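(* Let $n\ge 1$, let $\lambda_1,\dots,\lambda_n,\sigma_1,\dots,\sigma_n\in\mathbb C$, and put $\lambda_{n+1}=\sigma_{n+1}=0$. Assume that $\operatorname{Re}(\lambda_k-(n+k))>0$ and $\operatorname{Re}(\sigma_k-\lambda_k-(n-k))>0$ for $k=1,\dots,n$. Then, integrating over all pairs $(T,S)$ of complex $n\times n$ matrices with $T=T^*$ positive definite and $S=S^t$, $$\int\prod_{s=1}^n\frac{\det[T]_s^{\lambda_s-\lambda_{s+1}}}{\det[1+T+S\mathbf j]_s^{\sigma_s-\sigma_{s+1}}}\,\det T^{-(2n+1)}\,dT\,dS=\prod_{k=1}^n 2\pi^{2k-1}\,\frac{\Gamma(\lambda_k-(n+k))\,\Gamma(\sigma_k-\lambda_k-(n-k))}{\Gamma(\sigma_k-2(n-k)-1)} .$$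
   Context: $\mathbf i,\mathbf j,\mathbf k$ are the quaternionic imaginary units; $\mathbb C$ is embedded in the quaternions $\mathbb H$ with $i=\mathbf i$, so $1+T+S\mathbf j$ is a quaternionic $n\times n$ matrix. $[A]_s$ denotes the left upper $s\times s$ block of $A$. For a quaternionic $m\times m$ matrix $g$, $\det g:=\sqrt[4]{\det g_{\mathbb R}}$, where $g_{\mathbb R}$ is $g$ regarded as an operator on $\mathbb H^m\simeq\mathbb R^{4m}$ (for the positive definite complex matrix $[T]_s$ this is the usual determinant); $\det[A]_s^{a}$ means $(\det[A]_s)^a$ (all determinants occurring are positive). Lebesgue measures: $dT=\prod_k dt_{kk}\prod_{k<m}d\operatorname{Re}t_{km}\,d\operatorname{Im}t_{km}$; $dS=\prod_{k\le m}d\operatorname{Re}s_{km}\,d\operatorname{Im}s_{km}$. *)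

(* Defs.v *)
From HB Require Import structures.
From mathcomp Require Import all_boot all_order all_algebra.
From mathcomp Require Import all_classical all_reals all_analysis.
From mathcomp Require Import complex ring.

Set Implicit Arguments.
Unset Strict Implicit.
Unset Printing Implicit Defensive.

Import Order.TTheory GRing.Theory Num.Theory.
Import numFieldNormedType.Exports.

Local Open Scope classical_set_scope.
Local Open Scope ring_scope.
Local Open Scope complex_scope.

(* The quaternion Quat a b c d is a + b i + c j + d k. *)
Record quat (R : Type) := Quat { q1 : R; qi : R; qj : R; qk : R }.

Definition tuple_of_quat (R : Type) (x : quat R) := (q1 x, qi x, qj x, qk x).
Definition quat_of_tuple (R : Type) (x : R * R * R * R) :=
  let: (a, b, c, d) := x in Quat a b c d.
Lemma tuple_of_quatK (R : Type) :
  cancel (@tuple_of_quat R) (@quat_of_tuple R).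
Proof. by case. Qed.

HB.instance Definition _ (R : choiceType) :=
  Choice.copy (quat R) (can_type (@tuple_of_quatK R)).

Section QuatRing.
Variable R : comNzRingType.
Implicit Types x y z : quat R.

Definition qzero : quat R := Quat 0 0 0 0.
Definition qone : quat R := Quat 1 0 0 0.
Definition qopp x := Quat (- q1 x) (- qi x) (- qj x) (- qk x).
Definition qadd x y :=
  Quat (q1 x + q1 y) (qi x + qi y) (qj x + qj y) (qk x + qk y).
Definition qmul x y := Quat
  (q1 x * q1 y - qi x * qi y - qj x * qj y - qk x * qk y)
  (q1 x * qi y + qi x * q1 y + qj x * qk y - qk x * qj y)
  (q1 x * qj y - qi x * qk y + qj x * q1 y + qk x * qi y)
  (q1 x * qk y + qi x * qj y - qj x * qi y + qk x * q1 y).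

Lemma qaddA : associative qadd.
Proof. by move=> x y z; rewrite /qadd /= !addrA. Qed.
Lemma qaddC : commutative qadd.
Proof. by move=> x y; rewrite /qadd; congr Quat; rewrite addrC. Qed.
Lemma qadd0 : left_id qzero qadd.
Proof. by case=> a b c d; rewrite /qadd /= !add0r. Qed.
Lemma qaddN : left_inverse qzero qopp qadd.
Proof. by case=> a b c d; rewrite /qadd /= !addNr. Qed.
HB.instance Definition _ :=
  GRing.isZmodule.Build (quat R) qaddA qaddC qadd0 qaddN.

Lemma qmulA : associative qmul.
Proof.
by case=> ? ? ? ? [? ? ? ?] [? ? ? ?]; rewrite /qmul /=; congr Quat; ring.
Qed.
Lemma qmul1l : left_id qone qmul.
Proof. by case=> ? ? ? ?; rewrite /qmul /=; congr Quat; ring. Qed.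
Lemma qmul1r : right_id qone qmul.
Proof. by case=> ? ? ? ?; rewrite /qmul /=; congr Quat; ring. Qed.
Lemma qmulDl : left_distributive qmul qadd.
Proof.
by case=> ? ? ? ? [? ? ? ?] [? ? ? ?]; rewrite /qmul /qadd /=; congr Quat; ring.
Qed.
Lemma qmulDr : right_distributive qmul qadd.
Proof.
by case=> ? ? ? ? [? ? ? ?] [? ? ? ?]; rewrite /qmul /qadd /=; congr Quat; ring.
Qed.
Lemma qone_neq0 : qone != 0.
Proof. by apply/eqP => -[] /eqP; rewrite oner_eq0. Qed.
HB.instance Definition _ := GRing.Zmodule_isNzRing.Build (quat R)
  qmulA qmul1l qmul1r qmulDl qmulDr qone_neq0.

End QuatRing.

Definition quatJ (R : comNzRingType) : quat R := Quat 0 0 1 0.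

Definition quatC (R : comNzRingType) (z : R[i]) : quat R :=
  Quat (complex.Re z) (complex.Im z) 0 0.

Definition cmx_quat (R : comNzRingType) (m n : nat) (A : 'M[R[i]]_(m, n)) :
  'M[quat R]_(m, n) := map_mx (@quatC R) A.

(* H^m is identified with 'M[R]_(m, 4), row k holding the four real
   coordinates of the k-th entry. *)
Definition quat_col (R : comNzRingType) (m : nat) (v : 'M[R]_(m, 4)) :
  'cV[quat R]_m :=
  \col_k Quat (v k (inord 0)) (v k (inord 1)) (v k (inord 2)) (v k (inord 3)).

Definition real_coords (R : comNzRingType) (m : nat) (w : 'cV[quat R]_m) :
  'M[R]_(m, 4) :=
  \matrix_(k, l) nth 0 [:: q1 (w k 0); qi (w k 0); qj (w k 0); qk (w k 0)] l.

(* The matrix of the real operator v |-> g v on H^m = R^(4m); since lin_mx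
   encodes operators by their action on row vectors, it is the transpose of the
   column-vector matrix, which does not affect the determinant. *)
Definition realmx (R : comNzRingType) (m : nat) (g : 'M[quat R]_m) :
  'M[R]_(m * 4) :=
  lin_mx (fun v : 'M[R]_(m, 4) => real_coords (g *m quat_col v)).

Definition qdet (R : realType) (m : nat) (g : 'M[quat R]_m) : R :=
  (\det (realmx g)) `^ 4^-1.

(* The left upper block of size s + 1, for s < n. *)
Definition lublock (K : Type) (n : nat) (s : 'I_n) (A : 'M[K]_n) : 'M[K]_s.+1 :=
  mxsub (widen_ord (ltn_ord s)) (widen_ord (ltn_ord s)) A.

(* In R[i], 0 < z means that z is real and positive. *)
Definition posdefmx (R : realType) (n : nat) (T : 'M[R[i]]_n) : Prop :=
  T = (map_mx conjc T)^T /\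
  forall v : 'cV[R[i]]_n, v != 0 -> 0 < ((map_mx conjc v)^T *m T *m v) 0 0.

Definition cexp (R : realType) (z : R[i]) : R[i] :=
  (expR (complex.Re z))%:C *
  (cos (complex.Im z) +i* sin (complex.Im z)).

(* Represents a ^ z for real a > 0 only, since ln is a junk value elsewhere. *)
Definition cpow (R : realType) (a : R) (z : R[i]) : R[i] :=
  cexp (z * (ln a)%:C).

Definition cintegrable (d : measure_display) (T : measurableType d)
    (R : realType) (mu : set T -> \bar R) (D : set T) (f : T -> R[i]) : Prop :=
  mu.-integrable D (fun x => (complex.Re (f x))%:E) /\
  mu.-integrable D (fun x => (complex.Im (f x))%:E).

Definition cintegral (d : measure_display) (T : measurableType d)
    (R : realType) (mu : {measure set T -> \bar R}) (D : set T)
    (f : T -> R[i]) : R[i] :=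
  (\int[mu]_(x in D) complex.Re (f x)) +i* (\int[mu]_(x in D) complex.Im (f x)).

(* Euler's integral, which represents the Gamma function for 0 < Re z. *)
Definition cGamma (R : realType) (z : R[i]) : R[i] :=
  cintegral (@lebesgue_measure R) `]0, +oo[
    (fun x : R => cpow x (z - 1) * (expR (- x))%:C).

Section LebesgueTuple.
Variable R : realType.
Local Notation RT := (measurableTypeR R).

Definition cons_pair (N : nat) (x : RT * N.-tuple RT) : N.+1.-tuple RT :=
  [tuple of x.1 :: x.2].
Definition uncons (N : nat) (x : N.+1.-tuple RT) : RT * N.-tuple RT :=
  (thead x, [tuple of behead x]).

Lemma measurable_cons_pair (N : nat) : measurable_fun setT (@cons_pair N).
Proof. exact: (measurable_cons measurable_fst measurable_snd). Qed.

Lemma measurable_uncons (N : nat) : measurable_fun setT (@uncons N).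
Proof.
apply: measurable_fun_pair; last exact: measurable_behead.
exact: measurable_tnth.
Qed.

Lemma cons_pairK (N : nat) : cancel (@cons_pair N) (@uncons N).
Proof. by case=> x t; congr pair; apply: val_inj. Qed.

Section LebesgueCons.
Local Open Scope ereal_scope.
Variables (N : nat) (mu : {sigma_finite_measure set N.-tuple RT -> \bar R}).

Definition lebesgue_cons : set (N.+1.-tuple RT) -> \bar R :=
  pushforward (@lebesgue_measure R \x mu) (@cons_pair N).

Let mpre (A : set (N.+1.-tuple RT)) :
  measurable A -> measurable (@cons_pair N @^-1` A).
Proof.
by move=> mA; rewrite -[X in measurable X]setTI; exact: measurable_cons_pair.
Qed.

Let lebesgue_cons0 : lebesgue_cons set0 = 0.
Proof. by rewrite /lebesgue_cons /pushforward preimage_set0 measure0. Qed.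

Let lebesgue_cons_ge0 A : 0 <= lebesgue_cons A.
Proof. by rewrite /lebesgue_cons /pushforward; exact: measure_ge0. Qed.

Let lebesgue_cons_sigma_additive : semi_sigma_additive lebesgue_cons.
Proof.
move=> F mF tF mUF; rewrite /lebesgue_cons /pushforward preimage_bigcup.
apply: measure_semi_sigma_additive.
- by move=> n; exact: mpre.
- apply/trivIsetP => /= i j _ _ ij; rewrite -preimage_setI.
  by move/trivIsetP : tF => /(_ _ _ _ _ ij) ->//; rewrite preimage_set0.
- by rewrite -preimage_bigcup; exact: mpre.
Qed.

HB.instance Definition _ := isMeasure.Build _ _ _ lebesgue_cons
  lebesgue_cons0 lebesgue_cons_ge0 lebesgue_cons_sigma_additive.

Let lebesgue_cons_sigma_finite : sigma_finite setT lebesgue_cons.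
Proof.
have /sigma_finiteP[F [TF ndF Foo]] := sigma_finiteT (@lebesgue_measure R).
have /sigma_finiteP[G [TG ndG Goo]] := sigma_finiteT mu.
exists (fun k => @uncons N @^-1` (F k `*` G k)).
  rewrite -preimage_bigcup (_ : \bigcup_k (F k `*` G k) = setT) ?preimage_setT//.
  apply/seteqP; split=> // -[x y] _.
  have [n _ Fnx] : (\bigcup_k F k) x by rewrite -TF.
  have [k _ Gky] : (\bigcup_k G k) y by rewrite -TG.
  exists (maxn n k) => //; split.
  - by move: x Fnx; exact/subsetPset/ndF/leq_maxl.
  - by move: y Gky; exact/subsetPset/ndG/leq_maxr.
move=> k; have [mF ltF] := Foo k; have [mG ltG] := Goo k.
have mFG : measurable (F k `*` G k) by exact: measurableX.
split; first by rewrite -[X in measurable X]setTI; exact: measurable_uncons.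
rewrite /lebesgue_cons /pushforward -comp_preimage.
rewrite (_ : @uncons N \o @cons_pair N = id); last first.
  by rewrite funeqE; exact: cons_pairK.
by rewrite preimage_id product_measure1E// lte_mul_pinfty// ge0_fin_numE.
Qed.

HB.instance Definition _ := Measure_isSigmaFinite.Build _ _ _ lebesgue_cons
  lebesgue_cons_sigma_finite.

End LebesgueCons.

(* N-dimensional Lebesgue measure, on the Borel sets of R^N. *)
Fixpoint lebesgue_tuple (N : nat) :
    {sigma_finite_measure set N.-tuple RT -> \bar R} :=
  match N with
  | 0 => dirac ([tuple] : 0.-tuple RT)
  | N'.+1 => lebesgue_cons (lebesgue_tuple N')
  end.

End LebesgueTuple.

Definition tuple_mx (K : Type) (m n : nat) (x : (m * n).-tuple K) :
  'M[K]_(m, n) := vec_mx (\row_i tnth x i).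

(* A Hermitian matrix T is given by a real matrix a holding t_kk at (k, k) and,
   for k < l, Re t_kl at (k, l) and Im t_kl at (l, k). *)
Definition hermmx (R : realType) (n : nat) (a : 'M[R]_n) : 'M[R[i]]_n :=
  \matrix_(k, l) if k == l then (a k k)%:C
                 else if (k < l)%N then a k l +i* a l k else a l k -i* a k l.

(* A symmetric matrix S is given by a real (n + 1) x n matrix b holding, for
   k <= l, Re s_kl at (k, l) and Im s_kl at (l + 1, k). *)
Definition symmx (R : realType) (n : nat) (b : 'M[R]_(n.+1, n)) : 'M[R[i]]_n :=
  let s k l := b (widen_ord (leqnSn n) k) l +i* b (lift ord0 l) k in
  \matrix_(k, l) if (k <= l)%N then s k l else s l k.

Lemma hermmx_bij (R : realType) (n : nat) (T : 'M[R[i]]_n) :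
  T = (map_mx conjc T)^T <-> exists! a : 'M[R]_n, hermmx a = T.
Proof.
split=> [TE|[a [<- _]]]; last first.
  apply/matrixP => k l; rewrite !mxE eq_sym.
  case: eqVneq => [->|kl]; first by rewrite /= oppr0.
  case: ltngtP => //= [_|/val_inj kl']; first by rewrite opprK.
  by rewrite kl' eqxx in kl.
have TE' k l : T k l = conjc (T l k) by rewrite {1}TE !mxE.
exists (\matrix_(k, l) if (k <= l)%N then complex.Re (T k l)
                       else complex.Im (T l k)).
split=> [|a' <-].
  apply/matrixP => k l; rewrite !mxE.
  case: eqVneq => [->|kl].
    rewrite leqnn; have := TE' l l; case: (T l l) => x y /= [] /eqP.
    by rewrite -subr_eq0 opprK -mulr2n mulrn_eq0 /= => /eqP ->.
  case: ltngtP => [_|_|/val_inj kl']; last by rewrite kl' eqxx in kl.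
    by case: (T k l).
  by rewrite (TE' k l); case: (T l k).
apply/matrixP => k l; rewrite !mxE eq_sym.
case: eqVneq => [->|kl]; first by rewrite leqnn.
by case: ltngtP => // /val_inj kl'; rewrite kl' eqxx in kl.
Qed.

Lemma symmx_bij (R : realType) (n : nat) (S : 'M[R[i]]_n) :
  S = S^T <-> exists! b : 'M[R]_(n.+1, n), symmx b = S.
Proof.
split=> [SE|[b [<- _]]]; last first.
  by apply/matrixP => k l; rewrite !mxE; case: ltngtP => // /val_inj ->.
have SE' k l : S k l = S l k by rewrite {1}SE mxE.
pose b : 'M[R]_(n.+1, n) := \matrix_(k, l)
  if (k <= l)%N then complex.Re (S (insubd l (val k)) l)
  else complex.Im (S l (insubd l (val k).-1)).
exists b.
have insub_val (k l : 'I_n) : insubd l (val k) = k.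
  by apply: val_inj; rewrite val_insubd ltn_ord.
have sE (k l : 'I_n) : (k <= l)%N ->
    b (widen_ord (leqnSn n) k) l +i* b (lift ord0 l) k = S k l.
  move=> kl; rewrite !mxE /= /bump /= add1n kl ltnNge kl /= !insub_val (SE' k).
  by case: (S l k).
split=> [|b' Sb'].
  apply/matrixP => k l; rewrite mxE; case: leqP => [kl|/ltnW lk].
    exact: sE.
  by rewrite sE.
apply/matrixP => k l; rewrite /b -Sb' !mxE.
case: leqP => [kl|lk].
  have kn : (k < n)%N by exact: leq_ltn_trans kl (ltn_ord l).
  rewrite val_insubd kn kl /=; congr (b' _ _); apply: val_inj => /=.
  by rewrite val_insubd kn.
have k0 : (0 < k)%N by exact: leq_ltn_trans lk.
have kn : (k.-1 < n)%N by rewrite -ltnS prednK.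
rewrite val_insubd kn -ltnS prednK// lk /=.
congr (b' _ _); apply: val_inj => /=.
by rewrite /bump add1n val_insubd kn prednK.
Qed.

(* Main.v *)
Require Import Defs.
From HB Require Import structures.
From mathcomp Require Import all_boot all_order all_algebra.
From mathcomp Require Import all_classical all_reals all_analysis.
From mathcomp Require Import perm measurable_realfun.
From mathcomp Require Import complex ring lra.

Set Implicit Arguments.
Unset Strict Implicit.
Unset Printing Implicit Defensive.

Import Order.TTheory GRing.Theory Num.Theory.
Import numFieldNormedType.Exports.

Local Open Scope classical_set_scope.
Local Open Scope ring_scope.
Local Open Scope complex_scope.

(** The proof is an induction on the size, which removes the last row and
    column. Write T = (P, q; q^*, r) and S = (A, b; b^t, c), put
    X = 1 + P + A j, and let V in R^(4n) collect the quaternions q_k + b_k j.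
    Schur complements give

      det T = det P (r - delta),
      det (1 + T + S j) = det X sqrt ((1 + r - alpha)^2 + |c + c0|^2),

    where delta and alpha are real quadratic forms in V and c0 depends on V, and
    T is positive definite exactly when P is and delta < r (posdef_glue,
    qdet_glueT, qdet_glueS). Hence c, r and V occur only in the last factors of
    the two products and in the power of det T.

    These variables are integrated out in this order (hasI_border). The
    integral over c and the one over V have integrands (a + Q(v))^(- s) with Q a
    positive quadratic form; since Gamma(s) y^(- s) is the Laplace transform of
    t^(s - 1) at y, they reduce to Gaussian integrals (hasI_laplace, hasI_quad).
    The integral over r is a Beta integral, because 1 + r - alpha is
    (r - delta) + (1 + gamma) with gamma = delta - alpha. What remains is the
    integral over V of a power of 1 + gamma.

    Two facts about the form gamma make this work. It is positive definite
    (border_form_pos), and its determinant satisfies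
    (det gamma)^(- 1/2) = det P (det X)^2 (sqrt_det_gamma). The last two factors
    change the exponents lambda, sigma of the remaining integrand of size n into
    lambda - 1, sigma - 2 (coef_integrand), and the right-hand side obeys the
    same recursion (valueS). Both facts are proved for real matrices: P and A j
    act on H^n = R^(4n) by a symmetric and an antisymmetric matrix, the first
    commuting with the projections on the two complex halves of H^n and the
    second exchanging them.

    Absolute convergence comes from the same computation, since the modulus of
    the integrand is the integrand for the real parts of the exponents
    (normc_density). The constants are simplified by the recurrence and the
    nonvanishing of Gamma on the right half-plane (cGamma_rec, cGamma_neq0).

    The exponents are used in the form of the product of the powers
    (t_s / t_(s - 1))^(lambda_s) of ratios of consecutive leading minors, which
    summation by parts identifies with the given one (weight_abel); it has no
    boundary terms, so that a new row and column contribute one factor. *)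

(** * Integrals of complex functions *)

Section RealIntegral.
Context d (T : measurableType d) (R : realType).
Implicit Types (mu : {measure set T -> \bar R}) (f g : T -> R).

(** Integrability and the value of the integral in one statement, so that both
    are transported together. *)
Definition rint mu f (v : R) : Prop :=
  mu.-integrable setT (EFin \o f) /\ (\int[mu]_x (f x)%:E)%E = v%:E.

Lemma rint_meas mu f v : rint mu f v -> measurable_fun setT f.
Proof. by case=> /integrableP[/measurable_EFinP]. Qed.

Lemma rint_integrable mu f : mu.-integrable setT (EFin \o f) ->
  rint mu f (\int[mu]_x f x).
Proof.
move=> fi; split=> //; rewrite /Rintegral fineK//.
exact: integrable_fin_num fi.
Qed.

Lemma rint_uniq mu f v w : rint mu f v -> rint mu f w -> v = w.
Proof. by move=> [_ fv] [_ fw]; move: fw; rewrite fv => -[]. Qed.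

Lemma eq_rint mu f g v : f =1 g -> rint mu f v -> rint mu g v.
Proof. by move=> /funext ->. Qed.

Lemma rint_ge0 mu f v : measurable_fun setT f -> (forall x, 0 <= f x) ->
  (\int[mu]_x (f x)%:E)%E = v%:E -> rint mu f v.
Proof.
move=> mf f0 fv; split=> //; apply/integrableP; split.
  exact/measurable_EFinP.
by under eq_integral do rewrite /= ger0_norm//; rewrite fv ltry.
Qed.

Lemma rintD mu f g v w : rint mu f v -> rint mu g w ->
  rint mu (f \+ g) (v + w).
Proof.
move=> [fi fv] [gi gw]; split; first exact: (integrableD _ fi gi).
rewrite -[LHS]/(\int[mu]_x ((EFin \o f) x + (EFin \o g) x))%E.
by rewrite integralD//= fv gw.
Qed.

Lemma rintZ mu f v k : rint mu f v -> rint mu (fun x => k * f x) (k * v).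
Proof.
move=> [fi fv]; split; first exact: (integrableZl _ k fi).
rewrite -[LHS]/(\int[mu]_x (k%:E * (EFin \o f) x))%E.
by rewrite integralZl//= fv.
Qed.

Lemma rint_dom mu f g w : measurable_fun setT f -> (forall x, `|f x| <= g x) ->
  rint mu g w -> exists v, rint mu f v.
Proof.
move=> mf fg [gi _]; exists (\int[mu]_x f x); apply: rint_integrable.
apply: (le_integrable _ _ _ gi) => //; first exact/measurable_EFinP.
move=> x _ /=; rewrite lee_fin; apply: le_trans (fg x) _.
exact: ler_norm.
Qed.

End RealIntegral.

Section SigmaFiniteProduct.
Local Open Scope ereal_scope.
Context d1 d2 (T1 : measurableType d1) (T2 : measurableType d2) (R : realType).
Variables (m1 : {sigma_finite_measure set T1 -> \bar R})
  (m2 : {sigma_finite_measure set T2 -> \bar R}).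

Lemma sigma_finite_product : sigma_finite setT (m1 \x m2).
Proof.
have /sigma_finiteP[F [TF ndF Foo]] := sigma_finiteT m1.
have /sigma_finiteP[G [TG ndG Goo]] := sigma_finiteT m2.
exists (fun k => F k `*` G k).
  apply/seteqP; split=> // -[x y] _.
  have [i _ Fx] : (\bigcup_k F k) x by rewrite -TF.
  have [j _ Gy] : (\bigcup_k G k) y by rewrite -TG.
  exists (maxn i j) => //; split.
  - by move: x Fx; exact/subsetPset/ndF/leq_maxl.
  - by move: y Gy; exact/subsetPset/ndG/leq_maxr.
move=> k; have [mF ltF] := Foo k; have [mG ltG] := Goo k.
split; first exact: measurableX.
by rewrite product_measure1E// lte_mul_pinfty// ge0_fin_numE.
Qed.

(** The iterated integrals below involve products of products, and Fubini's
    theorem needs every factor to be sigma-finite. *)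
Definition sfprod : {sigma_finite_measure set (T1 * T2)%type -> \bar R} :=
  HB.pack (m1 \x m2) (Measure_isSigmaFinite.Build _ _ _ (m1 \x m2)
  sigma_finite_product).

Lemma sfprodE A B : measurable A -> measurable B ->
  sfprod (A `*` B) = m1 A * m2 B.
Proof. exact: product_measure1E. Qed.

End SigmaFiniteProduct.

Section RealFubini.
Context d1 d2 (T1 : measurableType d1) (T2 : measurableType d2) (R : realType).
Variables (m1 : {sigma_finite_measure set T1 -> \bar R})
  (m2 : {sigma_finite_measure set T2 -> \bar R}).
Implicit Type f : T1 * T2 -> R.

Lemma rint_fubini_inv f g v : rint (m1 \x m2)%E f v ->
  (forall x, rint m2 (fun y => f (x, y)) (g x)) -> rint m1 g v.
Proof.
move=> [fi fv] fg.
have gE : EFin \o g = fubini_F m2 (EFin \o f).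
  by apply/funext => x; rewrite /fubini_F /=; case: (fg x) => _ <-.
split; first by rewrite gE; exact: integrable_fubini_F.
by rewrite -[LHS]/(\int[m1]_x (EFin \o g) x)%E gE integral12_prod_meas1.
Qed.

Lemma rint_fubini_inv2 f g v : rint (m1 \x m2)%E f v ->
  (forall y, rint m1 (fun x => f (x, y)) (g y)) -> rint m2 g v.
Proof.
move=> [fi fv] fg.
have gE : EFin \o g = fubini_G m1 (EFin \o f).
  by apply/funext => x; rewrite /fubini_G /=; case: (fg x) => _ <-.
have mf : measurable_fun setT (EFin \o f) by case/integrableP : fi.
have mG : measurable_fun setT (fun y => \int[m1]_x `|(f (x, y))%:E|)%E.
  apply: (measurable_fun_fubini_tonelli_G (abse \o (EFin \o f))).
    exact: measurableT_comp.
  by move=> z /=.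
split.
  apply/integrableP; split; first by rewrite gE; exact: (measurable_fubini_G fi).
  apply: le_lt_trans ((integrable21ltyP m1 m2 mf).1 fi).
  apply: ge0_le_integral => //.
  - apply: measurableT_comp => //; rewrite gE; exact: (measurable_fubini_G fi).
  move=> y _; case: (fg y) => fyi E; rewrite -[(EFin \o g) y]E.
  by apply: le_abse_integral => //; case/integrableP : fyi.
by rewrite -[LHS]/(\int[m2]_x (EFin \o g) x)%E gE integral21_prod_meas1.
Qed.

(** Integrability is checked on a majorant h, whose iterated integrals G and V
    are supposed to be known. *)
Lemma rint_fubini f h g G v V : measurable_fun setT f ->
  (forall z, `|f z| <= h z) ->
  measurable_fun setT h ->
  (forall x, rint m2 (fun y => h (x, y)) (G x)) -> rint m1 G V ->
  (forall x, rint m2 (fun y => f (x, y)) (g x)) -> rint m1 g v ->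
  rint (m1 \x m2)%E f v.
Proof.
move=> mf fh mh hG GV fg gv.
have h0 z : 0 <= h z by exact: le_trans (normr_ge0 _) (fh z).
have hi : (m1 \x m2)%E.-integrable setT (EFin \o h).
  apply/integrable12ltyP; first exact/measurable_EFinP.
  have -> : (fun x => \int[m2]_y `|(EFin \o h) (x, y)|)%E = EFin \o G.
    apply/funext => x /=; case: (hG x) => _ <-.
    by apply: eq_integral => y _; rewrite ger0_norm.
  by case: GV => _ /= ->; rewrite ltry.
have [w fI] := rint_dom mf fh (rint_integrable hi).
by rewrite (rint_uniq gv (rint_fubini_inv fI fg)).
Qed.

Lemma rint_fubini2 f h g G v V : measurable_fun setT f ->
  (forall z, `|f z| <= h z) ->
  measurable_fun setT h ->
  (forall y, rint m1 (fun x => h (x, y)) (G y)) -> rint m2 G V ->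
  (forall y, rint m1 (fun x => f (x, y)) (g y)) -> rint m2 g v ->
  rint (m1 \x m2)%E f v.
Proof.
move=> mf fh mh hG GV fg gv.
have h0 z : 0 <= h z by exact: le_trans (normr_ge0 _) (fh z).
have hi : (m1 \x m2)%E.-integrable setT (EFin \o h).
  apply/integrable21ltyP; first exact/measurable_EFinP.
  have -> : (fun y => \int[m1]_x `|(EFin \o h) (x, y)|)%E = EFin \o G.
    apply/funext => y /=; case: (hG y) => _ <-.
    by apply: eq_integral => x _; rewrite ger0_norm.
  by case: GV => _ /= ->; rewrite ltry.
have [w fI] := rint_dom mf fh (rint_integrable hi).
by rewrite (rint_uniq gv (rint_fubini_inv2 fI fg)).
Qed.

End RealFubini.

Section ComplexMeasurable.
Context d (T : measurableType d) (R : realType).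
Implicit Types f g : T -> R[i].

Definition cmeas f : Prop := measurable_fun setT (fun x => complex.Re (f x)) /\
  measurable_fun setT (fun x => complex.Im (f x)).

Lemma cmeas_cst (z : R[i]) : cmeas (fun=> z).
Proof. by split; exact: measurable_cst. Qed.

Lemma cmeas_real (f : T -> R) : measurable_fun setT f ->
  cmeas (fun x => (f x)%:C).
Proof. by move=> mf; split=> //; exact: measurable_cst. Qed.

Lemma cmeasD f g : cmeas f -> cmeas g -> cmeas (fun x => f x + g x).
Proof.
move=> [f1 f2] [g1 g2]; split.
  apply: (eq_measurable_fun (fun x => complex.Re (f x) + complex.Re (g x))).
    by move=> x _; case: (f x) (g x) => ? ? [].
  exact: measurable_funD.
apply: (eq_measurable_fun (fun x => complex.Im (f x) + complex.Im (g x))).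
  by move=> x _; case: (f x) (g x) => ? ? [].
exact: measurable_funD.
Qed.

Lemma cmeasM f g : cmeas f -> cmeas g -> cmeas (fun x => f x * g x).
Proof.
move=> [f1 f2] [g1 g2]; split.
  apply: (eq_measurable_fun (fun x => complex.Re (f x) * complex.Re (g x) -
    complex.Im (f x) * complex.Im (g x))).
    by move=> x _; case: (f x) (g x) => ? ? [].
  by apply: measurable_funB; exact: measurable_funM.
apply: (eq_measurable_fun (fun x => complex.Re (f x) * complex.Im (g x) +
  complex.Im (f x) * complex.Re (g x))).
  by move=> x _; case: (f x) (g x) => ? ? [].
by apply: measurable_funD; exact: measurable_funM.
Qed.

Lemma cmeas_sum (I : Type) (r : seq I) (F : I -> T -> R[i]) :
  (forall i, cmeas (F i)) -> cmeas (fun x => \sum_(i <- r) F i x).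
Proof.
move=> mF; elim: r => [|i r IH].
  under [fun _ => _]funext do rewrite big_nil.
  exact: cmeas_cst.
under [fun _ => _]funext do rewrite big_cons.
exact: cmeasD.
Qed.

Lemma cmeas_prod (I : Type) (r : seq I) (F : I -> T -> R[i]) :
  (forall i, cmeas (F i)) -> cmeas (fun x => \prod_(i <- r) F i x).
Proof.
move=> mF; elim: r => [|i r IH].
  under [fun _ => _]funext do rewrite big_nil.
  exact: cmeas_cst.
under [fun _ => _]funext do rewrite big_cons.
exact: cmeasM.
Qed.

Lemma cmeas_det n (A : T -> 'M[R[i]]_n) :
  (forall i j, cmeas (fun x => A x i j)) -> cmeas (fun x => \det (A x)).
Proof.
move=> mA; apply: cmeas_sum => s; apply: cmeasM; first exact: cmeas_cst.
by apply: cmeas_prod => i; exact: mA.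
Qed.

Lemma cmeas_if (D : set T) f : measurable D -> cmeas f ->
  cmeas (fun x => if x \in D then f x else 0).
Proof.
move=> mD mf.
have -> : (fun x => if x \in D then f x else 0) =
    (fun x => (\1_D x)%:C * f x).
  apply/funext => x; rewrite indicE; case: (x \in D); first by rewrite mul1r.
  by rewrite mul0r.
by apply: cmeasM => //; apply: cmeas_real; exact: measurable_indic.
Qed.

Lemma normcE (z : R[i]) :
  Normc.normc z = Num.sqrt (complex.Re z ^+ 2 + complex.Im z ^+ 2).
Proof. by case: z. Qed.

Lemma Re_le_normc (z : R[i]) : `|complex.Re z| <= Normc.normc z.
Proof. by rewrite normcE -sqrtr_sqr ler_wsqrtr// lerDl sqr_ge0. Qed.

Lemma Im_le_normc (z : R[i]) : `|complex.Im z| <= Normc.normc z.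
Proof. by rewrite normcE -sqrtr_sqr ler_wsqrtr// lerDr sqr_ge0. Qed.

Lemma cmeas_normc f : cmeas f ->
  measurable_fun setT (fun x => Normc.normc (f x)).
Proof.
move=> [f1 f2]; under [fun _ => _]funext do rewrite normcE.
apply: measurableT_comp; last first.
  by apply: measurable_funD; exact: measurable_funX.
by apply: continuous_measurable_fun; exact: sqrt_continuous.
Qed.

End ComplexMeasurable.

Section ComplexSection.
Context d1 d2 (T1 : measurableType d1) (T2 : measurableType d2) (R : realType).
Implicit Type f : T1 * T2 -> R[i].

Lemma cmeas_comp (h : T1 -> T2) (f : T2 -> R[i]) : measurable_fun setT h ->
  cmeas f -> cmeas (f \o h).
Proof.
move=> mh [f1 f2].
split; [exact: (measurableT_comp f1 mh)|exact: (measurableT_comp f2 mh)].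
Qed.

End ComplexSection.

Section ComplexIntegral.
Context d (T : measurableType d) (R : realType).
Implicit Types (mu : {measure set T -> \bar R}) (f g : T -> R[i]).

Definition hasI mu f (v : R[i]) : Prop :=
  rint mu (fun x => complex.Re (f x)) (complex.Re v) /\
  rint mu (fun x => complex.Im (f x)) (complex.Im v).

Lemma hasI_meas mu f v : hasI mu f v -> cmeas f.
Proof. by move=> [/rint_meas ? /rint_meas]. Qed.

Lemma eq_hasI mu f g v : f =1 g -> hasI mu f v -> hasI mu g v.
Proof. by move=> /funext ->. Qed.

Lemma hasI_uniq mu f v w : hasI mu f v -> hasI mu f w -> v = w.
Proof.
move=> [f1 f2] [f3 f4]; have := rint_uniq f1 f3; have := rint_uniq f2 f4.
by case: v w {f1 f2 f3 f4} => ? ? [? ?] /= -> ->.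
Qed.

Lemma hasI_real mu (f : T -> R) v :
  rint mu f v <-> hasI mu (fun x => (f x)%:C) v%:C.
Proof.
split=> [fv|[]//]; split=> //; split.
  by rewrite (_ : _ \o _ = cst 0%E)//; exact: integrable0.
by rewrite /= integral0.
Qed.

Lemma hasI0 mu : hasI mu (fun=> 0) 0.
Proof.
have h : rint mu (fun=> 0) 0.
  split; last by rewrite integral0.
  by rewrite (_ : _ \o _ = cst 0%E)//; exact: integrable0.
by split.
Qed.

Lemma hasIZ mu f v (k : R[i]) : hasI mu f v ->
  hasI mu (fun x => k * f x) (k * v).
Proof.
move=> [f1 f2].
have E (h z : R[i]) : complex.Re (h * z) = complex.Re h * complex.Re z +
    (- complex.Im h) * complex.Im z.
  by case: h z => ? ? [? ?]; rewrite mulNr.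
have E' (h z : R[i]) : complex.Im (h * z) = complex.Re h * complex.Im z +
    complex.Im h * complex.Re z.
  by case: h z => ? ? [? ?].
split.
  rewrite E; under [fun _ => _]funext do rewrite E.
  by apply: (@rintD _ _ _ mu (fun x => _ * _) (fun x => _ * _)); exact: rintZ.
rewrite E'; under [fun _ => _]funext do rewrite E'.
by apply: (@rintD _ _ _ mu (fun x => _ * _) (fun x => _ * _)); exact: rintZ.
Qed.

Lemma hasI_dom mu f (g : T -> R) w : cmeas f ->
  (forall x, Normc.normc (f x) <= g x) ->
  hasI mu (fun x => (g x)%:C) w -> exists v, hasI mu f v.
Proof.
move=> [f1 f2] fg [gi _].
have [v fv] := rint_dom f1 (fun x => le_trans (Re_le_normc _) (fg x)) gi.
have [v' fv'] := rint_dom f2 (fun x => le_trans (Im_le_normc _) (fg x)) gi.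
by exists (v +i* v').
Qed.

(** Integrals over D are treated as integrals over the whole space of the
    extension by 0. *)
Lemma cintegral_hasI mu f v (D : set T) : measurable D ->
  hasI mu (fun x => if x \in D then f x else 0) v ->
  cintegrable mu D f /\ cintegral mu D f = v.
Proof.
move=> mD [[f1 v1] [f2 v2]].
have E1 : EFin \o (fun x => complex.Re (if x \in D then f x else 0)) =
    (fun x => (complex.Re (f x))%:E) \_ D.
  by apply/funext => x; rewrite patchE /=; case: ifP.
have E2 : EFin \o (fun x => complex.Im (if x \in D then f x else 0)) =
    (fun x => (complex.Im (f x))%:E) \_ D.
  by apply/funext => x; rewrite patchE /=; case: ifP.
split; first by split; apply/integrable_mkcond => //; rewrite -?E1 -?E2.
case: v v1 v2 => v1 v2 /= V1 V2.
by rewrite /cintegral /Rintegral; congr (_ +i* _);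
  rewrite integral_mkcond -?E1 -?E2 ?V1 ?V2.
Qed.

End ComplexIntegral.

Section ComplexFubini.
Context d1 d2 (T1 : measurableType d1) (T2 : measurableType d2) (R : realType).
Variables (m1 : {sigma_finite_measure set T1 -> \bar R})
  (m2 : {sigma_finite_measure set T2 -> \bar R}).
Implicit Type f : T1 * T2 -> R[i].

Lemma hasI_fubini_inv f g v : hasI (m1 \x m2)%E f v ->
  (forall x, hasI m2 (fun y => f (x, y)) (g x)) -> hasI m1 g v.
Proof.
move=> [f1 f2] fg; split.
  by apply: (rint_fubini_inv f1) => x; case: (fg x).
by apply: (rint_fubini_inv f2) => x; case: (fg x).
Qed.

(** Absolute convergence is the integrability, in iterated form, of the
    modulus; for the integrands below the modulus is the same integrand with
    the exponents replaced by their real parts. *)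
Lemma hasI_fubini f g G v V : cmeas f ->
  (forall x, hasI m2 (fun y => (Normc.normc (f (x, y)))%:C)
    (G x)) -> hasI m1 G V ->
  (forall x, hasI m2 (fun y => f (x, y)) (g x)) -> hasI m1 g v ->
  hasI (m1 \x m2)%E f v.
Proof.
move=> mf hG [GV _] fg [gv1 gv2].
have mh := cmeas_normc mf; case: mf => mf1 mf2; split.
  apply: (rint_fubini mf1 (fun z => Re_le_normc _) mh) GV _ gv1 => x.
    by case: (hG x).
  by case: (fg x).
apply: (rint_fubini mf2 (fun z => Im_le_normc _) mh) GV _ gv2 => x.
  by case: (hG x).
by case: (fg x).
Qed.

Lemma hasI_fubini2 f g G v V : cmeas f ->
  (forall y, hasI m1 (fun x => (Normc.normc (f (x, y)))%:C)
    (G y)) -> hasI m2 G V ->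
  (forall y, hasI m1 (fun x => f (x, y)) (g y)) -> hasI m2 g v ->
  hasI (m1 \x m2)%E f v.
Proof.
move=> mf hG [GV _] fg [gv1 gv2].
have mh := cmeas_normc mf; case: mf => mf1 mf2; split.
  apply: (rint_fubini2 mf1 (fun z => Re_le_normc _) mh) GV _ gv1 => y.
    by case: (hG y).
  by case: (fg y).
apply: (rint_fubini2 mf2 (fun z => Im_le_normc _) mh) GV _ gv2 => y.
  by case: (hG y).
by case: (fg y).
Qed.

End ComplexFubini.

Section ComplexPushforward.
Context d1 d2 (T1 : measurableType d1) (T2 : measurableType d2) (R : realType).
Variables (m1 : {measure set T1 -> \bar R}) (m2 : {measure set T2 -> \bar R}).
Variables (phi : T1 -> T2) (mphi : measurable_fun setT phi).
Hypothesis m12 : forall A, measurable A -> m2 A = m1 (phi @^-1` A).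

Lemma rint_push (f : T2 -> R) v : measurable_fun setT f ->
  rint m1 (f \o phi) v -> rint m2 f v.
Proof.
move=> mf [fi fv].
have mf' : measurable_fun setT (EFin \o f) by exact/measurable_EFinP.
have E (g : T2 -> \bar R) : (\int[m2]_x g x =
    \int[pushforward m1 phi]_x g x)%E.
  by apply: eq_measure_integral => A mA _; rewrite /= m12.
have fi' : m1.-integrable (phi @^-1` setT) ((EFin \o f) \o phi).
  by rewrite preimage_setT.
split.
  have /integrableP[_ fi2] := integrable_pushforward mphi mf' fi' measurableT.
  by apply/integrableP; split=> //; rewrite E.
rewrite E; have := integral_pushforward mphi mf' fi' measurableT.
by rewrite preimage_setT => ->.
Qed.

(** Change of variables along a map that carries m1 to m2. *)
Lemma hasI_push (f : T2 -> R[i]) v : cmeas f -> hasI m1 (f \o phi) v ->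
  hasI m2 f v.
Proof.
by move=> [mf1 mf2] [f1 f2]; split; apply: rint_push.
Qed.

End ComplexPushforward.

(** * Complex powers of positive numbers *)

Section ComplexPower.
Variable R : realType.
Implicit Types (z w : R[i]) (a b : R).
Local Notation normc := Normc.normc.

Lemma cexpD z w : cexp (z + w) = cexp z * cexp w.
Proof.
case: z w => x y [u v]; rewrite /cexp /=.
rewrite expRD cosD sinD; apply/eqP; rewrite eq_complex /=.
by apply/andP; split; apply/eqP; ring.
Qed.

Lemma cexp0 : cexp (0 : R[i]) = 1.
Proof. by rewrite /cexp /= expR0 cos0 sin0 mul1r. Qed.

Lemma cexp_real a : cexp a%:C = (expR a)%:C.
Proof. by rewrite /cexp /= cos0 sin0 mulr1. Qed.

Lemma cexp_neq0 z : cexp z != 0.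
Proof.
apply/eqP => z0; have := cexpD z (- z); rewrite subrr cexp0 z0 mul0r => /eqP.
by rewrite oner_eq0.
Qed.

Lemma cexpN z : cexp (- z) = (cexp z)^-1.
Proof.
apply: (mulfI (cexp_neq0 z)); rewrite -cexpD subrr cexp0 divff//.
exact: cexp_neq0.
Qed.

Lemma normc_cexp z : normc (cexp z) = expR (complex.Re z).
Proof.
rewrite /cexp Normc.normcM normcE /= expr0n addr0 sqrtr_sqr.
by rewrite cos2Dsin2 sqrtr1 mulr1 ger0_norm ?expR_ge0.
Qed.

Lemma cpowD a z w : cpow a (z + w) = cpow a z * cpow a w.
Proof. by rewrite /cpow mulrDl cexpD. Qed.

Lemma cpowN a z : cpow a (- z) = (cpow a z)^-1.
Proof. by rewrite /cpow mulNr cexpN. Qed.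

Lemma cpowB a z w : cpow a (z - w) = cpow a z / cpow a w.
Proof. by rewrite cpowD cpowN. Qed.

Lemma cpow0 a : cpow a 0 = 1.
Proof. by rewrite /cpow mul0r cexp0. Qed.

Lemma cpow_neq0 a z : cpow a z != 0.
Proof. exact: cexp_neq0. Qed.

Lemma cpow1x z : cpow 1 z = 1.
Proof. by rewrite /cpow ln1 mulr0 cexp0. Qed.

Lemma cpow_real a b : cpow a b%:C = (expR (b * ln a))%:C.
Proof. by rewrite /cpow -rmorphM cexp_real. Qed.

Lemma cpowx1 a : 0 < a -> cpow a 1 = a%:C.
Proof. by move=> a0; rewrite (cpow_real a 1) mul1r lnK. Qed.

Lemma cpow_nat a n : 0 < a -> cpow a n%:R = (a ^+ n)%:C.
Proof.
move=> a0; elim: n => [|n IH]; first by rewrite cpow0 expr0.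
by rewrite -natr1 cpowD IH cpowx1// exprSr rmorphM.
Qed.

Lemma cpowM a b z : 0 < a -> 0 < b -> cpow (a * b) z = cpow a z * cpow b z.
Proof. by move=> a0 b0; rewrite /cpow lnM// rmorphD mulrDr cexpD. Qed.

Lemma cpowV a z : 0 < a -> cpow a^-1 z = cpow a (- z).
Proof. by move=> a0; rewrite /cpow lnV// rmorphN mulrN mulNr. Qed.

Lemma normc_cpow a z : normc (cpow a z) = expR (complex.Re z * ln a).
Proof.
rewrite /cpow normc_cexp; congr expR; case: z => x y /=.
by rewrite mulr0 subr0.
Qed.

Lemma normc_cpowC a z : (normc (cpow a z))%:C = cpow a (complex.Re z)%:C.
Proof. by rewrite normc_cpow cpow_real. Qed.

Lemma normc_real a : 0 <= a -> normc a%:C = a.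
Proof. by move=> a0; rewrite normcE /= expr0n addr0 sqrtr_sqr ger0_norm. Qed.

Lemma ln_sqrt a : 0 < a -> ln (Num.sqrt a) = ln a / 2.
Proof.
move=> a0; have s0 : 0 < Num.sqrt a by rewrite sqrtr_gt0.
have -> : ln a = ln (Num.sqrt a ^+ 2) by rewrite sqr_sqrtr// ltW.
by rewrite lnXn//; lra.
Qed.

Lemma cpow_sqrt a z : 0 < a -> cpow (Num.sqrt a) z = cpow a (z / 2).
Proof.
move=> a0; rewrite /cpow ln_sqrt// rmorphM /= -!mulrA; congr (cexp (_ * _)).
by rewrite mulrC; congr (_ * _); rewrite fmorphV rmorph_nat.
Qed.

Lemma cpow_sqr a z : 0 < a -> cpow (a ^+ 2) z = cpow a (2 * z).
Proof.
move=> a0; have {2}-> : a = Num.sqrt (a ^+ 2) by rewrite sqrtr_sqr gtr0_norm.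
by rewrite cpow_sqrt ?exprn_gt0//; congr cpow; rewrite mulrAC mulfV ?mul1r ?pnatr_eq0.
Qed.

Lemma cmeas_cpow d (T : measurableType d) (f : T -> R) z :
  measurable_fun setT f -> cmeas (fun x => cpow (f x) z).
Proof.
move=> mf; have ml (k : R) : measurable_fun setT (fun x => k * ln (f x)).
  apply: measurable_funM; first exact: measurable_cst.
  exact: (measurableT_comp (@measurable_ln R) mf).
have -> : (fun x => cpow (f x) z) = (fun x =>
    (expR (complex.Re z * ln (f x)))%:C *
    (cos (complex.Im z * ln (f x)) +i* sin (complex.Im z * ln (f x)))).
  apply/funext => x; rewrite /cpow /cexp; case: z => u v /=.
  by rewrite !mulr0 subr0 add0r.
apply: cmeasM.
  apply: cmeas_real; exact: (measurableT_comp (@measurable_expR R) (ml _)).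
split => /=.
  apply: (measurableT_comp _ (ml _)).
  by apply: continuous_measurable_fun; exact: continuous_cos.
apply: (measurableT_comp _ (ml _)).
by apply: continuous_measurable_fun; exact: continuous_sin.
Qed.

End ComplexPower.

(** * Affine substitutions on the line *)

Section AffineLebesgue.
Variable R : realType.
Local Notation leb := (@lebesgue_measure R).

(** Both sides agree on the intervals ]c, d]. *)
Lemma lebesgue_affine (a : {nonneg R}) (b : R) (A : set R) : 0 < a%:num -> measurable A ->
  leb A = mscale a leb ((fun x : R => a%:num * x + b) @^-1` A).
Proof.
move=> a0 mA; set phi := fun x : R => _.
have mphi : measurable_fun setT phi.
  by apply: measurable_funD => //; exact: measurable_funM.
suff : forall A, measurable A -> leb A =
    pushforward (mscale a leb) (phi : measurableTypeR R -> measurableTypeR R) A.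
  exact.
apply: lebesgue_measure_unique => X -[[c d] /= cd <-].
rewrite /pushforward /mscale /=.
have -> : phi @^-1` `]c, d] = `](c - b) / a%:num, (d - b) / a%:num]%classic.
  apply/seteqP; split => x /=; rewrite !in_itv/= /phi ltr_pdivrMr// ler_pdivlMr//;
    rewrite ltrBlDr lerBrDr mulrC//.
rewrite !lebesgue_measure_itv/= !lte_fin ltr_pM2r ?invr_gt0// ltrD2r.
case: ifPn => _; last by rewrite mule0.
by rewrite -!EFinB -EFinM -mulrBl opprB addrA subrK mulrC divfK ?gt_eqF.
Qed.

(** The pushforward formula is available for nonnegative functions; it is applied
    to the positive and the negative part. *)
Lemma rint_affine (a b : R) (f : R -> R) v : 0 < a ->
  rint leb f v -> rint leb (fun x => f (a * x + b)) (v / a).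
Proof.
move=> a0 [fi fv].
have /integrableP[/measurable_EFinP mf _] := fi.
have mphi : measurable_fun setT (fun x : R => a * x + b).
  by apply: measurable_funD => //; exact: measurable_funM.
have mf' : measurable_fun setT (fun x => f (a * x + b)).
  exact: (measurableT_comp mf mphi).
pose an := NngNum (ltW a0).
have ne : a != 0 by rewrite gt_eqF.
have H (g : R -> R) w : measurable_fun setT g -> (forall x, 0 <= g x) ->
    rint leb g w -> rint leb (fun x => g (a * x + b)) (w / a).
  move=> mg g0 [_ gw].
  have mg' : measurable_fun setT (EFin \o g) by exact/measurable_EFinP.
  have E : (\int[leb]_x (g x)%:E = a%:E * \int[leb]_x (g (a * x + b)%R)%:E)%E.
    transitivity (\int[pushforward (mscale an leb)
        ((fun x : R => a * x + b)%R : measurableTypeR R -> measurableTypeR R)]_x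
        (EFin \o g) x)%E.
      apply: eq_measure_integral => A mA _ /=.
      by rewrite (@lebesgue_affine an b).
    rewrite ge0_integral_pushforward//; last by move=> x _; rewrite /= lee_fin.
    rewrite preimage_setT ge0_integral_mscale//.
      exact: (measurableT_comp mg' mphi).
    by move=> x _; rewrite /= lee_fin.
  apply: rint_ge0 => //; first exact: (measurableT_comp mg mphi).
  move: E; rewrite gw; case: (\int[leb]_x _)%E => [r|/eqP|/eqP].
  - by move=> [->]; rewrite mulrAC divff ?mul1r.
  - by rewrite gt0_muley ?lte_fin// eqe.
  - by rewrite gt0_muleNy ?lte_fin.
have mp := measurable_funrpos mf; have mn := measurable_funrneg mf.
have p0 x : 0 <= f^\+ x by rewrite /funrpos le_max lexx orbT.
have n0 x : 0 <= f^\- x by rewrite /funrneg le_max lexx orbT.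
have fa : rint leb (fun x => `|f x|) (\int[leb]_x `|f x|).
  exact/rint_integrable/integrable_norm.
have [|P fP] := rint_dom mp _ fa.
  by move=> x; rewrite ger0_norm// /funrpos ge_max normr_ge0 ler_norm.
have [|N fN] := rint_dom mn _ fa.
  by move=> x; rewrite ger0_norm// /funrneg ge_max normr_ge0 -normrN ler_norm.
have fE x : f x = f^\+ x + -1 * f^\- x.
  rewrite /funrpos /funrneg /Order.max; do 2 case: ifPn; lra.
have vE : v = P + -1 * N.
  apply: rint_uniq (conj fi fv) _; apply: eq_rint (rintD fP (rintZ (-1) fN)).
  by move=> x /=; rewrite -fE.
have := rintD (H _ _ mp p0 fP) (rintZ (-1) (H _ _ mn n0 fN)).
rewrite mulrA -mulrDl -vE; apply: eq_rint => x /=.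
by rewrite [RHS]fE.
Qed.

Lemma hasI_affine (a b : R) (f : R -> R[i]) v : 0 < a ->
  hasI leb f v -> hasI leb (fun x => f (a * x + b)) (v / a%:C).
Proof.
move=> a0 [f1 f2]; rewrite -fmorphV mulrC.
have E : complex.Re (a^-1%:C * v) = complex.Re v / a.
  by case: v {f1 f2} => ? ? /=; rewrite mul0r subr0 mulrC.
have E' : complex.Im (a^-1%:C * v) = complex.Im v / a.
  by case: v {f1 f2 E} => ? ? /=; rewrite mul0r addr0 mulrC.
by split; rewrite ?E ?E'; [apply: rint_affine f1|apply: rint_affine f2].
Qed.

End AffineLebesgue.

(** * The Gamma integral *)

Section PowerPrimitive.
Variable R : realType.
Local Notation leb := (@lebesgue_measure R).
Implicit Types (s : R[i]) (t e : R).

Lemma Re_cpow t s : complex.Re (cpow t s) =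
  expR (complex.Re s * ln t) * cos (complex.Im s * ln t).
Proof. by case: s => x y; rewrite /cpow /cexp /= !mulr0 !subr0 add0r !mul0r subr0. Qed.

Lemma Im_cpow t s : complex.Im (cpow t s) =
  expR (complex.Re s * ln t) * sin (complex.Im s * ln t).
Proof. by case: s => x y; rewrite /cpow /cexp /= !mulr0 !subr0 add0r !mul0r addr0. Qed.

Lemma expR_lnM1 t (x : R) : 0 < t ->
  expR ((x - 1) * ln t) = expR (x * ln t) * t^-1.
Proof. by move=> t0; rewrite mulrBl mul1r expRB lnK. Qed.

Lemma is_derive_exp_ln (g g' : R -> R) (u v t : R) : 0 < t ->
  (forall x : R, is_derive x 1 g (g' x)) ->
  is_derive t 1 (fun x => expR (u * ln x) * g (v * ln x))
    (u * (expR ((u - 1) * ln t) * g (v * ln t)) +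
     v * (expR ((u - 1) * ln t) * g' (v * ln t))).
Proof.
move=> t0 dg; have dl : is_derive t 1 (@ln R) t^-1 by exact: is_derive1_ln.
have du (k : R) : is_derive t 1 (fun x => k * ln x) (k * t^-1).
  exact: is_deriveZ.
have de := @is_derive1_comp R expR (fun x => u * ln x) t _ _
  (is_derive_expR _) (du u).
have dc := @is_derive1_comp R g (fun x => v * ln x) t _ _ (dg _) (du v).
apply: is_derive_eq (is_deriveM de dc) _.
by rewrite expR_lnM1// /GRing.scale /=; ring.
Qed.

Let ReIm1 s : (complex.Re (s - 1) = complex.Re s - 1) *
  (complex.Im (s - 1) = complex.Im s).
Proof. by case: s => a b; split => //=; rewrite subr0. Qed.

Lemma is_derive_Re_cpow s t : 0 < t ->
  is_derive t 1 (fun x => complex.Re (cpow x s)) (complex.Re (s * cpow t (s - 1))).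
Proof.
move=> t0; under [fun _ => _]funext do rewrite Re_cpow.
apply: is_derive_eq (is_derive_exp_ln _ _ t0 (@is_derive_cos R)) _.
have -> : complex.Re (s * cpow t (s - 1)) = complex.Re s *
    complex.Re (cpow t (s - 1)) - complex.Im s * complex.Im (cpow t (s - 1)).
  by case: (cpow t (s - 1)) => ? ?; clear; case: s.
by rewrite Re_cpow Im_cpow !ReIm1; ring.
Qed.

Lemma is_derive_Im_cpow s t : 0 < t ->
  is_derive t 1 (fun x => complex.Im (cpow x s)) (complex.Im (s * cpow t (s - 1))).
Proof.
move=> t0; under [fun _ => _]funext do rewrite Im_cpow.
apply: is_derive_eq (is_derive_exp_ln _ _ t0 (@is_derive_sin R)) _.
have -> : complex.Im (s * cpow t (s - 1)) = complex.Re s *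
    complex.Im (cpow t (s - 1)) + complex.Im s * complex.Re (cpow t (s - 1)).
  by case: (cpow t (s - 1)) => ? ?; clear; case: s.
by rewrite Re_cpow Im_cpow !ReIm1; ring.
Qed.

Lemma rint_FTC (f F : R -> R) (a b : R) : a < b ->
  (forall t, 0 < t -> is_derive t 1 F (f t)) ->
  (forall t, 0 < t -> {for t, continuous f}) -> 0 < a ->
  rint leb (fun t => if a <= t <= b then f t else 0) (F b - F a).
Proof.
move=> ab dF cf a0.
have cont t : 0 < t -> {for t, continuous F}.
  move=> t0; apply: differentiable_continuous.
  by apply/derivable1_diffP; case: (dF t t0).
have b0 : 0 < b by exact: lt_trans ab.
have cfw : {within `[a, b], continuous f}.
  apply: continuous_in_subspaceT => t; rewrite inE /= in_itv/= => /andP[at_ _].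
  by apply: cf; exact: lt_le_trans at_.
have E : (fun t => if a <= t <= b then f t else 0) = f \_ `[a, b].
  apply/funext => t; rewrite patchE; case: ifPn => tab.
    by rewrite mem_set//= in_itv.
  by rewrite memNset//= in_itv; exact/negP.
split.
  rewrite E -restrict_EFin; apply/(integrable_mkcond _ _).1 => //.
  by apply: continuous_compact_integrable => //; exact: segment_compact.
transitivity (\int[leb]_(x in `[a, b]) (f x)%:E)%E.
  rewrite [RHS]integral_mkcond restrict_EFin -E.
  by apply: eq_integral.
rewrite (@continuous_FTC2 _ f F)//; first split.
- move=> t; rewrite in_itv/= => /andP[at_ _].
  by case: (dF t (lt_trans a0 at_)).
- by apply: cvg_at_right_filter; exact: cont.
- by apply: cvg_at_left_filter; exact: cont.
- move=> t; rewrite in_itv/= => /andP[at_ _].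
  by rewrite derive1E; case: (dF t (lt_trans a0 at_)).
Qed.

Lemma continuous_Re_cpow s t : 0 < t ->
  {for t, continuous (fun x => complex.Re (cpow x s))}.
Proof.
move=> t0; apply: differentiable_continuous; apply/derivable1_diffP.
by case: (is_derive_Re_cpow s t0).
Qed.

Lemma continuous_Im_cpow s t : 0 < t ->
  {for t, continuous (fun x => complex.Im (cpow x s))}.
Proof.
move=> t0; apply: differentiable_continuous; apply/derivable1_diffP.
by case: (is_derive_Im_cpow s t0).
Qed.

(** Away from 0 the power t ^ s is a primitive of s t ^ (s - 1). *)
Lemma hasI_cpow_seg s e : 0 < e < 1 ->
  hasI leb (fun t => if e <= t <= 1 then s * cpow t (s - 1) else 0)
    (1 - cpow e s).
Proof.
move=> /andP[e0 e1].
have R1 (z w : R[i]) : complex.Re (z * w) =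
  complex.Re z * complex.Re w - complex.Im z * complex.Im w.
  by case: z w => ? ? [].
have I1 (z w : R[i]) : complex.Im (z * w) =
  complex.Re z * complex.Im w + complex.Im z * complex.Re w.
  by case: z w => ? ? [].
split.
  have -> : complex.Re (1 - cpow e s) =
      complex.Re (cpow 1 s) - complex.Re (cpow e s).
    by rewrite cpow1x; case: (cpow e s).
  apply: eq_rint (rint_FTC e1 (is_derive_Re_cpow s) _ e0).
    by move=> t; case: ifP.
  move=> t t0; have -> := funext (fun x => R1 s (cpow x (s - 1))).
  apply: cvgB; apply: cvgM; [exact: cvg_cst| |exact: cvg_cst|].
    exact: continuous_Re_cpow.
  exact: continuous_Im_cpow.
have -> : complex.Im (1 - cpow e s) =
    complex.Im (cpow 1 s) - complex.Im (cpow e s).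
  by rewrite cpow1x; case: (cpow e s).
apply: eq_rint (rint_FTC e1 (is_derive_Im_cpow s) _ e0).
  by move=> t; case: ifP.
move=> t t0; have -> := funext (fun x => I1 s (cpow x (s - 1))).
apply: cvgD; apply: cvgM; [exact: cvg_cst| |exact: cvg_cst|].
  exact: continuous_Im_cpow.
exact: continuous_Re_cpow.
Qed.

End PowerPrimitive.

Section GammaIntegrable.
Variable R : realType.
Local Notation leb := (@lebesgue_measure R).
Implicit Types (z s : R[i]) (t a r : R).
Local Notation normc := Normc.normc.

Lemma measurable_pos : measurable ([set t : R | 0 < t] : set (measurableTypeR R)).
Proof.
rewrite (_ : [set t | _] = `]0, +oo[%classic) //.
by apply/seteqP; split => t /=; rewrite in_itv/= andbT.
Qed.

Lemma cmeas_ifpos (f : measurableTypeR R -> R[i]) : cmeas f ->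
  cmeas (fun t : measurableTypeR R => if 0 < t then f t else 0).
Proof.
move=> mf; have := cmeas_if measurable_pos mf.
have -> // : (fun t => if t \in [set t : R | 0 < t] then f t else 0) =
  (fun t => if 0 < t then f t else 0).
apply/funext => t; congr (if _ then _ else _).
by apply/idP/idP => [/set_mem|] // t0; exact: mem_set.
Qed.

(** The density of the exponential law has total mass 1. *)
Lemma rint_exp r : 0 < r ->
  rint leb (fun t => if 0 < t then expR (- (r * t)) else 0) r^-1.
Proof.
move=> r0; set f := fun t => _.
have mf : measurable_fun setT f.
  have [|+ _] := @cmeas_ifpos (fun t => (expR (- (r * t)))%:C).
    apply: cmeas_real; apply: (measurableT_comp (@measurable_expR R)).
    apply: measurableT_comp => //; exact: measurable_funM.
  by congr measurable_fun; apply/funext => t; rewrite /f; case: ifP.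
apply: rint_ge0 => //; first by move=> t; rewrite /f; case: ifP.
have fE : (\int[leb]_x (f x)%:E = \int[leb]_(x in `[0%R, +oo[) (expR (- (r * x)))%:E)%E.
  rewrite -integral_itv_obnd_cbnd; last first.
    apply/measurable_EFinP; apply: measurable_funTS.
    apply: (measurableT_comp (@measurable_expR R)).
    apply: measurableT_comp => //; exact: measurable_funM.
  rewrite [RHS]integral_mkcond; apply: eq_integral => x _.
  rewrite patchE /f; case: ifPn => x0; first by rewrite mem_set//= in_itv/= x0.
  by rewrite memNset//= in_itv/= (negbTE x0).
have := integral_exponential_pdf r0.
have -> : (\int[leb]_x (exponential_pdf r x)%:E =
    \int[leb]_(x in `[0%R, +oo[) (r%:E * (expR (- (r * x)))%:E))%E.
  rewrite [RHS]integral_mkcond; apply: eq_integral => x _.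
  by rewrite /exponential_pdf !patchE; case: ifP => // _; rewrite -EFinM mulNr.
rewrite ge0_integralZl//=; last 2 first.
- apply/measurable_EFinP; apply: measurable_funTS.
  apply: (measurableT_comp (@measurable_expR R)).
  by apply: measurableT_comp => //; exact: measurable_funM.
- by rewrite lee_fin ltW.
rewrite -fE; case: (\int[leb]_x _)%E => [x|/eqP|/eqP].
- move=> [rx]; congr EFin; apply: (mulfI (lt0r_neq0 r0)).
  by rewrite rx divff// gt_eqF.
- by rewrite gt0_muley ?lte_fin// eqe.
- by rewrite gt0_muleNy ?lte_fin.
Qed.

(** The integrals over the segments [1 / (n + 2), 1] increase and are bounded by
    1 / a; the value is found in hasI_cpow01. *)
Lemma rint_pow01 a : 0 < a ->
  exists v, rint leb (fun t => if 0 < t <= 1 then expR ((a - 1) * ln t) else 0) v.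
Proof.
move=> a0; pose g t := a * expR ((a - 1) * ln t).
have mg : measurable_fun setT g.
  apply: measurable_funM => //; apply: (measurableT_comp (@measurable_expR R)).
  exact: measurable_funM.
pose F (n : nat) : set R := `[n.+2%:R^-1, 1]%classic.
have FI n : (\int[leb]_(t in F n) (g t)%:E <= 1)%E.
  have e01 : 0 < (n.+2%:R^-1 : R) < 1.
    by rewrite invr_gt0 ltr0n invf_lt1 ?ltr0n// ltr1n.
  have [[_ +] _] := hasI_cpow_seg a%:C e01.
  have -> : complex.Re (1 - cpow n.+2%:R^-1 a%:C) =
    1 - expR (a * ln (n.+2%:R^-1)) by rewrite cpow_real.
  move=> E; rewrite [X in (X <= _)%E]integral_mkcond.
  have -> : (\int[leb]_x ((fun t => (g t)%:E) \_ (F n)) x =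
      (1 - expR (a * ln n.+2%:R^-1))%:E)%E.
    rewrite -E; apply: eq_integral => t _; rewrite patchE.
    rewrite -[a%:C - 1](rmorphB _ a 1) cpow_real.
    case: ifPn => tF.
      by move: tF; rewrite inE /F /= in_itv/= => ->; rewrite /= mul0r subr0.
    by rewrite ifN//; move: tF; rewrite notin_setE /F /= in_itv/= => /negP.
  by rewrite lee_fin lerBlDr lerDl expR_ge0.
have FU : \bigcup_n F n = [set t | 0 < t <= 1].
  apply/seteqP; split => t.
    move=> [n _]; rewrite /F /= in_itv/= => /andP[nt ->]; rewrite andbT.
    by apply: lt_le_trans nt; rewrite invr_gt0 ltr0n.
  move=> /= /andP[t0 t1]; exists (Num.bound t^-1) => //.
  rewrite /F /= in_itv/= t1 andbT invf_ple ?posrE ?ltr0n//.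
  apply: ltW; apply: lt_le_trans (archi_boundP _) _; first by rewrite invr_ge0 ltW.
  by rewrite ler_nat -addn2 leq_addr.
have ndF : {homo F : n m / (n <= m)%N >-> (n <= m)%O}.
  move=> n m nm; apply/subsetPset => t; rewrite /F /= !in_itv/= => /andP[nt ->].
  rewrite andbT; apply: le_trans nt; rewrite lef_pV2 ?posrE ?ltr0n//.
  by rewrite ler_nat ltnS.
have mgE D : measurable_fun D (EFin \o g).
  by apply: measurable_funTS; exact/measurable_EFinP.
have g0 t : 0 <= g t by rewrite mulr_ge0 ?expR_ge0 ?ltW.
have cv : ((\int[leb]_(x in F i) (g x)%:E)%E @[i --> \oo] -->
    (\int[leb]_(x in \bigcup_i F i) (g x)%:E)%E).
  apply: ge0_nondecreasing_set_cvg_integral => //.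
  - by move=> n; exact: measurable_itv.
  - by move=> n; exact: mgE.
  - by move=> n t _; rewrite lee_fin.
have le1 : (\int[leb]_(x in \bigcup_i F i) (g x)%:E <= 1)%E.
  rewrite -(cvg_lim _ cv)//; apply: lime_le; last exact: nearW.
  by apply/cvg_ex; eexists; exact: cv.
have mU : measurable [set t : R | 0 < t <= 1].
  by rewrite -FU; apply: bigcup_measurable => n _; exact: measurable_itv.
have gi : leb.-integrable setT (EFin \o (g \_ [set t : R | 0 < t <= 1])).
  rewrite -restrict_EFin; apply/(integrable_mkcond _ _).1 => //.
  apply/integrableP; split; first exact: mgE.
  rewrite -FU; apply: le_lt_trans (ltry 1); apply: le_trans le1.
  apply: ge0_le_integral => //.
  - by rewrite FU; exact: mU.
  - by apply: measurableT_comp => //; exact: mgE.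
  - exact: mgE.
  - by move=> t _ /=; rewrite lee_fin ger0_norm.
exists (a^-1 * \int[leb]_x (g \_ [set t : R | 0 < t <= 1]) x).
apply: eq_rint (rintZ a^-1 (rint_integrable gi)) => t.
rewrite patchE /g; case: ifPn => [/set_mem /= ->|].
  by rewrite mulrA mulVf ?mul1r// gt_eqF.
by rewrite notin_setE mulr0 /= => /negP/negbTE ->.
Qed.

End GammaIntegrable.

Section Gamma.
Variable R : realType.
Local Notation leb := (@lebesgue_measure R).
Implicit Types (z s : R[i]) (t a r : R).
Local Notation normc := Normc.normc.

Lemma normcM3 (u v w : R[i]) :
  normc (u * (v * w)) = normc u * (normc v * normc w).
Proof. by rewrite !Normc.normcM. Qed.

Lemma rint_Gamma a : 0 < a -> exists v,
  rint leb (fun t => if 0 < t then expR ((a - 1) * ln t) * expR (- t) else 0) v.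
Proof.
move=> a0; have [v pv] := rint_pow01 a0.
have h0 : (0 : R) < 2^-1 by rewrite invr_gt0.
pose C := expR (a * ln (2 * a)).
have dv := rintD pv (rintZ C (rint_exp h0)).
apply: rint_dom dv.
  have [|+ _] := @cmeas_ifpos R (fun t => (expR ((a - 1) * ln t) * expR (- t))%:C).
    apply: cmeas_real; apply: measurable_funM.
      apply: (measurableT_comp (@measurable_expR R)).
      exact: measurable_funM.
    by apply: (measurableT_comp (@measurable_expR R)).
  by congr measurable_fun; apply/funext => t; case: ifP.
move=> t /=; case: ifPn => [t0|]; last first.
  by move=> _ /=; rewrite mulr0 addr0 normr0.
have e1 : expR (- t) <= 1 by rewrite expR_le1 oppr_le0 ltW.
rewrite ger0_norm ?mulr_ge0 ?expR_ge0//=; case: (leP t 1) => [t1|t1] /=.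
  rewrite ler_wpDr ?mulr_ge0 ?expR_ge0//.
  by rewrite ler_piMr ?expR_ge0.
rewrite add0r.
(* Since ln u < u, the power t ^ a is at most (2 a) ^ a exp (t / 2). *)
have lt0 : 0 <= ln t by apply: ln_ge0; exact: ltW.
have bound : (a - 1) * ln t <= a * ln (2 * a) + t / 2.
  apply: (@le_trans _ _ (a * ln t)).
    by rewrite ler_wpM2r// gerBl.
  have a2 : 0 < 2 * a by rewrite mulr_gt0.
  have tE : t = (2 * a) * (t / (2 * a)) by rewrite mulrC divfK// gt_eqF.
  rewrite {1}tE lnM ?posrE ?divr_gt0// mulrDr lerD2l.
  have -> : t / 2 = a * (t / (2 * a)) by field; rewrite gt_eqF.
  by rewrite ler_pM2l// ltW// ln_sublinear// divr_gt0.
rewrite /C -!expRD ler_expR; lra.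
Qed.

(** The modulus of the integrand is the integrand of Gamma (Re z). *)
Lemma hasI_Gamma z : 0 < complex.Re z ->
  hasI leb (fun t => if 0 < t then cpow t (z - 1) * (expR (- t))%:C else 0)
    (cGamma z).
Proof.
move=> z0; have [w gw] := rint_Gamma z0.
have mG : cmeas (fun t : measurableTypeR R => cpow t (z - 1) * (expR (- t))%:C).
  apply: cmeasM; first exact: cmeas_cpow.
  by apply: cmeas_real; exact: (measurableT_comp (@measurable_expR R)).
have [|v fv] := hasI_dom (cmeas_ifpos mG) _ ((hasI_real _ _ _).1 gw).
  move=> t; case: ifP => _; last by rewrite Normc.normc0.
  rewrite Normc.normcM normc_cpow normc_real ?expR_ge0//.
  by rewrite (_ : complex.Re (z - 1) = complex.Re z - 1)//; clear; case: z.
have [//| |_ E] := @cintegral_hasI _ _ _ leb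
  (fun t => cpow t (z - 1) * (expR (- t))%:C) v `]0, +oo[%classic.
  apply: eq_hasI fv => t; congr (if _ then _ else _).
  by apply/idP/idP => [t0|/set_mem]; rewrite ?inE/= in_itv/= andbT.
by rewrite /cGamma E.
Qed.

Lemma hasI_Gamma_scale z a : 0 < complex.Re z -> 0 < a ->
  hasI leb (fun t => if 0 < t then cpow t (z - 1) * (expR (- (a * t)))%:C else 0)
    (cGamma z * cpow a (- z)).
Proof.
move=> z0 a0; have := hasIZ (cpow a (1 - z)) (hasI_affine 0 a0 (hasI_Gamma z0)).
have -> : cpow a (1 - z) * (cGamma z / a%:C) = cGamma z * cpow a (- z).
  have ac : a%:C != 0 by apply/eqP => -[] /eqP; rewrite gt_eqF.
  by rewrite cpowD cpowx1//; field.
apply: eq_hasI => t; rewrite addr0 pmulr_rgt0//.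
case: ifPn => t0; last by rewrite mulr0.
rewrite cpowM//; have -> : 1 - z = - (z - 1) by rewrite opprB.
by rewrite cpowN -[X in _ * X]mulrA mulKf// cpow_neq0.
Qed.

(** Gamma(s) Phi^(- s) is the Laplace transform of t^(s - 1) at Phi. Exchanging
    the integrals turns the integral of f Phi^(- s) into the Gamma integral of
    the exponential integrals of f, which are elementary. *)
Lemma hasI_laplace d (Z : measurableType d)
    (mu : {sigma_finite_measure set Z -> \bar R}) (f : Z -> R[i])
    (Phi : Z -> R) (K K' kap s : R[i]) a :
  cmeas f -> measurable_fun setT Phi -> (forall x, f x != 0 -> 0 < Phi x) ->
  0 < a -> complex.Re kap < complex.Re s -> 0 < complex.Re s ->
  (forall t, 0 < t -> hasI mu (fun x => f x * (expR (- (t * Phi x)))%:C)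
    (K * cpow t (- kap) * (expR (- (a * t)))%:C)) ->
  (forall t, 0 < t -> hasI mu (fun x => (normc (f x))%:C * (expR (- (t * Phi x)))%:C)
    (K' * cpow t (- (complex.Re kap)%:C) * (expR (- (a * t)))%:C)) ->
  hasI mu (fun x => cGamma s * (f x * cpow (Phi x) (- s)))
    (K * cGamma (s - kap) * cpow a (kap - s)).
Proof.
move=> mf mP fP a0 ks s0 H H'.
have ReB (u v : R[i]) : complex.Re (u - v) = complex.Re u - complex.Re v.
  by case: u v => ? ? [].
pose h (p : Z * measurableTypeR R) : R[i] := f p.1 *
  ((if 0 < p.2 then cpow p.2 (s - 1) else 0) * (expR (- (p.2 * Phi p.1)))%:C).
have mh : cmeas h.
  apply: cmeasM; first exact: (cmeas_comp measurable_fst mf).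
  apply: cmeasM.
    apply: (@cmeas_comp _ _ _ _ _ snd (fun t : R => if 0 < t then cpow t (s - 1) else 0)).
      exact: measurable_snd.
    by apply: cmeas_ifpos; exact: cmeas_cpow.
  apply: cmeas_real; apply: (measurableT_comp (@measurable_expR R)).
  apply: measurableT_comp => //; apply: measurable_funM => //.
  exact: (measurableT_comp mP).
have hI : hasI (mu \x leb)%E h (K * cGamma (s - kap) * cpow a (kap - s)).
  apply: (@hasI_fubini2 _ _ _ (measurableTypeR R) R mu leb h
    (fun t => if 0 < t then K * (cpow t (s - kap - 1) * (expR (- (a * t)))%:C) else 0)
    (fun t => if 0 < t then K' * (cpow t ((complex.Re (s - kap))%:C - 1) *
      (expR (- (a * t)))%:C) else 0)
    _ (K' * (cGamma (complex.Re (s - kap))%:C * cpow a (- (complex.Re (s - kap))%:C)))) => //.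
  - move=> t; case: ifPn => t0; last first.
      apply: eq_hasI (hasI0 mu) => x; rewrite /h /= (negbTE t0) mul0r mulr0.
      by rewrite Normc.normc0.
    have := hasIZ (cpow t ((complex.Re s)%:C - 1)) (H' t t0).
    have -> : cpow t ((complex.Re s)%:C - 1) *
        (K' * cpow t (- (complex.Re kap)%:C) * (expR (- (a * t)))%:C) =
        K' * (cpow t ((complex.Re (s - kap))%:C - 1) * (expR (- (a * t)))%:C).
      have -> : (complex.Re (s - kap))%:C - 1 =
        ((complex.Re s)%:C - 1) + - (complex.Re kap)%:C.
        by rewrite ReB rmorphB /=; ring.
      rewrite (cpowD _ ((complex.Re s)%:C - 1)).
      by move: (cpow t (- (complex.Re kap)%:C)) (cpow t ((complex.Re s)%:C - 1))
        => c1 c2; ring.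
    apply: eq_hasI => x; rewrite /h /= t0 normcM3 normc_cpow normc_real ?expR_ge0//.
    have -> : complex.Re (s - 1) = complex.Re s - 1 by rewrite ReB.
    have -> : (complex.Re s)%:C - 1 = (complex.Re s - 1)%:C by rewrite rmorphB.
    by rewrite cpow_real -!rmorphM mulrCA.
  - have := hasIZ K' (@hasI_Gamma_scale (complex.Re (s - kap))%:C a _ a0).
    rewrite /= ReB subr_gt0 => /(_ ks); apply: eq_hasI => t.
    by case: ifP => // _; rewrite mulr0.
  - move=> t; case: ifPn => t0; last first.
      by apply: eq_hasI (hasI0 mu) => x; rewrite /h /= (negbTE t0) mul0r mulr0.
    have := hasIZ (cpow t (s - 1)) (H t t0).
    have -> : cpow t (s - 1) * (K * cpow t (- kap) * (expR (- (a * t)))%:C) =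
        K * (cpow t (s - kap - 1) * (expR (- (a * t)))%:C).
      have -> : s - kap - 1 = (s - 1) + - kap by ring.
      by rewrite (cpowD _ (s - 1)); move: (cpow t (s - 1)) (cpow t (- kap)) => c1 c2; ring.
    by apply: eq_hasI => x; rewrite /h /= t0 mulrCA.
  - have := hasIZ K (@hasI_Gamma_scale (s - kap) a _ a0).
    rewrite ReB subr_gt0 => /(_ ks); rewrite mulrA opprB.
    apply: eq_hasI => t; case: ifP => // _; by rewrite mulr0.
apply: (hasI_fubini_inv hI) => x.
have [fx0|fx0] := eqVneq (f x) 0.
  rewrite fx0 mul0r mulr0; apply: eq_hasI (hasI0 leb) => t.
  by rewrite /h /= fx0 mul0r.
have := hasIZ (f x) (hasI_Gamma_scale s0 (fP x fx0)).
rewrite mulrCA; apply: eq_hasI => t; rewrite /h /=.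
by case: ifP => _; rewrite ?mul0r ?mulr0// [t * _]mulrC.
Qed.

(** The Laplace transform of r ^ (z - 1) on the half-line is again a power. *)
Lemma hasI_beta z s a : 0 < complex.Re z -> complex.Re z < complex.Re s -> 0 < a ->
  hasI leb (fun r => cGamma s *
      ((if 0 < r then cpow r (z - 1) else 0) * cpow (a + r) (- s)))
    (cGamma z * cGamma (s - z) * cpow a (z - s)).
Proof.
move=> z0 zs a0.
have E (w : R[i]) t : 0 < complex.Re w -> 0 < t ->
    hasI leb (fun r => (if 0 < r then cpow r (w - 1) else 0) *
      (expR (- (t * (a + r))))%:C) (cGamma w * cpow t (- w) * (expR (- (a * t)))%:C).
  move=> w0 t0; have := hasIZ (expR (- (a * t)))%:C (hasI_Gamma_scale w0 t0).
  rewrite [_%:C * _]mulrC; apply: eq_hasI => r.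
  case: ifP => _; last by rewrite mul0r mulr0.
  rewrite mulrCA -rmorphM -expRD /=; congr (_ * (expR _)%:C); ring.
apply: (@hasI_laplace _ _ leb (fun r => if 0 < r then cpow r (z - 1) else 0)
  _ _ (cGamma (complex.Re z)%:C)) => //.
- by apply: cmeas_ifpos; exact: cmeas_cpow.
- exact: measurable_funD.
- by move=> r; case: ifP => [r0 _|]; rewrite ?eqxx// addr_gt0.
- exact: lt_trans zs.
- by move=> t; exact: E.
move=> t t0; apply: eq_hasI (E (complex.Re z)%:C t z0 t0) => r.
congr (_ * _); case: ifP => _; last by rewrite Normc.normc0.
rewrite normc_cpowC; congr (cpow _ _).
by clear; case: z => x y /=; rewrite rmorphB.
Qed.

End Gamma.

Section GammaRecurrence.
Variable R : realType.
Local Notation leb := (@lebesgue_measure R).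
Implicit Types (z s w : R[i]) (t u a : R).
Local Notation normc := Normc.normc.

Lemma hasID d (T : measurableType d) (mu : {measure set T -> \bar R})
    (f g : T -> R[i]) v w : hasI mu f v -> hasI mu g w ->
  hasI mu (fun x => f x + g x) (v + w).
Proof.
move=> [f1 f2] [g1 g2]; split.
  have := rintD f1 g1; rewrite -raddfD; apply: eq_rint => x /=.
  by rewrite raddfD.
have := rintD f2 g2; rewrite -raddfD; apply: eq_rint => x /=.
by rewrite raddfD.
Qed.

Lemma hasI_point (c : R) (k : R[i]) :
  hasI leb (fun t => if t == c then k else 0) 0.
Proof.
have h : rint leb (fun t => \1_[set c] t) 0.
  apply: rint_ge0 => //; last first.
    by rewrite integral_indic// setIT; exact: lebesgue_measure_set1.
  exact: measurable_indic.
have := hasIZ k ((hasI_real _ _ _).1 h); rewrite mulr0; apply: eq_hasI => t.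
rewrite indicE; case: eqVneq => [->|tc]; first by rewrite mem_set// mulr1.
by rewrite memNset ?mulr0// => /= tc'; rewrite tc' eqxx in tc.
Qed.

(** Integrability is known, so the value m can be found from the scaling
    relation m = 2 ^ (- s) m + (1 - 2 ^ (- s)) / s, without a limit at 0. *)
Lemma hasI_cpow01 s : 0 < complex.Re s ->
  hasI leb (fun u => if 0 < u < 1 then cpow u (s - 1) else 0) s^-1.
Proof.
move=> s0; have [v pv] := rint_pow01 s0.
have half : 0 < (2^-1 : R) < 1 by rewrite invr_gt0 ltr0n invf_lt1// ltr1n.
have mpos : cmeas (fun u : measurableTypeR R => if 0 < u then
    (if 0 < 1 - u then cpow u (s - 1) else 0) else 0).
  apply: cmeas_ifpos.
  have -> : (fun u => if 0 < 1 - u then cpow u (s - 1) else 0) =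
      (fun u => (if 0 < 1 - u then 1 else 0) * cpow u (s - 1)).
    by apply/funext => u; case: ifP; rewrite ?mul1r ?mul0r.
  apply: cmeasM; last exact: cmeas_cpow.
  apply: (@cmeas_comp _ _ _ (measurableTypeR R) R (fun u => 1 - u)
    (fun u => if 0 < u then 1 else 0)).
    exact: measurable_funB.
  apply: cmeas_ifpos; exact: cmeas_cst.
have E01 (u : measurableTypeR R) : (if 0 < u then (if 0 < 1 - u then cpow u (s - 1) else 0) else 0) =
    (if 0 < u < 1 then cpow u (s - 1) else 0).
  by rewrite subr_gt0; case: (0 < u).
have [|m fm] := hasI_dom mpos _ ((hasI_real _ _ _).1 pv).
  move=> u; rewrite E01; case: ifP => [/andP[u0 u1]|_].
    rewrite normc_cpow u0 (ltW u1) /= (_ : complex.Re (s - 1) = complex.Re s - 1)//.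
    by clear; case: s.
  by rewrite Normc.normc0; case: ifP => // _; rewrite expR_ge0.
have {}fm := eq_hasI E01 fm.
have two : (0 : R) < 2 by [].
have twoC : (2%:C : R[i]) != 0 by apply/eqP => -[] /eqP; rewrite pnatr_eq0.
(* Halving u multiplies the integral by 2 ^ (- s); what is left of the unit
   interval does not touch the singularity. *)
have fm2 := hasIZ (cpow 2 (1 - s)) (hasI_affine 0 two fm).
have seg := hasI_cpow_seg s half.
have := hasID (hasID (hasIZ s fm2) seg) (hasI_point 1 (- (s * cpow 1 (s - 1)))).
rewrite addr0 (cpowD 2 1) cpowx1// => tot.
have sm := hasI_uniq (hasIZ s fm) (eq_hasI _ tot).
have sE : s * m = s * (2%:C * cpow 2 (- s) * (m / 2%:C)) + (1 - cpow 2^-1 s).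
  apply: sm => u; rewrite addr0.
  have -> : 0 < 2 * u < 1 = (0 < u < 2^-1).
    by rewrite pmulr_rgt0// -ltr_pdivlMl// mulr1.
  case: (ltP 0 u) => u0 /=; last first.
    have -> : 2^-1 <= u = false.
      by apply/negbTE; rewrite -ltNge (le_lt_trans u0)// invr_gt0.
    have -> : u == 1 = false by apply/negbTE; rewrite lt_eqF// (le_lt_trans u0).
    by rewrite !mulr0 !addr0.
  case: (ltP u 2^-1) => u2 /=.
    have u1 : u < 1 by case/andP: half => _; exact: lt_trans.
    rewrite u1 lt_eqF// addr0 addr0 cpowM// -cpowx1// -cpowD.
    have -> : 1 + - s = - (s - 1) by ring.
    by rewrite cpowN mulKf// cpow_neq0.
  case: (ltgtP u 1) => u1 /=; rewrite ?mulr0 ?add0r ?addr0//.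
  by rewrite u1 subrr.
have q0 : 1 - cpow 2 (- s) != 0.
  apply/eqP => /eqP; rewrite subr_eq0 => /eqP /(congr1 (@normc R)).
  rewrite Normc.normc1 normc_cpow => /esym/eqP; rewrite lt_eqF//.
  rewrite expR_lt1 raddfN /= mulNr oppr_lt0 mulr_gt0// ln_gt0//.
  by rewrite ltr1n.
have sn0 : s != 0 by apply/eqP => s00; rewrite s00 ltxx in s0.
suff <- : m = s^-1 by [].
apply: (mulfI sn0); rewrite divff//.
have : (1 - cpow 2 (- s)) * (s * m) = 1 - cpow 2 (- s).
  rewrite mulrBl mul1r {1}sE cpowV//; move: (2%:C) twoC => c c0.
  by move: (cpow 2 (- s)) => q; field.
by move=> /(canRL (mulKf q0)) ->; rewrite mulVf.
Qed.

Lemma hasI_cpow0t s t : 0 < complex.Re s -> 0 < t ->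
  hasI leb (fun u => if 0 < u < t then cpow u (s - 1) else 0) (s^-1 * cpow t s).
Proof.
move=> s0 t0; have ti : 0 < t^-1 by rewrite invr_gt0.
have := hasIZ (cpow t (s - 1)) (hasI_affine 0 ti (hasI_cpow01 s0)).
have tc : t%:C != 0 by apply/eqP => -[] /eqP; rewrite gt_eqF.
have -> : cpow t (s - 1) * (s^-1 / t^-1%:C) = s^-1 * cpow t s.
  rewrite cpowB cpowx1// fmorphV invrK; move: (cpow t s) => c; field.
  by rewrite tc andbT; apply/eqP => s00; rewrite s00 ltxx in s0.
apply: eq_hasI => u; rewrite addr0 pmulr_rgt0// ltr_pdivrMl// mulr1.
case: ifPn => [/andP[u0 _]|]; last by rewrite mulr0.
by rewrite cpowM// cpowV// cpowN mulVKf// cpow_neq0.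
Qed.

(** The function u ^ (s - 1) exp (- t) on 0 < u < t is integrated in both orders.
    Integrating over t first gives Gamma (s), integrating over u first gives
    Gamma (s + 1) / s. *)
Lemma cGamma_rec s : 0 < complex.Re s -> cGamma (s + 1) = s * cGamma s.
Proof.
move=> s0; pose E (v : measurableTypeR R) : R := if 0 < v then expR (- v) else 0.
have E0 v : 0 <= E v by rewrite /E; case: ifP => // _; exact: expR_ge0.
have rE : rint leb E 1.
  have := rint_exp (ltr01 : 0 < (1 : R)); rewrite invr1; apply: eq_rint => v.
  by rewrite mul1r.
pose g (r : R[i]) (u : measurableTypeR R) : R[i] :=
  if 0 < u then cpow u (r - 1) * (expR (- u))%:C else 0.
pose h (p : measurableTypeR R * measurableTypeR R) : R[i] :=
  g s p.1 * (E (p.2 - p.1))%:C.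
have mh : cmeas h.
  apply: cmeasM.
    apply: (@cmeas_comp _ _ _ _ _ fst (g s)); first exact: measurable_fst.
    exact: hasI_meas (hasI_Gamma s0).
  apply: cmeas_real; apply: (measurableT_comp (rint_meas rE)).
  apply: measurable_funB; first exact: measurable_snd.
  exact: measurable_fst.
have rEu u : hasI leb (fun v => (E (v - u))%:C) 1.
  apply/hasI_real; have := rint_affine (- u) ltr01 rE; rewrite divr1.
  by apply: eq_rint => v; rewrite mul1r.
have s0' : 0 < complex.Re (complex.Re s)%:C by [].
have hI : hasI (leb \x leb)%E h (cGamma s).
  apply: (@hasI_fubini _ _ _ _ R leb leb h (g s) (g (complex.Re s)%:C) _ _ mh _
    (hasI_Gamma s0') _ (hasI_Gamma s0)) => u.
    have := hasIZ (g (complex.Re s)%:C u) (rEu u); rewrite mulr1.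
    apply: eq_hasI => v; rewrite /h Normc.normcM.
    rewrite [normc (E _)%:C]normc_real// rmorphM; congr (_ * _); rewrite /g; case: ifP => // _.
      rewrite Normc.normcM normc_cpow normc_real ?expR_ge0// rmorphM.
      rewrite /=; congr (_ * _); rewrite -cpow_real; congr cpow.
      by clear; case: s => x y /=; rewrite rmorphB.
    by rewrite Normc.normc0.
  by have := hasIZ (g s u) (rEu u); rewrite mulr1.
have H2 : hasI leb (fun t => s^-1 * (if 0 < t then cpow t (s + 1 - 1) * (expR (- t))%:C else 0))
    (cGamma s).
  case: hI => h1 h2.
  have gh t : hasI leb (fun u => h (u, t))
      (s^-1 * (if 0 < t then cpow t (s + 1 - 1) * (expR (- t))%:C else 0)).
    case: ifPn => t0; last first.
      rewrite mulr0; apply: eq_hasI (hasI0 leb) => u; rewrite /h /g /E /=.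
      case: ifP => u0; rewrite ?mul0r//; case: ifPn => ut; rewrite ?mulr0//.
      by move: t0; rewrite (lt_trans u0)// -subr_gt0.
    have := hasIZ (expR (- t))%:C (hasI_cpow0t s0 t0).
    rewrite addrK mulrC -mulrA; apply: eq_hasI => u; rewrite /h /g /E /= subr_gt0.
    case: (ltP 0 u) => u0 /=; last by rewrite mulr0 mul0r.
    case: ifP => ut; rewrite ?mulr0// mulrC -mulrA -rmorphM -expRD.
    by congr (_ * (expR _)%:C); ring.
  split.
    by apply: (rint_fubini_inv2 h1) => t; case: (gh t).
  by apply: (rint_fubini_inv2 h2) => t; case: (gh t).
have s1 : 0 < complex.Re (s + 1) by move: s0; clear; case: s => x y /= x0; rewrite addr_gt0.
have := hasI_uniq (hasIZ s^-1 (hasI_Gamma s1)) H2.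
have sn0 : s != 0 by apply/eqP => s00; rewrite s00 ltxx in s0.
by move=> /(canRL (mulKf (invr_neq0 sn0))); rewrite invrK.
Qed.

(** If Gamma vanished at w, then by the Beta integral it would vanish at w / 2,
    hence at all w / 2 ^ k, and by the recurrence at all 1 + w / 2 ^ k, which
    tend to 1. *)
Lemma cGamma_neq0 w : 0 < complex.Re w -> cGamma w != 0.
Proof.
move=> w0; apply/eqP => G0.
pose e (k : nat) : R := 2^-1 ^+ k.
have e0 k : 0 < e k by rewrite exprn_gt0.
have Rew k : complex.Re (w * (e k)%:C) = complex.Re w * e k.
  by clear; case: w => x y /=; rewrite mulr0 subr0.
have Imw k : complex.Im (w * (e k)%:C) = complex.Im w * e k.
  by clear; case: w => x y /=; rewrite mulr0 add0r.
have wk0 k : 0 < complex.Re (w * (e k)%:C) by rewrite Rew mulr_gt0.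
have Gk k : cGamma (w * (e k)%:C) = 0.
  elim: k => [|k IH]; first by rewrite /e expr0 mulr1.
  set z := w * (e k.+1)%:C; have zE : w * (e k)%:C = z + z.
    rewrite /z -mulrDr -rmorphD; congr (_ * _%:C).
    by rewrite /e exprS; lra.
  have zlt : complex.Re z < complex.Re (z + z).
    have -> : complex.Re (z + z) = complex.Re z + complex.Re z by clear; case: z.
    by rewrite ltrDl; exact: wk0.
  have := hasI_beta (wk0 k.+1) zlt ltr01.
  rewrite -zE IH zE addrK cpow1x mulr1 => B.
  have := hasI_uniq B (eq_hasI _ (hasI0 leb)) => /(_ (fun r => esym (mul0r _))).
  by move/eqP; rewrite mulf_eq0 orbb => /eqP.
have G1 k : cGamma (w * (e k)%:C + 1) = 0 by rewrite cGamma_rec// Gk mulr0.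
pose f (k : nat) (t : measurableTypeR R) : R := complex.Re
  (if 0 < t then cpow t (w * (e k)%:C + 1 - 1) * (expR (- t))%:C else 0).
have fk k : rint leb (f k) 0.
  have := hasI_Gamma (_ : 0 < complex.Re (w * (e k)%:C + 1)).
  rewrite G1 => -[|h _]; last exact: h.
  by rewrite raddfD /= addr_gt0.
pose E (t : measurableTypeR R) : R := if 0 < t then expR (- t) else 0.
have rE : rint leb E 1.
  have := rint_exp (ltr01 : 0 < (1 : R)); rewrite invr1; apply: eq_rint => v.
  by rewrite mul1r.
have w1 : 0 < complex.Re w + 1 by rewrite addr_gt0.
have [v gv] := rint_Gamma w1.
have dom := rintD rE gv.
have fE k t : f k t = if 0 < t then
    expR (complex.Re w * e k * ln t) * cos (complex.Im w * e k * ln t) * expR (- t) else 0.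
  rewrite /f; case: ifP => // _; rewrite addrK -Rew -Imw -Re_cpow.
  by move: (cpow _ _) => -[x y] /=; rewrite mulr0 subr0.
have ecvg (c : R) : (fun k => c * e k) @ \oo --> (0 : R).
  rewrite -(mulr0 c); apply: cvgM; first exact: cvg_cst.
  by apply: cvg_expr; rewrite ger0_norm// invf_lt1// ltr1n.
have := @dominated_convergence _ _ _ leb setT measurableT
  (fun k => EFin \o f k) (EFin \o E) _ _ _ _ dom.1 _.
case.
- by move=> k; case: (fk k) => /integrableP[].
- by case: rE => /integrableP[].
- apply: aeW => t _; apply/fine_cvgP; split.
    by apply: nearW => k.
  have -> : fine \o (fun k => (EFin \o f k) t) = f^~ t by [].
  under eq_fun do rewrite fE.
  rewrite /E; case: ifP => t0; last exact: cvg_cst.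
  have L : (expR (complex.Re w * e k * ln t) * cos (complex.Im w * e k * ln t) *
      expR (- t)) @[k --> \oo] --> expR (0 * ln t) * cos (0 * ln t) * expR (- t).
    apply: cvgM; last exact: cvg_cst.
    apply: cvgM.
      have cf : {for 0 * ln t, continuous (@expR R)} by exact: continuous_expR.
      apply: (continuous_cvg _ cf).
      by apply: cvgM; [exact: ecvg|exact: cvg_cst].
    have cf : {for 0 * ln t, continuous (@cos R)} by exact: continuous_cos.
    apply: (continuous_cvg _ cf).
    by apply: cvgM; [exact: ecvg|exact: cvg_cst].
  by move: L; rewrite !mul0r expR0 cos0 !mul1r.
- apply: aeW => t k _ /=; rewrite lee_fin fE /E.
  case: ifP => t0; last by rewrite normr0 addr0.
  rewrite !normrM (ger0_norm (expR_ge0 (- t))) (ger0_norm (expR_ge0 _)).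
  rewrite addrK -[X in X + _]mul1r -mulrDl ler_wpM2r ?expR_ge0//.
  apply: (@le_trans _ _ (expR (complex.Re w * e k * ln t))).
    by rewrite ler_piMr ?expR_ge0// ler_norml cos_geN1 cos_le1.
  case: (leP 0 (ln t)) => lt0.
    rewrite ler_wpDl// ler_expR ler_wpM2r//; apply: ler_piMr; first exact: ltW.
    by apply: exprn_ile1; rewrite ?invf_le1// ?ler1n// invr_ge0.
  rewrite ler_wpDr ?expR_ge0// expR_le1.
  by rewrite nmulr_lle0// ltW// mulr_gt0.
move=> _ _.
have -> : (\int[leb]_(x in setT) (EFin \o E) x = 1)%E by exact: rE.2.
have -> : (fun n => \int[leb]_(x in setT) (EFin \o f n) x)%E = (fun=> 0%E).
  by apply/funext => n; exact: (fk n).2.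
move=> /cvg_lim; rewrite (cvg_lim _ (cvg_cst _))// => /(_ _)/eqP.
by rewrite eqe eq_sym oner_eq0 => /(_ (@ereal_hausdorff R)).
Qed.

End GammaRecurrence.

(** * Gaussian integrals *)

Section Quadratic.
Variable R : realType.

Definition quad N (M : 'M[R]_N) (v : 'rV[R]_N) : R := (v *m M *m v^T) 0 0.

Definition posquad N (M : 'M[R]_N) : Prop :=
  M^T = M /\ forall v : 'rV[R]_N, v != 0 -> 0 < quad M v.

Lemma quadE N (M : 'M[R]_N) v :
  quad M v = \sum_j (\sum_i v 0 i * M i j) * v 0 j.
Proof. by rewrite /quad mxE; apply: eq_bigr => j _; rewrite !mxE. Qed.

Lemma posquad_ge0 N (M : 'M[R]_N) v : posquad M -> 0 <= quad M v.
Proof.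
move=> [_ M0]; have [->|v0] := eqVneq v 0; last exact/ltW/M0.
by rewrite /quad mul0mx mul0mx mxE.
Qed.

Section Schur.
Variables (N : nat) (M : 'M[R]_(1 + N)).

Let m : R := ulsubmx M 0 0.
Let l : 'rV[R]_N := ursubmx M.
Let k : 'cV[R]_N := dlsubmx M.

Definition schur : 'M[R]_N := drsubmx M - m^-1 *: (k *m l).

Let ME : M = block_mx m%:M l k (drsubmx M).
Proof. by rewrite -{1}(submxK M) -mx11_scalar. Qed.

Let quad_block (x : R) (v : 'rV[R]_N) : quad M (row_mx x%:M v) =
  m * x ^+ 2 + x * ((l *m v^T) 0 0 + (v *m k) 0 0) + quad (drsubmx M) v.
Proof.
rewrite /quad {1}ME (mul_row_block x%:M v) tr_row_mx mul_row_col tr_scalar_mx.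
rewrite !mul_scalar_mx mul_mx_scalar mulmxDl -scalemxAl.
move: (l *m v^T) (v *m k) (v *m drsubmx M *m v^T) => x1 x2 x3.
by rewrite !mxE eqxx mulr1n; ring.
Qed.

Let quad_schurE (v : 'rV[R]_N) : quad schur v =
  quad (drsubmx M) v - m^-1 * (v *m k) 0 0 * (l *m v^T) 0 0.
Proof.
rewrite /quad mulmxBr mulmxBl [LHS]mxE [X in _ + X]mxE; congr (_ - _).
rewrite -!scalemxAr -scalemxAl [LHS]mxE -mulrA; congr (_ * _).
by rewrite (mulmxA v) -(mulmxA (v *m k)) [LHS]mxE big_ord1.
Qed.

Hypothesis M0 : forall v : 'rV[R]_(1 + N), v != 0 -> 0 < quad M v.

Lemma schur_m_gt0 : 0 < m.
Proof.
have := M0 (v := row_mx 1%:M 0); rewrite quad_block /quad !trmx0 !mulmx0 mul0mx.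
rewrite !mxE expr1n mulr1 mul1r !addr0; apply.
apply/eqP => /(congr1 lsubmx); rewrite row_mxKl raddf0 => /matrixP /(_ 0 0).
by rewrite !mxE => /eqP; rewrite oner_eq0.
Qed.
Let m0 : m != 0. Proof. by rewrite gt_eqF// schur_m_gt0. Qed.

(** The value at v is the value of M at (x, v) for a suitable x. *)
Lemma schur_gt0 v : v != 0 -> 0 < quad schur v.
Proof.
move=> v0; have := M0 (v := row_mx (- (m^-1 * (v *m k) 0 0))%:M v).
rewrite quad_block quad_schurE => h.
rewrite [X in 0 < X](_ : _ = quad (drsubmx M) v -
  m^-1 * (v *m k) 0 0 * (l *m v^T) 0 0) in h; last by field.
apply: h; apply: contra v0 => /eqP /(congr1 rsubmx).
by rewrite row_mxKr raddf0 => ->.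
Qed.

Lemma det_schur : \det M = m * \det schur.
Proof.
have := congr1 determinant (_ : M *m block_mx 1%:M (- (m^-1 *: l)) 0 1%:M =
  block_mx m%:M 0 k schur).
rewrite det_mulmx det_ublock det_lblock !det1 !mulr1 det_mx11 mxE eqxx mulr1n.
apply; rewrite {1}ME mulmx_block !mulmx1 !mulmx0 !addr0 mulmxN mul_scalar_mx.
by rewrite scalerA divff// scale1r addNr /schur addrC mulmxN scalemxAr.
Qed.

Hypothesis MT : M^T = M.

Let kE : k = l^T. Proof. by rewrite /l trmx_ursub MT. Qed.

Lemma schur_tr : schur^T = schur.
Proof.
by rewrite /schur kE raddfB /= linearZ /= trmx_mul trmxK trmx_drsub MT.
Qed.

(** Completing the square in the first coordinate. *)
Lemma quad_schur (x : R) (v : 'rV[R]_N) : quad M (row_mx x%:M v) =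
  m * (x + (m^-1 *: (l *m v^T)) 0 0) ^+ 2 + quad schur v.
Proof.
rewrite quad_block quad_schurE.
have -> : (v *m k) 0 0 = (l *m v^T) 0 0.
  by rewrite kE -[in LHS](trmxK v) -trmx_mul mxE.
have -> : (m^-1 *: (l *m v^T)) 0 0 = m^-1 * (l *m v^T) 0 0 by rewrite mxE.
by field.
Qed.

End Schur.

(** By induction, with the Schur complement of the first diagonal entry. *)
Lemma det_quad_gt0 N (M : 'M[R]_N) :
  (forall v, v != 0 -> 0 < quad M v) -> 0 < \det M.
Proof.
elim: N M => [|N IHN] M M0; first by rewrite det_mx00.
rewrite (@det_schur N M M0) mulr_gt0 ?(@schur_m_gt0 N M M0)//.
exact: IHN (@schur_gt0 N M M0).
Qed.

End Quadratic.

Section Gaussian.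
Variable R : realType.
Local Notation leb := (@lebesgue_measure R).
Local Notation RT := (measurableTypeR R).

Definition rowt N (z : N.-tuple RT) : 'rV[R]_N := \row_i tnth z i.

Lemma rint_gauss1 (c x0 : R) : 0 < c ->
  rint leb (fun x => expR (- (c * (x + x0) ^+ 2))) (Num.sqrt (pi / c)).
Proof.
move=> c0; have s0 : 0 < Num.sqrt c by rewrite sqrtr_gt0.
have g : rint leb (@gauss_fun R) (Num.sqrt pi).
  by split; [exact: integrableT_gauss|exact: integralT_gauss].
have := rint_affine (Num.sqrt c * x0) s0 g.
rewrite sqrtrM ?pi_ge0// sqrtrV ?ltW//; apply: eq_rint => x.
by rewrite /gauss_fun -mulrDr exprMn sqr_sqrtr ?ltW.
Qed.

Lemma measurable_quad N (M : 'M[R]_N) (v0 : 'rV[R]_N) :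
  measurable_fun setT (fun z : N.-tuple RT => quad M (rowt z + v0)).
Proof.
under [fun _ => _]funext do rewrite quadE.
apply: measurable_sum => j.
have mv i : measurable_fun setT (fun z : N.-tuple RT => (rowt z + v0) 0 i).
  under [fun _ => _]funext do rewrite !mxE.
  by apply: measurable_funD => //; exact: measurable_tnth.
apply: measurable_funM => //; apply: measurable_sum => i.
exact: measurable_funM.
Qed.

(** The first coordinate is integrated out, which leaves the Schur complement
    and factors off its pivot m; the centre - v0 moves with the square. *)
Lemma rint_gauss N (M : 'M[R]_N) (v0 : 'rV[R]_N) (t : R) : posquad M -> 0 < t ->
  0 < \det M /\ rint (lebesgue_tuple R N)
    (fun z => expR (- (t * quad M (rowt z + v0))))
    (Num.sqrt (pi / t) ^+ N / Num.sqrt (\det M)).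
Proof.
elim: N M v0 => [|N IH] M v0 Mpos t0.
  rewrite det_mx00; split=> //; rewrite expr0 sqrtr1 divr1.
  apply: rint_ge0.
  - apply: (measurableT_comp (@measurable_expR R)).
    apply: measurableT_comp => //; apply: measurable_funM => //.
    exact: measurable_quad.
  - by move=> x; exact: expR_ge0.
  rewrite /= integral_dirac//; last first.
    apply/measurable_EFinP; apply: (measurableT_comp (@measurable_expR R)).
    apply: measurableT_comp => //; apply: measurable_funM => //.
    exact: measurable_quad.
  by rewrite diracE mem_set// mul1e quadE big_ord0 mulr0 oppr0 expR0.
pose M' : 'M[R]_(1 + N) := M.
have [MT M0] : posquad M' := Mpos.
have m0 := schur_m_gt0 M0; set m := ulsubmx M' 0 0 in m0.
have Spos : posquad (schur M').
  by split; [exact: schur_tr|exact: schur_gt0].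
have [dS S] := IH _ (rsubmx (v0 : 'rV_(1 + N))) Spos t0.
have dM : \det M = m * \det (schur M') := det_schur M0.
split; first by rewrite dM mulr_gt0.
have mF : measurable_fun setT
    (fun z : N.+1.-tuple RT => expR (- (t * quad M (rowt z + v0)))).
  apply: (measurableT_comp (@measurable_expR R)).
  apply: measurableT_comp => //; apply: measurable_funM => //.
  exact: measurable_quad.
apply: (@rint_push _ _ _ _ R (leb \x lebesgue_tuple R N)%E _ _
  (@measurable_cons_pair R N)) => //.
have qE x (z : N.-tuple RT) : t * quad M (rowt (cons_pair (x, z)) + v0) =
    t * m * (x + ((v0 : 'rV_(1 + N)) 0 (lshift N 0) + (m^-1 *: (ursubmx M' *m
      (rowt z + rsubmx (v0 : 'rV_(1 + N)))^T)) 0 0)) ^+ 2 +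
    t * quad (schur M') (rowt z + rsubmx (v0 : 'rV_(1 + N))).
  have -> : quad M (rowt (cons_pair (x, z)) + v0) = quad M' (row_mx
      (x + (v0 : 'rV_(1 + N)) 0 (lshift N 0))%:M
      (rowt z + rsubmx (v0 : 'rV_(1 + N)))).
    congr (quad _ _); apply/(@rowP _ (1 + N)) => i.
    case: (split_ordP i) => j ->.
      by rewrite row_mxEl !mxE (ord1 j) eqxx mulr1n.
    by rewrite row_mxEr !mxE !(tnth_nth x).
  by rewrite (quad_schur M0 MT) mulrDr addrA mulrA.
have inner (z : N.-tuple RT) : rint leb
    (fun x => expR (- (t * quad M (rowt (cons_pair (x, z)) + v0))))
    (Num.sqrt (pi / (t * m)) *
     expR (- (t * quad (schur M') (rowt z + rsubmx (v0 : 'rV_(1 + N)))))).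
  rewrite [X in rint _ _ X]mulrC.
  have := rintZ (expR (- (t * quad (schur M') (rowt z + rsubmx (v0 : 'rV_(1 + N))))))
    (rint_gauss1 ((v0 : 'rV_(1 + N)) 0 (lshift N 0) + (m^-1 *: (ursubmx M' *m
      (rowt z + rsubmx (v0 : 'rV_(1 + N)))^T)) 0 0) (mulr_gt0 t0 m0)).
  apply: eq_rint => x.
  by rewrite qE opprD expRD mulrC.
have outer := rintZ (Num.sqrt (pi / (t * m))) S.
have mF' := measurableT_comp mF (@measurable_cons_pair R N).
have val : Num.sqrt (pi / (t * m)) * (Num.sqrt (pi / t) ^+ N / Num.sqrt (\det (schur M')))
    = Num.sqrt (pi / t) ^+ N.+1 / Num.sqrt (\det M).
  have -> : pi / (t * m) = pi / t / m by rewrite invfM mulrA.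
  have pt0 : 0 <= pi / t by rewrite divr_ge0 ?pi_ge0// ltW.
  rewrite dM (sqrtrM _ pt0) (sqrtrV (ltW m0)) (sqrtrM _ (ltW m0)) exprS; field.
  by rewrite !gt_eqF ?sqrtr_gt0.
rewrite -val; apply: (rint_fubini2 mF' _ mF' inner outer inner outer) => z.
by rewrite ger0_norm ?expR_ge0.
Qed.

End Gaussian.

(** * Splitting off the last row and column in Lebesgue measure *)

Section Boxes.
Variable R : realType.
Local Notation leb := (@lebesgue_measure R).
Local Notation RT := (measurableTypeR R).

Definition tbox N (A : 'I_N -> set RT) : set (N.-tuple RT) :=
  [set t | forall i, A i (tnth t i)].

Definition mbox m n (A : 'I_m -> 'I_n -> set RT) : set ((m * n).-tuple RT) :=
  [set t | forall k l, A k l (tuple_mx t k l)].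

Lemma tuple_mxE m n (t : (m * n).-tuple RT) k l :
  tuple_mx t k l = tnth t (mxvec_index k l).
Proof. by rewrite /tuple_mx !mxE. Qed.

Lemma measurable_tbox N (A : 'I_N -> set RT) : (forall i, measurable (A i)) ->
  measurable (tbox A).
Proof.
move=> mA; have -> : tbox A = \bigcap_(i : 'I_N) ((fun t => tnth t i) @^-1` A i).
  by apply/seteqP; split => [t At i _|t At i]; [exact: At|exact: (At i I)].
apply: fin_bigcap_measurable => // i _.
by rewrite -[X in measurable X]setTI; exact: (measurable_tnth i).
Qed.

Lemma lebesgue_tbox N (A : 'I_N -> set RT) : (forall i, measurable (A i)) ->
  lebesgue_tuple R N (tbox A) = (\prod_(i < N) leb (A i))%E.
Proof.
elim: N A => [|N IH] A mA.
  by rewrite big_ord0 /= diracE mem_set// => -[].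
rewrite big_ord_recl -IH// -product_measure1E//; last exact: measurable_tbox.
rewrite /= /lebesgue_cons /pushforward; congr (_ _).
apply/seteqP; split => -[x t] /=.
  move=> H; split; first by have := H ord0; rewrite tnth0.
  by move=> i; have := H (lift ord0 i); rewrite tnthS.
move=> [/= Ax At] i; case: (unliftP ord0 i) => [j|] ->; last by rewrite tnth0.
by rewrite tnthS; exact: At.
Qed.

Lemma big_mxvec (T : Type) (idx : T) (op : Monoid.com_law idx) m n
    (F : 'I_m -> 'I_n -> T) (G : 'I_(m * n) -> T) :
  (forall k l, G (mxvec_index k l) = F k l) ->
  \big[op/idx]_i G i = \big[op/idx]_k \big[op/idx]_l F k l.
Proof.
move=> GF; rewrite pair_bigA /= (reindex _ (curry_mxvec_bij m n)) /=.
by apply: eq_bigr => -[k l] _; rewrite -GF.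
Qed.

Definition mxvec_inv m n (i : 'I_(m * n)) : 'I_m * 'I_n :=
  enum_val (cast_ord (esym (mxvec_cast m n)) i).

Lemma mxvec_indexK m n (k : 'I_m) (l : 'I_n) :
  mxvec_inv (mxvec_index k l) = (k, l).
Proof. by rewrite /mxvec_inv /mxvec_index cast_ordK enum_rankK. Qed.

Lemma mbox_tbox m n (A : 'I_m -> 'I_n -> set RT) :
  mbox A = tbox (fun i => A (mxvec_inv i).1 (mxvec_inv i).2).
Proof.
apply/seteqP; split => t At.
  move=> i; case/mxvec_indexP: i => k l; rewrite mxvec_indexK /=.
  by have := At k l; rewrite tuple_mxE.
by move=> k l; have := At (mxvec_index k l); rewrite mxvec_indexK tuple_mxE.
Qed.

Lemma measurable_mbox m n (A : 'I_m -> 'I_n -> set RT) :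
  (forall k l, measurable (A k l)) -> measurable (mbox A).
Proof. by move=> mA; rewrite mbox_tbox; exact: measurable_tbox. Qed.

Lemma lebesgue_mbox m n (A : 'I_m -> 'I_n -> set RT) :
  (forall k l, measurable (A k l)) ->
  lebesgue_tuple R (m * n) (mbox A) = (\prod_(k < m) \prod_(l < n) leb (A k l))%E.
Proof.
move=> mA; rewrite mbox_tbox lebesgue_tbox//; apply: big_mxvec => k l.
by rewrite mxvec_indexK.
Qed.

(** Two measures on pairs of matrices that agree on products of boxes agree:
    such products form a pi-system generating the Borel sets. *)
Lemma lebesgue_pair_unique m n p q
    (nu : {measure set ((m * n).-tuple RT * (p * q).-tuple RT) -> \bar R}) :
  (forall A B, (forall k l, measurable (A k l)) ->
     (forall k l, measurable (B k l)) ->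
     nu (mbox A `*` mbox B) =
     ((\prod_(k < m) \prod_(l < n) leb (A k l)) *
      (\prod_(k < p) \prod_(l < q) leb (B k l)))%E) ->
  forall E, measurable E ->
    (lebesgue_tuple R (m * n) \x lebesgue_tuple R (p * q))%E E = nu E.
Proof.
move=> nuE.
pose T := ((m * n).-tuple RT * (p * q).-tuple RT)%type.
pose G : set (set T) := [set E | exists A B,
  [/\ forall k l, measurable (A k l : set RT),
      forall k l, measurable (B k l : set RT) & E = mbox A `*` mbox B]].
pose g (k : nat) : set T := mbox (fun (_ : 'I_m) (_ : 'I_n) => `[(- k%:R : R), k%:R]%classic)
  `*` mbox (fun (_ : 'I_p) (_ : 'I_q) => `[(- k%:R : R), k%:R]%classic).
have Gg k : G (g k) by exists (fun _ _ => `[(- k%:R : R), k%:R]%classic), (fun _ _ => `[(- k%:R : R), k%:R]%classic).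
have prodE A B : (forall k l, measurable (A k l)) ->
    (forall k l, measurable (B k l)) ->
    (lebesgue_tuple R (m * n) \x lebesgue_tuple R (p * q))%E (mbox A `*` mbox B) =
    ((\prod_(k < m) \prod_(l < n) leb (A k l)) *
      (\prod_(k < p) \prod_(l < q) leb (B k l)))%E.
  move=> mA mB; rewrite -!lebesgue_mbox// product_measure1E//; exact: measurable_mbox.
apply: (@measure_unique _ _ _ G g) => //.
- apply/seteqP; split; last first.
    apply: smallest_sub; first exact: sigma_algebra_measurable.
    by move=> _ [A [B [mA mB ->]]]; apply: measurableX; exact: measurable_mbox.
  move=> E mE.
  pose id1 : g_sigma_algebraType G -> (m * n).-tuple RT := fun x => x.1.
  pose id2 : g_sigma_algebraType G -> (p * q).-tuple RT := fun x => x.2.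
  have m1 : measurable_fun setT id1.
    apply/measurable_fun_tnthP => i _ Y mY; rewrite setTI.
    apply: sub_sigma_algebra; case/mxvec_indexP: i => k l.
    exists (fun k' l' => if (k' == k) && (l' == l) then Y else setT), (fun _ _ => setT).
    split=> //; first by move=> k' l'; case: ifP.
    apply/seteqP; split=> -[x y] /=.
      move=> Yx; split=> // k' l'; rewrite tuple_mxE.
      by case: ifP => // /andP[/eqP -> /eqP ->].
    by move=> [+ _] => /(_ k l); rewrite !eqxx /= tuple_mxE.
  have m2 : measurable_fun setT id2.
    apply/measurable_fun_tnthP => i _ Y mY; rewrite setTI.
    apply: sub_sigma_algebra; case/mxvec_indexP: i => k l.
    exists (fun _ _ => setT), (fun k' l' => if (k' == k) && (l' == l) then Y else setT).
    split=> //; first by move=> k' l'; case: ifP.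
    apply/seteqP; split=> -[x y] /=.
      move=> Yx; split=> // k' l'; rewrite tuple_mxE.
      by case: ifP => // /andP[/eqP -> /eqP ->].
    by move=> [_ +] => /(_ k l); rewrite !eqxx /= tuple_mxE.
  have := measurable_fun_pair m1 m2 => /(_ measurableT E mE).
  rewrite setTI; suff -> : (fun x => (id1 x, id2 x)) @^-1` E = E by [].
  by apply/seteqP; split=> -[].
- move=> _ _ [A [B [mA mB ->]]] [A' [B' [mA' mB' ->]]].
  exists (fun k l => A k l `&` A' k l), (fun k l => B k l `&` B' k l).
  split; [by move=> k l; exact: measurableI|by move=> k l; exact: measurableI|].
  rewrite -setXI; congr (_ `*` _); apply/seteqP; split => t.
  + by move=> [At A't] k l; split; [exact: At|exact: A't].
  + by move=> At; split=> k l; case: (At k l).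
  + by move=> [At A't] k l; split; [exact: At|exact: A't].
  + by move=> At; split=> k l; case: (At k l).
- apply/seteqP; split=> // -[x y] _.
  pose c := \sum_k \sum_l `|tuple_mx x k l| + \sum_k \sum_l `|tuple_mx y k l|.
  have c0 : 0 <= c by rewrite addr_ge0 ?sumr_ge0// => i _; exact: sumr_ge0.
  exists (Num.bound c) => //; have cb := ltW (archi_boundP c0).
  have le1 (a b : nat) (M : 'M[R]_(a, b)) k l :
      `|M k l| <= \sum_k \sum_l `|M k l|.
    rewrite (bigD1 k) //= (bigD1 l) //= -addrA lerDl addr_ge0 ?sumr_ge0// => i _.
    by rewrite sumr_ge0.
  split=> k l; rewrite /= in_itv /= -ler_norml; apply: le_trans cb.
    apply: (le_trans (le1 _ _ _ k l)); rewrite lerDl sumr_ge0// => i _.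
    exact: sumr_ge0.
  apply: (le_trans (le1 _ _ _ k l)); rewrite lerDr sumr_ge0// => i _.
  exact: sumr_ge0.
- by move=> _ [A [B [mA mB ->]]]; rewrite nuE//; exact: prodE.
- move=> k; rewrite /g [X in (X < _)%E]prodE// lebesgue_measure_itv.
  have fin (a b : nat) (x : \bar R) : (0 <= x < +oo)%E ->
      (0 <= \prod_(k < a) \prod_(l < b) x < +oo)%E.
    move=> /andP[x0 xoo].
    elim/big_ind: _ => //; first by rewrite lee01 ltry.
      move=> u v /andP[u0 uo] /andP[v0 vo]; rewrite mule_ge0//=.
      by rewrite lte_mul_pinfty// ge0_fin_numE.
    move=> _ _; elim/big_ind: _ => //; first by rewrite lee01 ltry.
      move=> u v /andP[u0 uo] /andP[v0 vo]; rewrite mule_ge0//=.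
      by rewrite lte_mul_pinfty// ge0_fin_numE.
    by rewrite x0.
  set w := (if _ then _ else _)%E.
  have w0 : (0 <= w < +oo)%E.
    rewrite /w /= lte_fin; case: ifP => h; last by rewrite lexx ltry.
    by rewrite -EFinB lee_fin ltry andbT subr_ge0 ltW.
  have /andP[a0 ao] := fin m n w w0; have /andP[b0 bo] := fin p q w w0.
  by rewrite lte_mul_pinfty// ge0_fin_numE.
Qed.

End Boxes.

Local Notation mxtuples R m n := ((m * n).-tuple (measurableTypeR R)).
Local Notation small R n := (mxtuples R n n * mxtuples R n.+1 n)%type.
Local Notation border R n :=
  (mxtuples R n 4 * (measurableTypeR R * 2.-tuple (measurableTypeR R)))%type.
Local Notation mu_small R n :=
  (sfprod (lebesgue_tuple R (n * n)) (lebesgue_tuple R (n.+1 * n))).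
Local Notation mu_border R n :=
  (sfprod (lebesgue_tuple R (n * 4))
    (sfprod (@lebesgue_measure R) (lebesgue_tuple R 2))).

Lemma pushforward_measure d d' (T1 : measurableType d) (T2 : measurableType d')
    (R : realType) (m : {measure set T1 -> \bar R}) (f : T1 -> T2) :
  measurable_fun setT f ->
  {nu : {measure set T2 -> \bar R} | forall A, nu A = m (f @^-1` A)}.
Proof.
move=> mf; unshelve eexists.
  by unshelve refine (pushforward m f : measure _ _); exact: mf.
by [].
Qed.

Section Glue.
Variable R : realType.
Local Notation leb := (@lebesgue_measure R).
Local Notation RT := (measurableTypeR R).

Definition mxtuple m n (A : 'M[R]_(m, n)) : (m * n).-tuple RT :=
  [tuple mxvec A 0 i | i < m * n].

Lemma mxtupleK m n (A : 'M[R]_(m, n)) : tuple_mx (mxtuple A) = A.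
Proof.
apply/matrixP => k l; rewrite tuple_mxE /mxtuple tnth_mktuple.
by rewrite mxvecE.
Qed.

Variable n : nat.

(** The last row and column are collected in V : 'M_(n, 4), row k of which holds
    the real coordinates of the quaternion t_kn + s_kn j, and in the three real
    numbers t_nn, Re s_nn and Im s_nn. *)
Definition glueT (a : 'M[R]_n) (V : 'M[R]_(n, 4)) (r : R) : 'M[R]_n.+1 :=
  \matrix_(k, l) match unlift ord_max k, unlift ord_max l with
    | Some k', Some l' => a k' l'
    | Some k', None => V k' (inord 0)
    | None, Some l' => V l' (inord 1)
    | None, None => r
    end.

Definition glueS (b : 'M[R]_(n.+1, n)) (V : 'M[R]_(n, 4)) (c : 'rV[R]_2) :
    'M[R]_(n.+2, n.+1) :=
  \matrix_(k, l) match unlift ord_max k, unlift ord_max l with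
    | Some k', Some l' => b k' l'
    | Some k', None => if unlift ord_max k' is Some k'' then V k'' (inord 2)
                       else c 0 0
    | None, Some l' => V l' (inord 3)
    | None, None => c 0 1
    end.

Definition glue (z : small R n * border R n) :
    (n.+1 * n.+1).-tuple RT * (n.+2 * n.+1).-tuple RT :=
  (mxtuple (glueT (tuple_mx z.1.1) (tuple_mx z.2.1) z.2.2.1),
   mxtuple (glueS (tuple_mx z.1.2) (tuple_mx z.2.1) (rowt z.2.2.2))).

Lemma measurable_tuple_mx d (X : measurableType d) p q
    (f : X -> (p * q).-tuple RT) k l : measurable_fun setT f ->
  measurable_fun setT (fun x => tuple_mx (f x) k l).
Proof.
move=> mf; under [fun _ => _]funext do rewrite tuple_mxE.
exact: (measurableT_comp (measurable_tnth _) mf).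
Qed.

Lemma measurable_glue : measurable_fun setT glue.
Proof.
have mfst : measurable_fun setT (@fst (small R n) (border R n)) := measurable_fst.
have msnd : measurable_fun setT (@snd (small R n) (border R n)) := measurable_snd.
have m22 : measurable_fun setT (fun z : small R n * border R n => z.2.2) :=
  measurableT_comp measurable_snd msnd.
have ma k l : measurable_fun setT (fun z : small R n * border R n => tuple_mx z.1.1 k l).
  apply: (@measurable_tuple_mx _ _ _ _ (fun z : small R n * border R n => z.1.1)).
  exact: (measurableT_comp measurable_fst mfst).
have mb k l : measurable_fun setT (fun z : small R n * border R n => tuple_mx z.1.2 k l).
  apply: (@measurable_tuple_mx _ _ _ _ (fun z : small R n * border R n => z.1.2)).
  exact: (measurableT_comp measurable_snd mfst).
have mV k l : measurable_fun setT (fun z : small R n * border R n => tuple_mx z.2.1 k l).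
  apply: (@measurable_tuple_mx _ _ _ _ (fun z : small R n * border R n => z.2.1)).
  exact: (measurableT_comp measurable_fst msnd).
have mc i : measurable_fun setT (fun z : small R n * border R n => rowt z.2.2.2 0 i).
  under [fun _ => _]funext do rewrite mxE.
  exact: (measurableT_comp (measurable_tnth i)
    (measurableT_comp measurable_snd m22)).
apply: measurable_fun_pair; apply/measurable_fun_tnthP => i;
  case/mxvec_indexP: i => k l.
  rewrite (_ : _ \o _ = (fun z : small R n * border R n =>
    glueT (tuple_mx z.1.1) (tuple_mx z.2.1) z.2.2.1 k l)); last first.
    by apply/funext => z /=; rewrite tnth_mktuple mxvecE.
  under [fun _ => _]funext do rewrite mxE.
  case: (unlift ord_max k) (unlift ord_max l) => [k'|] [l'|];
    [exact: ma|exact: mV|exact: mV|].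
  exact: (measurableT_comp measurable_fst m22).
rewrite (_ : _ \o _ = (fun z : small R n * border R n =>
  glueS (tuple_mx z.1.2) (tuple_mx z.2.1) (rowt z.2.2.2) k l)); last first.
  by apply/funext => z /=; rewrite tnth_mktuple mxvecE.
under [fun _ => _]funext do rewrite mxE.
case: (unlift ord_max k) (unlift ord_max l) => [k'|] [l'|];
  [exact: mb| |exact: mV|exact: mc].
by case: (unlift ord_max k') => [k''|]; [exact: mV|exact: mc].
Qed.

Lemma big_ord_max (T : Type) (idx : T) (op : Monoid.com_law idx) p
    (F : 'I_p.+1 -> T) :
  \big[op/idx]_(i < p.+1) F i =
  op (\big[op/idx]_(i < p) F (lift ord_max i)) (F ord_max).
Proof.
rewrite big_ord_recr /=; congr (op _ _); apply: eq_bigr => i _; congr F.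
by apply: val_inj => /=; rewrite /bump leqNgt ltn_ord.
Qed.

Local Open Scope ereal_scope.

(** Every real coordinate of a pair of size n + 1 is exactly one coordinate of the
    pair of size n or of its border, so that boxes pull back to boxes with the
    same sides. *)
Lemma lebesgue_glue E : measurable E ->
  (lebesgue_tuple R (n.+1 * n.+1) \x lebesgue_tuple R (n.+2 * n.+1)) E =
  (mu_small R n \x mu_border R n) (glue @^-1` E).
Proof.
move=> mE; have [nu nuE] :=
  pushforward_measure ((mu_small R n \x mu_border R n)%E :
    {measure set (small R n * border R n) -> \bar R}) measurable_glue.
rewrite -nuE; move: E mE; apply: lebesgue_pair_unique => A B mA mB.
rewrite nuE.
pose A' k l := A (lift ord_max k) (lift ord_max l).
pose B' k l := B (lift ord_max k) (lift ord_max l).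
pose C (k : 'I_n) (l : 'I_4) : set RT := nth setT
  [:: A (lift ord_max k) ord_max; A ord_max (lift ord_max k);
      B (lift ord_max (lift ord_max k)) ord_max; B ord_max (lift ord_max k)] l.
pose D (i : 'I_2) : set RT := nth setT
  [:: B (lift ord_max ord_max) ord_max; B ord_max ord_max] i.
have mC k l : measurable (C k l).
  by rewrite /C; case: l => -[|[|[|[|?]]]] ? //=; first [exact: mA|exact: mB].
have mD i : measurable (D i) 
  by rewrite /D; case: i => -[|[|?]] ? //=; exact: mB.
have -> : glue @^-1` (mbox A `*` mbox B) =
    (mbox A' `*` mbox B') `*` (mbox C `*` (A ord_max ord_max `*` tbox D)).
  apply/seteqP; split => -[[x y] [V [r c]]] /=.
    move=> [HA HB]; split; [split|split; last split] => /=.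
    - move=> k l; have := HA (lift ord_max k) (lift ord_max l).
      by rewrite mxtupleK mxE !liftK.
    - move=> k l; have := HB (lift ord_max k) (lift ord_max l).
      by rewrite mxtupleK mxE !liftK.
    - move=> k l; rewrite -(inord_val l) /C.
      case: l => -[|[|[|[|]]]] //= _; rewrite inordK//=.
      + have := HA (lift ord_max k) ord_max.
        by rewrite mxtupleK mxE liftK unlift_none.
      + have := HA ord_max (lift ord_max k).
        by rewrite mxtupleK mxE liftK unlift_none.
      + have := HB (lift ord_max (lift ord_max k)) ord_max.
        by rewrite mxtupleK mxE !liftK unlift_none.
      + have := HB ord_max (lift ord_max k).
        by rewrite mxtupleK mxE liftK unlift_none.
    - by have := HA ord_max ord_max; rewrite mxtupleK mxE !unlift_none.
    - move=> i; rewrite /D; case: i => -[|[|]] //= i2.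
        have := HB (lift ord_max ord_max) ord_max.
        rewrite mxtupleK mxE !liftK !unlift_none mxE.
        by congr (B _ _ (tnth _ _)); exact: val_inj.
      have := HB ord_max ord_max; rewrite mxtupleK mxE !unlift_none mxE.
      by congr (B _ _ (tnth _ _)); exact: val_inj.
  move=> [[/= HA HB] [/= HC [/= Hr HD]]]; split => k l; rewrite mxtupleK mxE.
    case: (unliftP ord_max k) => [k'|] ->; case: (unliftP ord_max l) => [l'|] -> //.
    - exact: HA.
    - by have := HC k' (inord 0); rewrite /C inordK.
    - by have := HC l' (inord 1); rewrite /C inordK.
  case: (unliftP ord_max k) => [k'|] ->; case: (unliftP ord_max l) => [l'|] ->.
  - exact: HB.
  - case: (unliftP ord_max k') => [k''|] ->.
      by have := HC k'' (inord 2); rewrite /C inordK.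
    by have := HD 0%R; rewrite mxE.
  - by have := HC l' (inord 3); rewrite /C inordK.
  - by have := HD 1%R; rewrite mxE.
have mB' : measurable (mbox A' `*` mbox B').
  by apply: measurableX; apply: measurable_mbox => k l; [exact: mA|exact: mB].
have mD' : measurable (A ord_max ord_max `*` tbox D).
  by apply: measurableX => //; exact: measurable_tbox.
have mCD : measurable (mbox C `*` (A ord_max ord_max `*` tbox D)).
  by apply: measurableX => //; exact: measurable_mbox.
transitivity (mu_small R n (mbox A' `*` mbox B') *
    mu_border R n (mbox C `*` (A ord_max ord_max `*` tbox D))).
  exact: product_measure1E.
have mA' : measurable (mbox A') by apply: measurable_mbox => k l; exact: mA.
have mB'' : measurable (mbox B') by apply: measurable_mbox => k l; exact: mB.
have mtD : measurable (tbox D) by exact: measurable_tbox.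
have mmC : measurable (mbox C) by exact: measurable_mbox.
rewrite sfprodE// sfprodE// sfprodE// !lebesgue_mbox//; last 2 first.
- by move=> k l; exact: mB.
- by move=> k l; exact: mA.
rewrite lebesgue_tbox//.
have -> : \prod_(i < 2) leb (D i) =
    leb (B (lift ord_max ord_max) ord_max) * leb (B ord_max ord_max).
  by rewrite !big_ord_recl big_ord0 mule1.
have -> : \prod_(k < n) \prod_(l < 4) leb (C k l) =
    (\prod_(k < n) leb (A (lift ord_max k) ord_max)) *
    (\prod_(k < n) leb (A ord_max (lift ord_max k))) *
    ((\prod_(k < n) leb (B (lift ord_max (lift ord_max k)) ord_max)) *
    (\prod_(k < n) leb (B ord_max (lift ord_max k)))).
  rewrite -!big_split /=; apply: eq_bigr => k _.
  by rewrite !big_ord_recl big_ord0 mule1 /C /= !muleA.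
rewrite !big_ord_max /=.
have -> : \prod_(i < n) \prod_(l < n.+1) leb (A (lift ord_max i) l) =
    (\prod_(i < n) \prod_(l < n) leb (A' i l)) *
    \prod_(i < n) leb (A (lift ord_max i) ord_max).
  by rewrite -big_split /=; apply: eq_bigr => k _; rewrite big_ord_max.
have -> : \prod_(i < n) \prod_(l < n.+1) leb (B (lift ord_max (lift ord_max i)) l) =
    (\prod_(i < n) \prod_(l < n) leb (B' (lift ord_max i) l)) *
    \prod_(i < n) leb (B (lift ord_max (lift ord_max i)) ord_max).
  by rewrite -big_split /=; apply: eq_bigr => k _; rewrite big_ord_max.
by rewrite (AC ((1*2)*((2*2)*(1*2))) ((1*4)*(5*8)*((2*6)*(3*9)*(7*10)))).
Qed.

End Glue.

(** * Determinants of quaternionic matrices *)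

Section Reindex.

Lemma det_mxsub_bij (K : comNzRingType) a b (f : 'I_a -> 'I_b) (A : 'M[K]_b) :
  bijective f -> \det (mxsub f f A) = \det A.
Proof.
move=> bf; have ab : a = b by rewrite -(card_ord a) -(card_ord b) (bij_eq_card bf).
subst b; pose s := perm (bij_inj bf).
have -> : mxsub f f A = row_perm s (col_perm s A).
  by apply/matrixP => i j; rewrite !mxE !permE.
rewrite row_permE col_permE !det_mulmx !det_perm odd_permV.
by case: (odd_perm s); rewrite ?expr1 ?expr0; ring.
Qed.

Definition last_split n (i : 'I_(n + 1)) : 'I_n.+1 :=
  match fintype.split i with inl k => lift ord_max k | inr _ => ord_max end.

Lemma last_splitl n (k : 'I_n) : last_split (lshift 1 k) = lift ord_max k.
Proof. by rewrite /last_split (unsplitK (inl k)). Qed.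

Lemma last_splitr n (k : 'I_1) : last_split (rshift n k) = ord_max.
Proof. by rewrite /last_split (unsplitK (inr k)). Qed.

Lemma last_split_bij n : bijective (@last_split n).
Proof.
exists (fun i => if unlift ord_max i is Some k then lshift 1 k else rshift n 0).
  move=> i; case: (split_ordP i) => k ->; first by rewrite last_splitl liftK.
  by rewrite last_splitr unlift_none ord1.
move=> i; case: (unliftP ord_max i) => [k|] ->; first by rewrite last_splitl.
by rewrite last_splitr.
Qed.

Lemma mxvec_invK m n (i : 'I_(m * n)) :
  mxvec_index (mxvec_inv i).1 (mxvec_inv i).2 = i.
Proof. by case/mxvec_indexP: i => k l; rewrite mxvec_indexK. Qed.

End Reindex.

(** Locked, because unification would otherwise unfold matrix products over the
   quaternions. *)
HB.lock Definition qop (R : realType) m p (g : 'M[quat R]_(m, p))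
    (v : 'M[R]_(p, 4)) : 'M[R]_(m, 4) :=
  real_coords (g *m quat_col v).

HB.lock Definition rmx (R : realType) m p (g : 'M[quat R]_(m, p)) :
    'M[R]_(p * 4, m * 4) := lin_mx (qop g).

Section RealRepresentation.
Variable R : realType.
Local Notation H := (quat R).

Definition qcoord (x : H) (l : nat) : R := nth 0 [:: q1 x; qi x; qj x; qk x] l.

Definition qbasis (l : nat) : H :=
  Quat (l == 0%N)%:R (l == 1%N)%:R (l == 2%N)%:R (l == 3%N)%:R.

(** The square of the quaternionic absolute value. *)
Definition qnorm (x : H) : R := q1 x ^+ 2 + qi x ^+ 2 + qj x ^+ 2 + qk x ^+ 2.

Lemma real_coordsK m (w : 'cV[H]_m) : quat_col (real_coords w) = w.
Proof.
apply/colP => k; rewrite /quat_col /real_coords !mxE !inordK//=.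
by case: (w k 0).
Qed.

Lemma quat_colK m (v : 'M[R]_(m, 4)) : real_coords (quat_col v) = v.
Proof.
apply/matrixP => k l; rewrite !mxE /=.
rewrite -[in RHS](inord_val l).
by case: l => -[|[|[|[|]]]].
Qed.

Lemma qaddE (x y : H) :
  x + y = Quat (q1 x + q1 y) (qi x + qi y) (qj x + qj y) (qk x + qk y).
Proof. by []. Qed.

Lemma qmulE (x y : H) : x * y = Quat
  (q1 x * q1 y - qi x * qi y - qj x * qj y - qk x * qk y)
  (q1 x * qi y + qi x * q1 y + qj x * qk y - qk x * qj y)
  (q1 x * qj y - qi x * qk y + qj x * q1 y + qk x * qi y)
  (q1 x * qk y + qi x * qj y - qj x * qi y + qk x * q1 y).
Proof. by []. Qed.

Lemma qcoord_sum (I : finType) (F : I -> H) l :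
  qcoord (\sum_i F i) l = \sum_i qcoord (F i) l.
Proof.
elim/big_rec2: _ => [|i x y _ <-]; first by case: l => [|[|[|[|[|]]]]].
by case: l => [|[|[|[|[|l]]]]] //=; rewrite ?add0r// /qcoord /= nth_default ?add0r ?addr0.
Qed.

Lemma qopE m p (g : 'M[H]_(m, p)) v k l :
  qop g v k l = \sum_j qcoord (g k j * quat_col v j 0) l.
Proof. by rewrite qop.unlock [LHS]mxE [in LHS]mxE -qcoord_sum. Qed.

Lemma qop_linear m p (g : 'M[H]_(m, p)) : linear (qop g).
Proof.
move=> a u v; apply/matrixP => k l.
have E (M1 M2 : 'M[R]_(m, 4)) : (a *: M1 + M2) k l = a * M1 k l + M2 k l.
  by rewrite !mxE.
apply: (etrans (qopE _ _ _ _)).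
apply: esym.
apply: (etrans (E _ _)).
rewrite (qopE g u k l).
rewrite (qopE g v k l).
rewrite mulr_sumr -big_split /=.
apply: eq_bigr => j _.
rewrite !mxE.
rewrite !qmulE.
case: (g k j) => x1 x2 x3 x4 /= {E}.
by case: l => -[|[|[|[|]]]] //= _; rewrite /qcoord /=; ring.
Qed.

Lemma rmx_vec m p (g : 'M[H]_(m, p)) v : mxvec v *m rmx g = mxvec (qop g v).
Proof.
pose f : {linear 'M[R]_(p, 4) -> 'M[R]_(m, 4)} :=
  HB.pack (qop g) (GRing.isLinear.Build _ _ _ _ _ (qop_linear g)).
by rewrite rmx.unlock; exact: (mul_vec_lin f).
Qed.

Lemma eq_mulrV m p (A B : 'M[R]_(m, p)) :
  (forall u : 'rV_m, u *m A = u *m B) -> A = B.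
Proof. by move=> AB; apply/row_matrixP => i; rewrite !rowE AB. Qed.

Lemma qopM m p q (g : 'M[H]_(m, p)) (h : 'M[H]_(p, q)) v :
  qop (g *m h) v = qop g (qop h v).
Proof. by rewrite qop.unlock real_coordsK mulmxA. Qed.

(** The order is reversed because rmx acts on row vectors. *)
Lemma rmxM m p q (g : 'M[H]_(m, p)) (h : 'M[H]_(p, q)) :
  rmx (g *m h) = rmx h *m rmx g.
Proof.
apply: eq_mulrV => u; rewrite -(vec_mxK u) mulmxA !rmx_vec.
by rewrite qopM.
Qed.

Lemma rmxD m p (g h : 'M[H]_(m, p)) : rmx (g + h) = rmx g + rmx h.
Proof.
apply: eq_mulrV => u; rewrite -(vec_mxK u) mulmxDr !rmx_vec.
rewrite -(linearD (@mxvec R m 4)); congr mxvec; apply/matrixP => k l.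
have E (M1 M2 : 'M[R]_(m, 4)) : (M1 + M2) k l = M1 k l + M2 k l.
  by rewrite mxE.
rewrite (E (qop g _)) (qopE (g + h)) (qopE g) (qopE h) -big_split /=.
apply: eq_bigr => j _.
have -> : (g + h) k j = g k j + h k j by rewrite mxE.
rewrite mulrDl; move: (g k j * _) (h k j * _) => a b {E}.
by case: l => -[|[|[|[|]]]].
Qed.

Lemma rmx1 m : rmx (1%:M : 'M[H]_m) = 1%:M.
Proof.
apply: eq_mulrV => u; rewrite -(vec_mxK u) mulmx1 rmx_vec.
by rewrite qop.unlock mul1mx quat_colK.
Qed.

Lemma rmxE m p (g : 'M[H]_(m, p)) k l k' l' :
  rmx g (mxvec_index k l) (mxvec_index k' l') =
  qcoord (g k' k * qbasis l) l'.
Proof.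
rewrite rmx.unlock /lin_mx /lin1_mx mxE /= vec_mx_delta mxvecE qopE (bigD1 k) //=.
rewrite big1 ?addr0; last first.
  move=> j jk; rewrite !mxE (negbTE jk) /=.
  rewrite qmulE /=; case: (g k' j) => x1 x2 x3 x4 /=.
  by case: l' => -[|[|[|[|]]]] //= _; rewrite /qcoord /=; ring.
congr (qcoord (_ * _) _); rewrite !mxE eqxx /= /qbasis.
by congr Quat; rewrite -val_eqE /= inordK// eq_sym.
Qed.

Definition Lq (x : H) : 'M[R]_4 := \matrix_(l, l') qcoord (x * qbasis l) l'.

Lemma LqM x y : Lq (x * y) = Lq y *m Lq x.
Proof.
apply/matrixP => l l'; rewrite !mxE -mulrA !big_ord_recl big_ord0 !mxE.
move: (y * qbasis l) => z; rewrite !qmulE.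
case: x z => a b c d [a' b' c' d'].
by case: l' => -[|[|[|[|]]]] //= _; rewrite /qcoord /=; ring.
Qed.

Lemma Lq_real a : Lq (Quat a 0 0 0) = a%:M.
Proof.
apply/matrixP => l l'; rewrite !mxE qmulE /qcoord -val_eqE /=.
by case: l => -[|[|[|[|]]]] //= _; case: l' => -[|[|[|[|]]]] //= _; ring.
Qed.

Lemma Lq_conj x : Lq (Quat (q1 x) (- qi x) (- qj x) (- qk x)) = (Lq x)^T.
Proof.
apply/matrixP => l l'; rewrite !mxE !qmulE /qcoord.
case: x => a b c d.
by case: l => -[|[|[|[|]]]] //= _; case: l' => -[|[|[|[|]]]] //= _; ring.
Qed.

(** The product with the conjugate gives det ^ 2 = |x| ^ 8. The sign is
    positive because (|x| + x) ^ 2 = 2 (|x| + Re x) x, so that x is a square up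
    to a nonnegative factor. *)
Lemma det_Lq x : \det (Lq x) = qnorm x ^+ 2.
Proof.
have n0 : 0 <= qnorm x by rewrite /qnorm !addr_ge0 ?sqr_ge0.
have sq : \det (Lq x) ^+ 2 = (qnorm x ^+ 2) ^+ 2.
  have := congr1 determinant (LqM x (Quat (q1 x) (- qi x) (- qj x) (- qk x))).
  rewrite det_mulmx Lq_conj det_tr -expr2 => <-.
  have -> : x * Quat (q1 x) (- qi x) (- qj x) (- qk x) = Quat (qnorm x) 0 0 0.
    by rewrite qmulE /qnorm /=; congr Quat; ring.
  by rewrite Lq_real det_scalar -exprM.
have det_ge0 : 0 <= \det (Lq x).
  pose r := Num.sqrt (qnorm x); have r2 : r ^+ 2 = qnorm x by rewrite sqr_sqrtr.
  have [ra|ra] := eqVneq (r + q1 x) 0.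
    have : qi x ^+ 2 + qj x ^+ 2 + qk x ^+ 2 = 0.
      have : r ^+ 2 = q1 x ^+ 2.
        by rewrite (_ : r = - q1 x) ?sqrrN//; apply/eqP; rewrite -addr_eq0 ra.
      by rewrite r2 /qnorm => h; lra.
    move=> /eqP; rewrite paddr_eq0 ?addr_ge0 ?sqr_ge0// paddr_eq0 ?sqr_ge0//.
    rewrite !sqrf_eq0 => /andP[/andP[/eqP bi /eqP bj] /eqP bk].
    have -> : x = Quat (q1 x) 0 0 0 by case: x bi bj bk {n0 sq r r2 ra} => ? ? ? ? /= -> -> ->.
    by rewrite Lq_real det_scalar -[4%N]/(2 * 2)%N exprM sqr_ge0.
  have := congr1 determinant (LqM (Quat r 0 0 0 + x) (Quat r 0 0 0 + x)).
  have -> : (Quat r 0 0 0 + x) * (Quat r 0 0 0 + x) = Quat (2 * (r + q1 x)) 0 0 0 * x.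
    rewrite qaddE !qmulE /=; congr Quat; [|ring..].
    apply/eqP; rewrite -subr_eq0; apply/eqP.
    transitivity (r ^+ 2 - qnorm x); last by rewrite r2 subrr.
    by rewrite /qnorm; ring.
  rewrite LqM Lq_real !det_mulmx det_scalar -expr2 => E.
  have : 0 <= \det (Lq x) * (2 * (r + q1 x)) ^+ 4 by rewrite E sqr_ge0.
  rewrite pmulr_lge0// -[4%N]/(2 * 2)%N exprM lt_neqAle sqr_ge0 andbT eq_sym.
  by rewrite !expf_neq0// mulf_neq0// pnatr_eq0.
by apply/eqP; rewrite -(eqrXn2 (n := 2)) ?sqr_ge0//; apply/eqP.
Qed.

(** The same permutation of rows and columns permutes the rows and the columns of
    the real matrix by the blocks of four coordinates. *)
Lemma det_rmx_mxsub a b (f : 'I_a -> 'I_b) (g : 'M[H]_b) : bijective f ->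
  \det (rmx (mxsub f f g)) = \det (rmx g).
Proof.
move=> [h fK hK].
pose e (i : 'I_(a * 4)) : 'I_(b * 4) :=
  mxvec_index (f (mxvec_inv i).1) (mxvec_inv i).2.
have be : bijective e.
  exists (fun i : 'I_(b * 4) => mxvec_index (h (mxvec_inv i).1) (mxvec_inv i).2) => i.
    by rewrite /e mxvec_indexK /= fK mxvec_invK.
  by rewrite /e mxvec_indexK /= hK mxvec_invK.
rewrite -(det_mxsub_bij (rmx g) be); congr (\det _).
apply/matrixP => i j; rewrite [RHS]mxE /e.
case/mxvec_indexP: i => k l; case/mxvec_indexP: j => k' l'.
by rewrite !mxvec_indexK /= !rmxE mxE.
Qed.

Section Blocks.
Variable n : nat.

Let e (i : 'I_(n * 4 + 4)) : 'I_((n + 1) * 4) :=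
  match fintype.split i with
  | inl j => mxvec_index (lshift 1 (mxvec_inv j).1) (mxvec_inv j).2
  | inr l => mxvec_index (rshift n 0) l
  end.

Let e_l k l : e (lshift 4 (mxvec_index k l)) = mxvec_index (lshift 1 k) l.
Proof. by rewrite /e (unsplitK (inl _)) mxvec_indexK. Qed.

Let e_r l : e (rshift (n * 4) l) = mxvec_index (rshift n 0) l.
Proof. by rewrite /e (unsplitK (inr _)). Qed.

Let e_bij : bijective e.
Proof.
exists (fun i => match fintype.split (mxvec_inv i).1 with
  | inl k => lshift 4 (mxvec_index k (mxvec_inv i).2)
  | inr _ => rshift (n * 4) (mxvec_inv i).2 end) => i.
  case: (split_ordP i) => j ->.
    case/mxvec_indexP: j => k l; rewrite e_l mxvec_indexK /=.
    by rewrite (unsplitK (inl _)).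
  by rewrite e_r mxvec_indexK /= (unsplitK (inr _)).
case/mxvec_indexP: i => k l; rewrite mxvec_indexK /=.
case: (split_ordP k) => k' ->; first by rewrite e_l.
by rewrite e_r ord1.
Qed.

Lemma det_rmx_lblock (X : 'M[H]_n) (v : 'M[H]_(1, n)) (d : 'M[H]_1) :
  \det (rmx (block_mx X 0 v d)) = \det (rmx X) * qnorm (d 0 0) ^+ 2.
Proof.
rewrite -(det_mxsub_bij _ e_bij) -[mxsub _ _ _]submxK.
have -> : dlsubmx (mxsub e e (rmx (block_mx X 0 v d))) = 0.
  apply/matrixP => l j; case/mxvec_indexP: j => k' l'.
  do 3 rewrite [LHS]mxE; rewrite e_r e_l rmxE block_mxEur !mxE mul0r.
  by case: l' => -[|[|[|[|]]]].
have -> : ulsubmx (mxsub e e (rmx (block_mx X 0 v d))) = rmx X.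
  apply/matrixP => i j; case/mxvec_indexP: i => k l; case/mxvec_indexP: j => k' l'.
  by do 3 rewrite [LHS]mxE; rewrite !e_l !rmxE block_mxEul.
have -> : drsubmx (mxsub e e (rmx (block_mx X 0 v d))) = Lq (d 0 0).
  apply/matrixP => l l'; do 3 rewrite [LHS]mxE.
  by rewrite !e_r rmxE block_mxEdr [RHS]mxE.
by rewrite det_ublock det_Lq.
Qed.

Lemma det_rmx_ublock (X : 'M[H]_n) (u : 'M[H]_(n, 1)) (d : 'M[H]_1) :
  \det (rmx (block_mx X u 0 d)) = \det (rmx X) * qnorm (d 0 0) ^+ 2.
Proof.
rewrite -(det_mxsub_bij _ e_bij) -[mxsub _ _ _]submxK.
have -> : ursubmx (mxsub e e (rmx (block_mx X u 0 d))) = 0.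
  apply/matrixP => j l; case/mxvec_indexP: j => k' l'.
  do 3 rewrite [LHS]mxE; rewrite e_r e_l rmxE block_mxEdl !mxE mul0r.
  by case: l => -[|[|[|[|]]]].
have -> : ulsubmx (mxsub e e (rmx (block_mx X u 0 d))) = rmx X.
  apply/matrixP => i j; case/mxvec_indexP: i => k l; case/mxvec_indexP: j => k' l'.
  by do 3 rewrite [LHS]mxE; rewrite !e_l !rmxE block_mxEul.
have -> : drsubmx (mxsub e e (rmx (block_mx X u 0 d))) = Lq (d 0 0).
  apply/matrixP => l l'; do 3 rewrite [LHS]mxE.
  by rewrite !e_r rmxE block_mxEdr [RHS]mxE.
by rewrite det_lblock det_Lq.
Qed.

(** The Schur complement formula, with a solution w of X w = u in place of an
    inverse of the quaternionic matrix X. *)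
Lemma det_rmx_block (X : 'M[H]_n) (u w : 'M[H]_(n, 1)) v d : X *m w = u ->
  \det (rmx (block_mx X u v d)) =
  \det (rmx X) * qnorm ((d - v *m w) 0 0) ^+ 2.
Proof.
move=> Xw; rewrite -(det_rmx_lblock X v).
have E : block_mx X u v d *m block_mx 1%:M (- w) 0 1%:M =
    block_mx X 0 v (d - v *m w).
  rewrite (mulmx_block X u v d) (mulmx1 X) (mulmx1 v) (mulmx1 u) (mulmx1 d).
  rewrite (mulmx0 _ u) (mulmx0 _ d) (mulmxN X) (mulmxN v) Xw addNr.
  by rewrite (addr0 X) (addr0 v) (addrC (- _) d).
rewrite -E rmxM det_mulmx det_rmx_ublock rmx1 det1.
rewrite mul1r mxE eqxx mulr1n.
by rewrite /qnorm /= !expr0n !addr0 !expr1n mul1r.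
Qed.

End Blocks.
End RealRepresentation.

(** * The quadratic form of the border *)

Section BorderForm.
Variables (R : realType) (N : nat).
Implicit Types (v z m : 'rV[R]_N).

Lemma quad1_gt0 v : v != 0 -> 0 < quad 1%:M v.
Proof.
move=> v0; rewrite /quad mulmx1 mxE; under eq_bigr do rewrite mxE -expr2.
rewrite lt_neqAle sumr_ge0 ?andbT => [|i _]; last exact: sqr_ge0.
rewrite eq_sym psumr_neq0 => [|i _]; last exact: sqr_ge0.
have /rV0Pn[i vi] := v0; apply/hasP; exists i; first exact: mem_index_enum.
by rewrite /= exprn_even_gt0.
Qed.

Lemma quadD (A B : 'M[R]_N) v : quad (A + B) v = quad A v + quad B v.
Proof. by rewrite /quad mulmxDr mulmxDl mxE. Qed.

Lemma quad_tr (A : 'M[R]_N) v : quad A^T v = quad A v.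
Proof.
rewrite /quad; transitivity ((v *m A *m v^T)^T 0 0); last by rewrite mxE.
by rewrite !trmx_mul trmxK mulmxA.
Qed.

Lemma quad_antisym (A : 'M[R]_N) v : A^T = - A -> quad A v = 0.
Proof.
move=> AT; have := quad_tr A v; rewrite AT /quad mulmxN mulNmx mxE.
by move=> /eqP; rewrite -subr_eq0 -opprD oppr_eq0 -mulr2n mulrn_eq0 => /eqP.
Qed.

Lemma unitmx_quad (A : 'M[R]_N) : (forall v, v != 0 -> 0 < quad A v) ->
  A \in unitmx.
Proof.
move=> A0; rewrite -row_free_unit; apply/inj_row_free => v vA.
apply/eqP; apply: contraT => v0; have := A0 v v0.
by rewrite /quad vA mul0mx mxE ltxx.
Qed.

(** Here p and y stand for the real matrices of P and A j, Pq and Pb for the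
    projections on the two complex halves of H^n, and s for the exchange of the
    halves. *)
Variables p y Pq Pb : 'M[R]_N.
Variable s : 'I_N -> 'I_N.
Hypotheses (pP : posquad p) (yT : y^T = - y).
Hypotheses (Pqb : Pq + Pb = 1%:M) (PqPq : Pq *m Pq = Pq) (PbPb : Pb *m Pb = Pb)
  (PqPb : Pq *m Pb = 0) (PbPq : Pb *m Pq = 0) (PqT : Pq^T = Pq) (PbT : Pb^T = Pb).
Hypotheses (pPq : p *m Pq = Pq *m p) (pPb : p *m Pb = Pb *m p)
  (yPq : y *m Pq = Pb *m y) (yPb : y *m Pb = Pq *m y).
Hypotheses (sK : involutive s) (sp : mxsub s s p = p)
  (sPq : mxsub s s Pq = Pb) (sPb : mxsub s s Pb = Pq).

Definition border_x : 'M[R]_N := 1%:M + p + y.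
Local Notation x := border_x.
Let pi := invmx p.
Let xi := invmx x.
Let tau := Pq - Pb.

(** The form gamma of the border: the difference of the Schur complements of
    the two bordered matrices. *)
Definition border_form : 'M[R]_N := Pq *m pi - tau *m xi^T.

Let quad_x m : quad x m = quad 1%:M m + quad p m.
Proof. by rewrite /x !quadD (quad_antisym _ yT) addr0. Qed.

Lemma border_x_unit : x \in unitmx.
Proof.
apply: unitmx_quad => v v0; rewrite quad_x ltr_wpDr ?quad1_gt0//.
exact: posquad_ge0.
Qed.

Let pU : p \in unitmx. Proof. by apply: unitmx_quad; case: pP. Qed.
Let ppi : p *m pi = 1%:M. Proof. exact: mulmxV. Qed.
Let pip : pi *m p = 1%:M. Proof. exact: mulVmx. Qed.
Let xxi : x *m xi = 1%:M. Proof. exact: mulmxV border_x_unit. Qed.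
Let xix : xi *m x = 1%:M. Proof. exact: mulVmx border_x_unit. Qed.

Let piT : pi^T = pi. Proof. by rewrite /pi trmx_inv; case: pP => ->. Qed.

Let xT : x^T = 1%:M + p - y.
Proof. by rewrite /x !raddfD /= trmx1 yT; case: pP => ->. Qed.

Let piPq : pi *m Pq = Pq *m pi.
Proof.
by rewrite -[LHS]mulmx1 -ppi !mulmxA -(mulmxA pi Pq p) -pPq mulmxA pip mul1mx.
Qed.

Let piPb : pi *m Pb = Pb *m pi.
Proof.
by rewrite -[LHS]mulmx1 -ppi !mulmxA -(mulmxA pi Pb p) -pPb mulmxA pip mul1mx.
Qed.

Let ytau : y *m tau = - (tau *m y).
Proof. by rewrite /tau mulmxBr mulmxBl yPq yPb opprB. Qed.

Let tau2 : tau *m tau = 1%:M.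
Proof.
by rewrite /tau mulmxBl !mulmxBr PqPq PqPb PbPq PbPb subr0 sub0r opprK.
Qed.

Let ptau : p *m tau = tau *m p.
Proof. by rewrite /tau mulmxBr mulmxBl pPq pPb. Qed.

Let xtau : x *m tau = tau *m x^T.
Proof.
rewrite xT /x (mulmxBr tau) (mulmxDr tau) (mulmxDl _ y tau) (mulmxDl _ p tau).
by rewrite mul1mx mulmx1 ptau ytau.
Qed.

Let xiT_tau : tau *m xi^T = xi *m tau.
Proof.
have <- : xi *m (x *m tau) *m xi^T = tau *m xi^T by rewrite mulmxA xix mul1mx.
by rewrite xtau -!mulmxA -trmx_mul xix trmx1 mulmx1.
Qed.

Let K := Pq *m pi *m (1%:M - y) + Pb.

Let formK : border_form *m x^T = K.
Proof.
rewrite /border_form mulmxBl -[tau *m _ *m _]mulmxA -trmx_mul xxi trmx1 mulmx1.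
rewrite xT addrAC mulmxDr -[X in _ + X - _]mulmxA pip mulmx1 /K -addrA.
by congr (_ + _); rewrite /tau opprB addrCA subrr addr0.
Qed.

(** Substituting z = m x turns the form into pi[h] + |m|^2 + p[m Pb] with
    h = m (1 + y) Pq. *)
Lemma border_form_pos : posquad border_form.
Proof.
split.
  rewrite /border_form raddfB /= !trmx_mul trmxK piT PqT piPq; congr (_ - _).
  have -> : tau^T = tau by rewrite /tau raddfB /= PqT PbT.
  by rewrite xiT_tau.
move=> z z0; pose m := z *m xi; have zE : z = m *m x.
  by rewrite /m -mulmxA xix mulmx1.
have m0 : m != 0 by apply: contra z0; rewrite zE => /eqP ->; rewrite mul0mx.
clearbody m; pose h := m *m (1%:M + y) *m Pq.
have hT : h^T = Pq *m (1%:M - y) *m m^T.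
  by rewrite /h !trmx_mul raddfD /= trmx1 yT PqT mulmxA.
have xK : x *m K = (1%:M + y) *m Pq *m pi *m Pq *m (1%:M - y) + 1%:M + Pb *m p *m Pb.
  have xPq : x *m Pq = (1%:M + y) *m Pq + Pq *m p.
    have -> : x = (1%:M + y) + p by rewrite /border_x addrAC.
    by rewrite (mulmxDl _ p) pPq.
  have xPb : x *m Pb = Pb + Pb *m p *m Pb + Pq *m y.
    rewrite /border_x (mulmxDl _ y) (mulmxDl _ p) mul1mx yPb.
    by rewrite -(mulmxA Pb p) pPb mulmxA PbPb.
  have A3 : (1%:M + y) *m Pq *m pi *m Pq = (1%:M + y) *m Pq *m pi.
    by rewrite -(mulmxA _ pi) piPq mulmxA -(mulmxA _ Pq Pq) PqPq.
  have A4 : x *m Pq *m pi = (1%:M + y) *m Pq *m pi *m Pq + Pq.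
    by rewrite xPq mulmxDl A3 -(mulmxA Pq p) ppi mulmx1.
  have -> : x *m K = x *m Pq *m pi *m (1%:M - y) + x *m Pb.
    by rewrite /K mulmxDr !mulmxA.
  rewrite A4 xPb mulmxDl (mulmxBr Pq) mulmx1 -Pqb.
  have G (B q Y b D : 'M[R]_N) : B + (q - Y) + (b + D + Y) = B + (q + b) + D.
    by apply/matrixP => i j; rewrite !mxE; ring.
  exact: G.
have -> : quad border_form z = quad pi h + quad 1%:M m + quad p (m *m Pb).
  have -> : quad border_form z = quad (x *m K) m.
    rewrite /quad [in LHS]zE trmx_mul -formK !mulmxA.
    by [].
  rewrite xK !quadD; congr (_ + _ + _).
    by rewrite /quad hT /h !mulmxA.
  by rewrite /quad trmx_mul PbT !mulmxA.
have pi0 : 0 <= quad pi h.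
  have -> : quad pi h = quad p (h *m pi).
    by rewrite /quad (trmx_mul h pi) piT !mulmxA -(mulmxA h pi p) pip mulmx1.
  exact: posquad_ge0.
by rewrite ltr_wpDr ?posquad_ge0// ltr_wpDl// quad1_gt0.
Qed.

(** The product of the form with x^T is K = (Pq pi + Pb) (1 - Pq y). The second
    factor is unipotent. Conjugating the first by s exchanges the roles of Pq and
    Pb, and the product with the conjugate is pi. *)
Lemma det_border_form :
  (\det border_form * \det x) ^+ 2 * \det p = 1.
Proof.
have detK : \det border_form * \det x = \det K.
  by rewrite -formK det_mulmx det_tr.
have PyPy : Pq *m y *m (Pq *m y) = 0.
  by rewrite mulmxA -(mulmxA Pq) yPq mulmxA PqPb !mul0mx.
have KE : K = (Pq *m pi + Pb) *m (1%:M - Pq *m y).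
  have E : (Pq *m pi + Pb) *m (Pq *m y) = Pq *m pi *m y.
    rewrite mulmxDl (mulmxA Pb) PbPq mul0mx addr0 (mulmxA _ Pq y).
    by rewrite -(mulmxA Pq pi Pq) piPq (mulmxA Pq Pq) PqPq.
  by rewrite /K !mulmxBr !mulmx1 E addrAC.
have d1 : \det (1%:M - Pq *m y) ^+ 2 = 1.
  have tt : \det tau * \det tau = 1 by rewrite -det_mulmx tau2 det1.
  have e1 : tau *m (1%:M - Pq *m y) *m tau = 1%:M + Pq *m y.
    have tq : tau *m Pq = Pq by rewrite /tau mulmxBl PqPq PbPq subr0.
    have qt : Pq *m tau = Pq by rewrite /tau mulmxBr PqPq PqPb subr0.
    have a1 : tau *m (Pq *m y) *m tau = - (Pq *m y).
      by rewrite (mulmxA tau) tq -(mulmxA Pq) ytau mulmxN (mulmxA Pq) qt.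
    by rewrite (mulmxBr tau) mulmx1 (mulmxBl tau) tau2 a1 opprK.
  have e2 : (1%:M - Pq *m y) *m (1%:M + Pq *m y) = 1%:M.
    rewrite mulmxBl mul1mx mulmxDr mulmx1 PyPy addr0 addrK.
    by [].
  have := congr1 determinant e2; rewrite -e1 !det_mulmx det1.
  by rewrite [\det tau * _]mulrC -mulrA tt mulr1 expr2.
have smul (A B : 'M[R]_N) : mxsub s s (A *m B) = mxsub s s A *m mxsub s s B.
  apply/matrixP => i j; rewrite !mxE (reindex_inj (inv_inj sK)) /=.
  by apply: eq_bigr => k _; rewrite !mxE.
have s1 : mxsub s s 1%:M = 1%:M :> 'M[R]_N.
  by apply/matrixP => i j; rewrite !mxE (inj_eq (inv_inj sK)).
have spi : mxsub s s pi = pi.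
  rewrite -[LHS]mulmx1 -ppi mulmxA -{1}sp -smul pip s1.
  by rewrite mul1mx.
have d2 : \det (Pq *m pi + Pb) ^+ 2 * \det p = 1.
  have e1 : mxsub s s (Pq *m pi + Pb) = Pb *m pi + Pq.
    rewrite (_ : mxsub s s (_ + _) = mxsub s s (Pq *m pi) + mxsub s s Pb).
      by rewrite smul spi sPq sPb.
    by apply/matrixP => i j; rewrite !mxE.
  have e2 : (Pq *m pi + Pb) *m (Pb *m pi + Pq) = pi.
    have a1 : Pq *m pi *m (Pb *m pi) = 0.
      by rewrite mulmxA -(mulmxA Pq pi Pb) piPb (mulmxA Pq Pb) PqPb !mul0mx.
    have a2 : Pq *m pi *m Pq = Pq *m pi.
      by rewrite -(mulmxA Pq pi Pq) piPq mulmxA PqPq.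
    rewrite mulmxDl !mulmxDr a1 a2 PbPq (mulmxA Pb) PbPb add0r addr0.
    by rewrite -mulmxDl Pqb mul1mx.
  have bs : bijective s by exists s.
  rewrite expr2 -{2}(det_mxsub_bij _ bs) e1 -det_mulmx e2 -det_mulmx pip.
  exact: det1.
rewrite detK KE det_mulmx exprMn d1 mulr1.
exact: d2.
Qed.

End BorderForm.

(** * The real matrices of Hermitian and symmetric complex matrices *)

Section Border.
Variables (R : realType) (n : nat).
Local Notation H := (quat R).
Local Notation C := (R[i]).
Local Notation J := ((quatJ R)%:M).

Definition col4 (i : 'I_(n * 4)) : 'I_4 := (mxvec_inv i).2.

(** Right multiplication by the imaginary unit j permutes the coordinates in this
   way, up to sign; it exchanges the two complex halves of a quaternion. *)
Definition swap_halves (i : 'I_(n * 4)) : 'I_(n * 4) :=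
  mxvec_index (mxvec_inv i).1 (inord ((col4 i + 2) %% 4)).

(** The projections on the halves q and b of a column q + b j, with q and b
   complex. *)
Definition proj_q : 'M[R]_(n * 4) := diag_mx (\row_i (col4 i < 2)%N%:R).
Definition proj_b : 'M[R]_(n * 4) := diag_mx (\row_i (2 <= col4 i)%N%:R).

Lemma sum4E (F : 'I_4 -> R) : \sum_(l < 4) F l =
  F (inord 0) + F (inord 1) + F (inord 2) + F (inord 3).
Proof.
rewrite !big_ord_recl big_ord0 addr0 !addrA.
by congr (F _ + F _ + F _ + F _); apply: val_inj; rewrite /= inordK.
Qed.

Lemma col4E k l : col4 (mxvec_index k l) = l.
Proof. by rewrite /col4 mxvec_indexK. Qed.

Lemma proj_qb : proj_q + proj_b = 1%:M.
Proof.
apply/matrixP => i j; rewrite !mxE -mulrnDl (ltnNge (col4 i) 2); case: (2 <= col4 i)%N.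
  by rewrite add0r.
by rewrite addr0.
Qed.

Lemma diag_mxM (N : nat) (a b : 'rV[R]_N) :
  diag_mx a *m diag_mx b = diag_mx (\row_i (a 0 i * b 0 i)).
Proof.
by rewrite mul_mx_diag; apply/matrixP => i j; rewrite !mxE; case: eqP => [->|];
  rewrite ?mulr1n ?mulr0n ?mul0r.
Qed.

Lemma proj_qq : proj_q *m proj_q = proj_q.
Proof.
rewrite diag_mxM; congr diag_mx; apply/rowP => i; rewrite !mxE.
by case: (_ < _)%N; rewrite ?mulr1 ?mulr0.
Qed.

Lemma proj_bb : proj_b *m proj_b = proj_b.
Proof.
rewrite diag_mxM; congr diag_mx; apply/rowP => i; rewrite !mxE.
by case: (_ <= _)%N; rewrite ?mulr1 ?mulr0.
Qed.

Lemma proj_q_b : proj_q *m proj_b = 0.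
Proof.
rewrite diag_mxM (_ : \row_i _ = 0) ?raddf0//; apply/rowP => i; rewrite !mxE.
by rewrite (ltnNge (col4 i) 2); case: (2 <= _)%N; rewrite /= ?mulr0 ?mul0r.
Qed.

Lemma proj_b_q : proj_b *m proj_q = 0.
Proof.
rewrite diag_mxM (_ : \row_i _ = 0) ?raddf0//; apply/rowP => i; rewrite !mxE.
by rewrite (ltnNge (col4 i) 2); case: (2 <= _)%N; rewrite /= ?mulr0 ?mul0r.
Qed.

Lemma swap_halvesK : involutive swap_halves.
Proof.
move=> i; case/mxvec_indexP: i => k l; rewrite /swap_halves /col4 !mxvec_indexK /=.
congr mxvec_index; apply: val_inj => /=.
by case: l => -[|[|[|[|]]]] //= _; rewrite !inordK// modnn.
Qed.

Lemma swap_halves_q : mxsub swap_halves swap_halves proj_q = proj_b.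
Proof.
apply/matrixP => i j; rewrite !mxE (inj_eq (inv_inj swap_halvesK)).
congr (_%:R *+ _); case/mxvec_indexP: i => k l.
rewrite /swap_halves !col4E.
by case: l => -[|[|[|[|]]]] //= _; rewrite !inordK.
Qed.

Lemma swap_halves_b : mxsub swap_halves swap_halves proj_b = proj_q.
Proof.
apply/matrixP => i j; rewrite !mxE (inj_eq (inv_inj swap_halvesK)).
congr (_%:R *+ _); case/mxvec_indexP: i => k l.
rewrite /swap_halves !col4E.
by case: l => -[|[|[|[|]]]] //= _; rewrite !inordK.
Qed.

Lemma quatCE (z : C) : quatC z = Quat (complex.Re z) (complex.Im z) 0 0.
Proof. by []. Qed.

Lemma mxJE (A : 'M[H]_n) k l : (A *m J) k l = A k l * quatJ R.
Proof.
rewrite mxE (bigD1 l) //= big1 ?addr0; last first.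
  by move=> j jl; rewrite mxE (negbTE jl) mulr0n mulr0.
by rewrite mxE eqxx mulr1n.
Qed.

Section Hermitian.
Variable P : 'M[C]_n.
Hypothesis PH : P = (map_mx conjc P)^T.
Local Notation p := (rmx (cmx_quat P)).

Lemma herm_Re k l : complex.Re (P k l) = complex.Re (P l k).
Proof. by rewrite {1}PH !mxE; case: (P l k). Qed.

Lemma herm_Im k l : complex.Im (P k l) = - complex.Im (P l k).
Proof. by rewrite {1}PH !mxE; case: (P l k). Qed.

Lemma rmx_hermE k l k' l' : p (mxvec_index k l) (mxvec_index k' l') =
  qcoord (quatC (P k' k) * qbasis R l) l'.
Proof. by rewrite rmxE mxE. Qed.

Lemma rmx_herm_tr : p^T = p.
Proof.
apply/matrixP => i j; case/mxvec_indexP: i => k l; case/mxvec_indexP: j => k' l'.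
rewrite mxE !rmx_hermE !qmulE !quatCE /qcoord /qbasis /= (herm_Re k) (herm_Im k).
case: l => -[|[|[|[|]]]] //= _; case: l' => -[|[|[|[|]]]] //= _; ring.
Qed.

Lemma rmx_herm_proj_q : p *m proj_q = proj_q *m p.
Proof.
rewrite mul_mx_diag mul_diag_mx; apply/matrixP => i j.
case/mxvec_indexP: i => k l; case/mxvec_indexP: j => k' l'.
rewrite !mxE !col4E !rmx_hermE !qmulE !quatCE /qcoord /qbasis /=.
case: l => -[|[|[|[|]]]] //= _; case: l' => -[|[|[|[|]]]] //= _; ring.
Qed.

Lemma rmx_herm_proj_b : p *m proj_b = proj_b *m p.
Proof.
rewrite mul_mx_diag mul_diag_mx; apply/matrixP => i j.
case/mxvec_indexP: i => k l; case/mxvec_indexP: j => k' l'.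
rewrite !mxE !col4E !rmx_hermE !qmulE !quatCE /qcoord /qbasis /=.
case: l => -[|[|[|[|]]]] //= _; case: l' => -[|[|[|[|]]]] //= _; ring.
Qed.

Lemma rmx_herm_swap : mxsub swap_halves swap_halves p = p.
Proof.
apply/matrixP => i j; rewrite [LHS]mxE.
case/mxvec_indexP: i => k l; case/mxvec_indexP: j => k' l'.
rewrite /swap_halves !col4E !mxvec_indexK /= !rmx_hermE !qmulE !quatCE.
rewrite /qcoord /qbasis /=.
case: l => -[|[|[|[|]]]] //= _; case: l' => -[|[|[|[|]]]] //= _;
  rewrite !inordK //=; ring.
Qed.

Definition hform (v : 'cV[C]_n) : C := ((map_mx conjc v)^T *m P *m v) 0 0.

Definition lo_half (v : 'M[R]_(n, 4)) : 'cV[C]_n :=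
  \col_k (v k (inord 0) +i* v k (inord 1)).
Definition hi_half (v : 'M[R]_(n, 4)) : 'cV[C]_n :=
  \col_k (v k (inord 2) +i* v k (inord 3)).

Lemma ReD (z w : C) : complex.Re (z + w) = complex.Re z + complex.Re w.
Proof. by case: z w => ? ? []. Qed.

Lemma Re_sum (I : finType) (F : I -> C) :
  complex.Re (\sum_i F i) = \sum_i complex.Re (F i).
Proof. by elim/big_rec2: _ => // i x y _ <-; rewrite ReD. Qed.

Lemma hformE v : hform v = \sum_j \sum_k (conjc (v k 0) * P k j * v j 0).
Proof.
rewrite /hform mxE; apply: eq_bigr => j _; rewrite mxE mulr_suml.
by apply: eq_bigr => k _; rewrite !mxE.
Qed.

Lemma mxvec_dot (a b : 'M[R]_(n, 4)) :
  (mxvec a *m (mxvec b)^T) 0 0 = \sum_k \sum_(l < 4) a k l * b k l.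
Proof.
rewrite mxE; apply: big_mxvec => k l.
by rewrite [X in _ * X]mxE !mxvecE.
Qed.

(** Left multiplication by a complex matrix acts on q and b separately. *)
Lemma quad_rmx_herm (v : 'M[R]_(n, 4)) :
  quad p (mxvec v) = complex.Re (hform (lo_half v)) + complex.Re (hform (hi_half v)).
Proof.
rewrite /quad rmx_vec mxvec_dot !hformE !Re_sum -big_split /= .
rewrite [RHS](eq_bigr (fun j => \sum_k (complex.Re (conjc (lo_half v k 0) * P k j * lo_half v j 0)
  + complex.Re (conjc (hi_half v k 0) * P k j * hi_half v j 0)))); last first.
  by move=> j _; rewrite !Re_sum -big_split.
rewrite [RHS]exchange_big /=; apply: eq_bigr => k _.
transitivity (\sum_(l < 4) \sum_j
    qcoord (cmx_quat P k j * quat_col v j 0) l * v k l).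
  by apply: eq_bigr => l _; rewrite qopE mulr_suml.
rewrite exchange_big /=; apply: eq_bigr => j _.
rewrite sum4E !inordK//= !mxE !qmulE quatCE /qcoord /=.
by case: (P k j) => a b /=; ring.
Qed.

End Hermitian.

Lemma posdef_rmx (P : 'M[C]_n) : posdefmx P -> posquad (rmx (cmx_quat P)).
Proof.
move=> [PH P0]; split; first exact: rmx_herm_tr.
move=> v; rewrite -(vec_mxK v); move: (vec_mx v) => V V0.
have h0 (w : 'cV[C]_n) : 0 <= complex.Re (hform P w).
  have [->|w0] := eqVneq w 0; first by rewrite /hform mulmx0 mxE.
  by have := P0 w w0; rewrite ltcE => /andP[_ /ltW].
have h1 (w : 'cV[C]_n) : w != 0 -> 0 < complex.Re (hform P w).
  by move=> w0; have := P0 w w0; rewrite ltcE => /andP[_].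
rewrite quad_rmx_herm; have [lo|lo] := eqVneq (lo_half V) 0; last first.
  by rewrite ltr_wpDr ?h1.
have [hi|hi] := eqVneq (hi_half V) 0; last by rewrite ltr_wpDl ?h1.
exfalso; move/negP: V0; apply; apply/eqP; rewrite -(raddf0 (@mxvec R n 4)).
congr mxvec; apply/matrixP => k l; rewrite [RHS]mxE -(inord_val l).
have := congr1 (fun w : 'cV_n => w k 0) lo; rewrite !mxE => -[e0 e1].
have := congr1 (fun w : 'cV_n => w k 0) hi; rewrite !mxE => -[e2 e3].
by case: l => -[|[|[|[|]]]] //=.
Qed.

Section Symmetric.
Variable A : 'M[C]_n.
Hypothesis AS : A^T = A.
Local Notation y := (rmx (cmx_quat A *m J)).

Lemma rmx_symE k l k' l' : y (mxvec_index k l) (mxvec_index k' l') =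
  qcoord (quatC (A k' k) * quatJ R * qbasis R l) l'.
Proof. by rewrite rmxE mxJE mxE. Qed.

Lemma rmx_sym_tr : y^T = - y.
Proof.
apply/matrixP => i j; case/mxvec_indexP: i => k l; case/mxvec_indexP: j => k' l'.
rewrite [LHS]mxE [RHS]mxE !rmx_symE -{1}AS [A^T _ _]mxE.
rewrite !qmulE !quatCE /qcoord /qbasis /=.
case: l => -[|[|[|[|]]]] //= _; case: l' => -[|[|[|[|]]]] //= _; ring.
Qed.

Lemma rmx_sym_proj_q : y *m proj_q = proj_b *m y.
Proof.
rewrite mul_mx_diag mul_diag_mx; apply/matrixP => i j.
case/mxvec_indexP: i => k l; case/mxvec_indexP: j => k' l'.
rewrite !mxE !col4E !rmx_symE !qmulE !quatCE /qcoord /qbasis /=.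
case: l => -[|[|[|[|]]]] //= _; case: l' => -[|[|[|[|]]]] //= _; ring.
Qed.

Lemma rmx_sym_proj_b : y *m proj_b = proj_q *m y.
Proof.
rewrite mul_mx_diag mul_diag_mx; apply/matrixP => i j.
case/mxvec_indexP: i => k l; case/mxvec_indexP: j => k' l'.
rewrite !mxE !col4E !rmx_symE !qmulE !quatCE /qcoord /qbasis /=.
case: l => -[|[|[|[|]]]] //= _; case: l' => -[|[|[|[|]]]] //= _; ring.
Qed.

End Symmetric.
End Border.

(** * Schur complements of bordered matrices *)

Section Dagger.
Variables (R : realType) (n : nat).
Local Notation H := (quat R).

(** The anti-involution x |-> i^-1 x^* i; it fixes the quaternions without
    i-component, and 1 + T + S j is self-adjoint for it. *)
Definition qdag (x : H) : H := Quat (q1 x) (- qi x) (qj x) (qk x).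

Lemma qdagM x y : qdag (x * y) = qdag y * qdag x.
Proof. by rewrite !qmulE /qdag /=; congr Quat; ring. Qed.

Lemma qdag_sum (I : finType) (F : I -> H) : qdag (\sum_i F i) = \sum_i qdag (F i).
Proof.
elim/big_rec2: _ => [|i x y _ <-]; first by rewrite /qdag /= oppr0.
by rewrite /qdag !qaddE /= opprD.
Qed.

Variable X : 'M[H]_n.
Hypothesis Xdag : forall k l, qdag (X k l) = X l k.

(** The row below X in a matrix that is self-adjoint for qdag. *)
Definition border_row (V : 'M[R]_(n, 4)) : 'rV[H]_n :=
  \row_k qdag (quat_col V k 0).

Definition schur_term (V : 'M[R]_(n, 4)) (w : 'cV[H]_n) : H :=
  (border_row V *m w) 0 0.

Lemma schur_termE V w :
  schur_term V w = \sum_k qdag (quat_col V k 0) * w k 0.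
Proof. by rewrite /schur_term mxE; apply: eq_bigr => k _; rewrite mxE. Qed.

(** The Schur term w^dag X w is self-adjoint for qdag. *)
Lemma schur_term_qi V w : X *m w = quat_col V -> qi (schur_term V w) = 0.
Proof.
move=> Xw; have E : schur_term V w =
    \sum_k \sum_l qdag (w l 0) * (X l k * w k 0).
  rewrite schur_termE -Xw; apply: eq_bigr => k _.
  rewrite mxE qdag_sum mulr_suml; apply: eq_bigr => l _.
  by rewrite qdagM Xdag mulrA.
have : qdag (schur_term V w) = schur_term V w.
  rewrite {1}E qdag_sum E exchange_big /=; apply: eq_bigr => l _.
  rewrite qdag_sum; apply: eq_bigr => k _.
  rewrite !qdagM Xdag mulrA; congr (_ * _ * _).
  by rewrite /qdag /=; case: (w _ _) => a b c d /=; rewrite opprK.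
move=> /(congr1 (@qi R)) /= /eqP; rewrite eq_sym -subr_eq0 opprK -mulr2n.
by rewrite mulrn_eq0 => /eqP.
Qed.

Lemma schur_term_q1 V w : q1 (schur_term V w) =
  (mxvec V *m (proj_q R n - proj_b R n) *m (mxvec (real_coords w))^T) 0 0.
Proof.
pose sg (l : 'I_4) : R := (l < 2)%N%:R - (2 <= l)%N%:R.
have -> : mxvec V *m (proj_q R n - proj_b R n) = mxvec (\matrix_(k, l) (V k l * sg l)).
  rewrite mulmxBr !mul_mx_diag; apply/rowP => i; case/mxvec_indexP: i => k l.
  by rewrite [RHS]mxvecE [RHS]mxE !(mxE, mxvecE) !col4E /sg; ring.
rewrite mxvec_dot schur_termE.
have -> (F : 'I_n -> H) : q1 (\sum_i F i) = \sum_i q1 (F i).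
  by elim/big_rec2: _ => // i x y _ <-; rewrite qaddE.
apply: eq_bigr => k _; rewrite sum4E /sg !mxE !inordK//=.
by rewrite /qdag /=; ring.
Qed.

Lemma rmx_solve V : rmx X \in unitmx ->
  exists2 w, X *m w = quat_col V &
    mxvec (real_coords w) = mxvec V *m invmx (rmx X).
Proof.
move=> U; exists (quat_col (vec_mx (mxvec V *m invmx (rmx X)))); last first.
  by rewrite quat_colK vec_mxK.
move: (vec_mx _) (vec_mxK (mxvec V *m invmx (rmx X))) => W WE.
have : qop X W = V.
  by apply: (can_inj mxvecK); rewrite -rmx_vec WE mulmxKV.
rewrite qop.unlock => <-; by rewrite real_coordsK.
Qed.

Lemma det_border V w d : X *m w = quat_col V ->
  \det (rmx (block_mx X (quat_col V) (border_row V) (const_mx d))) =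
  \det (rmx X) * qnorm (d - schur_term V w) ^+ 2.
Proof.
move=> Xw; rewrite (det_rmx_block _ _ Xw); congr (_ * qnorm _ ^+ 2).
by rewrite mxE [X in _ + X]mxE mxE.
Qed.

End Dagger.

(** * Positive definite block matrices *)

Section PosDef.
Variable R : realType.
Local Notation C := (R[i]).

Definition ct m n (M : 'M[C]_(m, n)) : 'M[C]_(n, m) := (map_mx conjc M)^T.

Lemma ctM m n p (M : 'M[C]_(m, n)) (N : 'M[C]_(n, p)) :
  ct (M *m N) = ct N *m ct M.
Proof. by rewrite /ct map_mxM trmx_mul. Qed.

Lemma ctD m n (M N : 'M[C]_(m, n)) : ct (M + N) = ct M + ct N.
Proof. by rewrite /ct map_mxD raddfD. Qed.

Lemma ctK m n (M : 'M[C]_(m, n)) : ct (ct M) = M.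
Proof. by apply/matrixP => i j; rewrite !mxE conjcK. Qed.

Lemma posdef_reindex a b (f : 'I_a -> 'I_b) (T : 'M[C]_b) : bijective f ->
  posdefmx (mxsub f f T) <-> posdefmx T.
Proof.
move=> [g fK gK]; have bf : bijective f by exists g.
have hE (v : 'cV[C]_b) : hform (mxsub f f T) (rowsub f v) = hform T v.
  rewrite !hformE [RHS](reindex f) /=; last exact: onW_bij.
  apply: eq_bigr => j _; rewrite [RHS](reindex f) /=; last exact: onW_bij.
  by apply: eq_bigr => k _; rewrite !mxE.
split=> -[TH T0]; split.
- apply/matrixP => i j; have := TH => /matrixP /(_ (g i) (g j)).
  by rewrite !mxE !gK.
- move=> v v0; rewrite -[X in 0 < X]/(hform T v) -hE; apply: T0.
  apply: contra v0 => /eqP v0; apply/eqP/colP => i.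
  by have := v0 => /matrixP /(_ (g i) 0); rewrite !mxE gK.
- by apply/matrixP => i j; have := TH => /matrixP /(_ (f i) (f j)); rewrite !mxE.
- move=> v v0; have -> : v = rowsub f (rowsub g v).
    by apply/matrixP => i j; rewrite !mxE fK.
  rewrite -[X in 0 < X]/(hform _ _) hE; apply: T0.
  apply: contra v0 => /eqP v0; apply/eqP/colP => i.
  by have := v0 => /matrixP /(_ (f i) 0); rewrite !mxE fK.
Qed.

Lemma posdef_unit n (P : 'M[C]_n) : posdefmx P -> P \in unitmx.
Proof.
move=> [PH P0]; rewrite -unitmx_tr -row_free_unit; apply/inj_row_free => v vP.
apply/eqP; apply: contraT => v0; have := P0 v^T.
rewrite trmx_eq0 => /(_ v0).
by rewrite -mulmxA -[P]trmxK -trmx_mul vP trmx0 mulmx0 mxE ltxx.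
Qed.

Section Block.
Variables (n : nat) (P : 'M[C]_n) (q : 'cV[C]_n) (r : R).
Local Notation T := (block_mx P q (ct q) (const_mx r%:C) : 'M[C]_(n + 1)).

Hypothesis PP : posdefmx P.
Variable w : 'cV[C]_n.
Hypothesis Pw : P *m w = q.

Let PH : ct P = P. Proof. by case: PP => /esym. Qed.

Let delta : R := complex.Re ((ct q *m w) 0 0).

Let qw : ct q *m w = const_mx delta%:C.
Proof.
have E : ct q *m w = ct (ct q *m w) by rewrite ctM ctK -Pw ctM PH mulmxA.
apply/matrixP => i j; rewrite !ord1 [RHS]mxE /delta.
have := E => /matrixP /(_ 0 0); rewrite [RHS]mxE [RHS]mxE.
case: ((ct q *m w) 0 0) => a b /= [/eqP].
rewrite -subr_eq0 opprK -mulr2n mulrn_eq0 /= => /eqP ->.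
by [].
Qed.

(** Adding to the last column the combination of the others given by - w clears
    the upper right block. *)
Lemma det_posdef_block : \det T = \det P * (r - delta)%:C.
Proof.
have E : T *m block_mx 1%:M (- w) 0 1%:M = block_mx P 0 (ct q) (const_mx (r - delta)%:C).
  rewrite mulmx_block !mulmx1 !mulmx0 !addr0 !mulmxN Pw addNr qw; congr block_mx.
  by apply/matrixP => i j; rewrite !mxE -rmorphN -rmorphD addrC.
have := congr1 determinant E.
rewrite det_mulmx det_ublock !det1 !mulr1 det_lblock => ->.
by rewrite det_mx11 mxE.
Qed.

(** The form splits as P[z + t w] + (r - delta) |t|^2. *)
Lemma posdef_blockP : posdefmx T <-> delta < r.
Proof.
have hE (z : 'cV[C]_n) (t : C) : hform T (col_mx z (const_mx t)) =
    hform P (z + t *: w) + conjc t * t * (r - delta)%:C.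
  rewrite /hform -[(map_mx _ (col_mx _ _))^T]/(ct _) -[(map_mx _ (z + _))^T]/(ct _).
  have -> : ct (col_mx z (const_mx t : 'M[C]_1)) = row_mx (ct z) (const_mx (conjc t)).
    by rewrite /ct matrix.map_col_mx tr_col_mx map_const_mx trmx_const.
  rewrite mul_row_block mul_row_col ctD !mulmxDl !mulmxDr.
  have -> : ct (t *: w) = conjc t *: ct w.
    by apply/matrixP => i j; rewrite !mxE rmorphM.
  have zw : ct z *m P *m (t *: w) = t *: (ct z *m q) by rewrite -scalemxAr -mulmxA Pw.
  have wz : conjc t *: ct w *m P *m z = conjc t *: (ct q *m z).
    by rewrite -!scalemxAl -{1}PH -ctM Pw.
  have ww : conjc t *: ct w *m P *m (t *: w) = (conjc t * t) *: (ct q *m w).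
    by rewrite -!scalemxAl -{1}PH -ctM Pw -scalemxAr scalerA.
  have c1 (a : C) : const_mx a = a%:M :> 'M[C]_1.
    by apply/matrixP => i j; rewrite !ord1 !mxE.
  rewrite zw wz ww qw !c1 !mul_scalar_mx !mul_mx_scalar -!scalemxAl.
  move: (ct z *m P *m z) (ct q *m z) (ct z *m q) => a b d.
  by rewrite !mxE eqxx !mulr1n rmorphB /=; ring.
have TH : T = (map_mx conjc T)^T.
  rewrite matrix.map_block_mx tr_block_mx; congr block_mx.
  - by case: PP.
  - by rewrite -[LHS]ctK.
  - by rewrite map_const_mx trmx_const conjc_real.
split.
  move=> [_ /(_ (col_mx (- w) (const_mx 1)))]; rewrite -[X in 0 < X]/(hform _ _) hE.
  rewrite scale1r addNr rmorph1 !mul1r {1}/hform mulmx0 mxE add0r.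
  rewrite ltcR subr_gt0; apply; apply/eqP => /(congr1 dsubmx).
  rewrite col_mxKd raddf0 => /matrixP /(_ 0 0); rewrite !mxE => /eqP.
  by rewrite oner_eq0.
move=> dr; split=> // v v0; rewrite -[v]vsubmxK.
have -> : dsubmx v = const_mx (dsubmx v 0 0).
  by apply/matrixP => i j; rewrite !ord1 [RHS]mxE.
rewrite -[X in 0 < X]/(hform _ _) hE; set t := dsubmx v 0 0; set z := usubmx v.
have d0 : 0 < (r - delta)%:C by rewrite ltcR subr_gt0.
have tt : 0 <= conjc t * t by rewrite mulrC -sqr_normc exprn_ge0.
have [t0|t0] := eqVneq t 0.
  rewrite t0 scale0r addr0 mulr0 mul0r addr0; apply: PP.2.
  apply: contra v0 => /eqP z0; apply/eqP; rewrite -[v]vsubmxK -/z z0.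
  have -> : dsubmx v = 0 by apply/matrixP => i j; rewrite !ord1 -/t t0 mxE.
  by rewrite col_mx0.
apply: ltr_wpDl.
  have [->|z0] := eqVneq (z + t *: w) 0; first by rewrite /hform mulmx0 mxE.
  exact/ltW/PP.2.
rewrite mulr_gt0// lt_neqAle tt andbT eq_sym mulf_neq0//.
by rewrite conjc_eq0.
Qed.

End Block.
End PosDef.

(** * The last row and column of T and S *)

Section QuaternionicSum.
Variable R : realType.
Local Notation H := (quat R).
Local Notation C := (R[i]).

(** The matrix 1 + T + S j. *)
Definition qmx n (T S : 'M[C]_n) : 'M[H]_n :=
  1%:M + cmx_quat T + cmx_quat S *m (quatJ R)%:M.

Lemma qmxE n (T S : 'M[C]_n) k l : qmx T S k l =
  Quat ((k == l)%:R + complex.Re (T k l)) (complex.Im (T k l))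
       (complex.Re (S k l)) (complex.Im (S k l)).
Proof.
have -> : qmx T S k l =
    (k == l)%:R + quatC (T k l) + (cmx_quat S *m (quatJ R)%:M) k l.
  by rewrite mxE [X in X + _ = _]mxE [X in X + _ + _ = _]mxE [X in _ + X + _ = _]mxE.
rewrite mxJE mxE !qaddE qmulE !quatCE /=.
by case: (k == l); rewrite /=; congr Quat; ring.
Qed.

Lemma qmx_mxsub m n (f : 'I_m -> 'I_n) (T S : 'M[C]_n) : injective f ->
  mxsub f f (qmx T S) = qmx (mxsub f f T) (mxsub f f S).
Proof.
move=> fI; apply/matrixP => k l.
by rewrite [LHS]mxE !qmxE (inj_eq fI) ![mxsub f f _ _ _]mxE.
Qed.

Lemma cmx_quatM m n p (A : 'M[C]_(m, n)) (B : 'M[C]_(n, p)) :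
  cmx_quat (A *m B) = cmx_quat A *m cmx_quat B.
Proof.
have CD (z w : C) : quatC (z + w) = quatC z + quatC w.
  by rewrite /quatC qaddE /=; case: z w => ? ? [? ?] /=; congr Quat; rewrite ?addr0.
have CM (z w : C) : quatC (z * w) = quatC z * quatC w.
  by rewrite /quatC qmulE /=; case: z w => ? ? [? ?] /=; congr Quat; ring.
apply/matrixP => k l; rewrite [LHS]mxE mxE [RHS]mxE.
elim/big_rec2: _ => // i x y _ <-; rewrite CD CM; congr (_ + _).
by rewrite !mxE.
Qed.

End QuaternionicSum.

Section GlueBlocks.
Variables (R : realType) (n : nat).
Local Notation C := (R[i]).
Variables (a : 'M[R]_n) (b : 'M[R]_(n.+1, n)) (V : 'M[R]_(n, 4)) (r : R)
  (c : 'rV[R]_2).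

Lemma hermmx_glueT : mxsub (@last_split n) (@last_split n) (hermmx (glueT a V r)) =
  block_mx (hermmx a) (lo_half V) (ct (lo_half V)) (const_mx r%:C).
Proof.
have nm (k : 'I_n) : (lift ord_max k == ord_max) = false.
  by rewrite eq_sym (negbTE (neq_lift _ _)).
have nm' (k : 'I_n) : (ord_max == lift ord_max k) = false.
  by rewrite (negbTE (neq_lift _ _)).
have lk (k : 'I_n) : lift ord_max k = k :> nat.
  by rewrite /= /bump leqNgt ltn_ord.
apply/matrixP => k l; rewrite [LHS]mxE.
case: (split_ordP k) => k' ->; case: (split_ordP l) => l' ->;
  rewrite ?last_splitl ?last_splitr ?block_mxEul ?block_mxEur ?block_mxEdl ?block_mxEdr.
- by rewrite !mxE !liftK (inj_eq lift_inj) !lk.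
- by rewrite !mxE !liftK !unlift_none nm lk ltn_ord.
- by rewrite !mxE !liftK !unlift_none nm' lk ltnNge ltnW.
- by rewrite !mxE !unlift_none eqxx.
Qed.

Lemma symmx_glueS : mxsub (@last_split n) (@last_split n) (symmx (glueS b V c)) =
  block_mx (symmx b) (hi_half V) (hi_half V)^T (const_mx (c 0 0 +i* c 0 1)).
Proof.
have w1 (k : 'I_n) : widen_ord (leqnSn n.+1) (lift ord_max k) =
    lift ord_max (widen_ord (leqnSn n) k).
  by apply: val_inj; rewrite /= /bump (leqNgt n k) (leqNgt n.+1 k) ltn_ord ltnS ltnW.
have w2 : widen_ord (leqnSn n.+1) ord_max = lift ord_max ord_max.
  by apply: val_inj; rewrite /= /bump ltnn.
have w3 (k : 'I_n) : lift ord0 (lift ord_max k) = lift ord_max (lift ord0 k).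
  by apply: val_inj; rewrite /= /bump /= !add1n ltnS (leqNgt n k) ltn_ord.
have w4 : lift ord0 ord_max = ord_max :> 'I_n.+2 by apply: val_inj.
have w5 (k : 'I_n) : widen_ord (leqnSn n) k = lift ord_max k.
  by apply: val_inj; rewrite /= /bump leqNgt ltn_ord.
have lk (k : 'I_n) : lift ord_max k = k :> nat.
  by rewrite /= /bump leqNgt ltn_ord.
apply/matrixP => k l; rewrite [LHS]mxE.
case: (split_ordP k) => k' ->; case: (split_ordP l) => l' ->;
  rewrite ?last_splitl ?last_splitr ?block_mxEul ?block_mxEur ?block_mxEdl ?block_mxEdr.
- by rewrite !mxE !w1 !w3 !liftK !lk.
- by rewrite !mxE !w1 !w4 !liftK !unlift_none w5 liftK lk ltnW.
- by rewrite !mxE !w1 !w4 !liftK !unlift_none w5 liftK lk leqNgt ltn_ord.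
- by rewrite !mxE w2 w4 !liftK !unlift_none leqnn.
Qed.

End GlueBlocks.

(** * Determinants of the bordered matrices *)

Lemma qdetE (R : realType) n (g : 'M[quat R]_n) : qdet g = (\det (rmx g)) `^ 4^-1.
Proof. by rewrite /qdet rmx.unlock qop.unlock. Qed.

Section BorderDeterminants.
Variables (R : realType) (n : nat).
Local Notation C := (R[i]).
Variables P A : 'M[C]_n.
Hypotheses (PP : posdefmx P) (AT : A^T = A).
Local Notation p := (rmx (cmx_quat P)).
Local Notation y := (rmx (cmx_quat A *m (quatJ R)%:M)).

(** The Schur complements of T and of 1 + T + S j are r - delta and, up to its j-
    and k-components, 1 + r - alpha; gamma_form is the matrix of their
    difference. *)
Definition delta (V : 'M[R]_(n, 4)) : R := quad (proj_q R n *m invmx p) (mxvec V).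
Definition alpha (V : 'M[R]_(n, 4)) : R :=
  quad ((proj_q R n - proj_b R n) *m (invmx (rmx (qmx P A)))^T) (mxvec V).
Definition gamma_form : 'M[R]_(n * 4) := border_form p y (proj_q R n) (proj_b R n).

Definition borderT (V : 'M[R]_(n, 4)) (r : R) : 'M[C]_(n + 1) :=
  block_mx P (lo_half V) (ct (lo_half V)) (const_mx r%:C).
Definition borderS (V : 'M[R]_(n, 4)) (c : 'rV[R]_2) : 'M[C]_(n + 1) :=
  block_mx A (hi_half V) (hi_half V)^T (const_mx (c 0 0 +i* c 0 1)).

Lemma rmx_qmx : rmx (qmx P A) = border_x p y.
Proof. by rewrite /qmx !rmxD rmx1. Qed.

Lemma qmx_dag k l : qdag (qmx P A k l) = qmx P A l k.
Proof.
rewrite !qmxE /qdag /= (herm_Re PP.1 k) (herm_Im PP.1 k) opprK eq_sym.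
by rewrite -{1 2}AT [A^T _ _]mxE.
Qed.

Let pU : p \in unitmx. Proof. by apply: unitmx_quad; case: (posdef_rmx PP). Qed.

Lemma qmx_quad_gt0 v : v != 0 -> 0 < quad (rmx (qmx P A)) v.
Proof.
move=> v0; rewrite rmx_qmx /border_x !quadD (quad_antisym _ (rmx_sym_tr AT)) addr0.
by rewrite ltr_wpDr ?quad1_gt0// (posquad_ge0 _ (posdef_rmx PP)).
Qed.

Lemma det_rmx_qmx_gt0 : 0 < \det (rmx (qmx P A)).
Proof. exact: det_quad_gt0 qmx_quad_gt0. Qed.

Lemma det_rmx_posdef_gt0 : 0 < \det p.
Proof. by apply: det_quad_gt0; case: (posdef_rmx PP). Qed.

Let xU : rmx (qmx P A) \in unitmx.
Proof. exact: unitmx_quad qmx_quad_gt0. Qed.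

Lemma gamma_form_pos : posquad gamma_form.
Proof.
have qT : (proj_q R n)^T = proj_q R n by exact: tr_diag_mx.
have bT : (proj_b R n)^T = proj_b R n by exact: tr_diag_mx.
exact: (border_form_pos (posdef_rmx PP) (rmx_sym_tr AT) (proj_qb R n)
  (proj_qq R n) (proj_bb R n) qT bT (rmx_herm_proj_q P) (rmx_herm_proj_b P)
  (rmx_sym_proj_q A) (rmx_sym_proj_b A)).
Qed.

Lemma det_gamma_form :
  (\det gamma_form * \det (rmx (qmx P A))) ^+ 2 * \det p = 1.
Proof.
rewrite rmx_qmx.
exact: (det_border_form (posdef_rmx PP) (rmx_sym_tr AT) (proj_qb R n)
  (proj_qq R n) (proj_bb R n) (proj_q_b R n) (proj_b_q R n) (rmx_herm_proj_q P)
  (rmx_herm_proj_b P) (rmx_sym_proj_q A) (rmx_sym_proj_b A) (@swap_halvesK n)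
  (rmx_herm_swap P) (swap_halves_q R n) (swap_halves_b R n)).
Qed.

Lemma quad_gamma V : quad gamma_form (mxvec V) = delta V - alpha V.
Proof.
rewrite /gamma_form /border_form -rmx_qmx quadD; congr (_ + _).
by rewrite /alpha /quad mulmxN mulNmx mxE.
Qed.

Let w (V : 'M[R]_(n, 4)) := invmx P *m lo_half V.

Let Pw V : P *m w V = lo_half V.
Proof. by rewrite /w mulmxA mulmxV ?mul1mx// posdef_unit. Qed.

(** The value q^* P^-1 q that the complex Schur complement produces. *)
Lemma deltaE V : delta V = complex.Re ((ct (lo_half V) *m w V) 0 0).
Proof.
pose W := real_coords (cmx_quat (w V)).
have lW : lo_half W = w V.
  rewrite /W; move: (w V) => u; apply/colP => k; rewrite !mxE !inordK//=.
  by case: (u k 0).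
have hW : hi_half W = 0.
  by rewrite /W; move: (w V) => u; apply/colP => k; rewrite !mxE !inordK.
have qV : mxvec V *m proj_q R n = mxvec (real_coords (cmx_quat (lo_half V))).
  rewrite mul_mx_diag; apply/rowP => i; case/mxvec_indexP: i => k l.
  rewrite [RHS]mxvecE [RHS]mxE [LHS]mxE mxvecE [X in _ * X]mxE col4E mxE mxE /=.
  rewrite -[in LHS](inord_val l).
  by case: l => -[|[|[|[|]]]] //= _; rewrite inordK// ?mulr1 ?mulr0.
have Wp : mxvec W *m p = mxvec V *m proj_q R n.
  by rewrite rmx_vec qop.unlock real_coordsK -cmx_quatM Pw qV.
have WE : mxvec W = mxvec V *m proj_q R n *m invmx p by rewrite -Wp mulmxK.
have pT := rmx_herm_tr PP.1.
have -> : delta V = quad p (mxvec W).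
  rewrite [in RHS]/quad {1}WE mulmxKV// WE !trmx_mul trmx_inv pT.
  rewrite (tr_diag_mx _ : (proj_q R n)^T = _) /delta /quad !mulmxA.
  have piq : invmx p *m proj_q R n = proj_q R n *m invmx p.
    rewrite -[LHS](mulmxK pU) -(mulmxA _ _ p) -rmx_herm_proj_q mulmxA.
    by rewrite mulVmx// mul1mx.
  by rewrite -(mulmxA _ (invmx p) (proj_q R n)) piq !mulmxA -(mulmxA _ (proj_q R n) (proj_q R n)) proj_qq.
rewrite quad_rmx_herm lW hW {2}/hform mulmx0 [X in _ + complex.Re X]mxE addr0.
have PH : ct P = P by case: PP => /esym.
by rewrite /hform -[(map_mx _ _)^T]/(ct _) -{1}PH -ctM Pw.
Qed.

Lemma posdef_borderP V r : posdefmx (borderT V r) <-> delta V < r.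
Proof. by rewrite deltaE; exact: (posdef_blockP r PP (Pw V)). Qed.

Lemma det_borderT V r : \det (rmx (cmx_quat (borderT V r))) =
  \det p * (r - delta V) ^+ 4.
Proof.
have E : cmx_quat (borderT V r) = block_mx (cmx_quat P) (cmx_quat (lo_half V))
    (cmx_quat (ct (lo_half V))) (const_mx (quatC r%:C)).
  by rewrite /cmx_quat /borderT matrix.map_block_mx map_const_mx.
rewrite E (@det_rmx_block _ _ _ _ (cmx_quat (w V))); last by rewrite -cmx_quatM Pw.
rewrite -cmx_quatM deltaE.
have : complex.Im ((ct (lo_half V) *m w V) 0 0) = 0.
  have PH : ct P = P by case: PP => /esym.
  have : (ct (lo_half V) *m w V) = ct (ct (lo_half V) *m w V).
    by rewrite ctM ctK -{1}Pw ctM PH -mulmxA Pw.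
  move=> /matrixP /(_ 0 0); rewrite [RHS]mxE [RHS]mxE.
  case: ((_ *m _) 0 0) => a b /= [/eqP].
  by rewrite -subr_eq0 opprK -mulr2n mulrn_eq0 /= => /eqP.
move=> im0; congr (_ * _).
have -> : (const_mx (quatC r%:C) - cmx_quat (ct (lo_half V) *m w V)) 0 0 =
    Quat (r - complex.Re ((ct (lo_half V) *m w V) 0 0)) 0 0 0.
  rewrite mxE [X in X + _]mxE [X in _ + X]mxE [X in - X]mxE /quatC im0.
  by rewrite qaddE /=; congr Quat; rewrite subrr.
by rewrite /qnorm /= expr0n !addr0 -exprM.
Qed.

Lemma qmx_border V r c : qmx (borderT V r) (borderS V c) =
  block_mx (qmx P A) (quat_col V) (border_row V)
    (const_mx (Quat (1 + r) 0 (c 0 0) (c 0 1))).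
Proof.
apply/matrixP => k l; rewrite [LHS]qmxE /borderT /borderS.
case: (split_ordP k) => k' ->; case: (split_ordP l) => l' ->.
- by rewrite !block_mxEul qmxE (inj_eq (@lshift_inj _ _)).
- rewrite !block_mxEur (_ : lshift 1 k' == rshift n l' = false); last first.
    by rewrite eq_lrshift.
  by rewrite !mxE /= add0r.
- rewrite !block_mxEdl (_ : rshift n k' == lshift 1 l' = false); last first.
    by rewrite eq_rlshift.
  by rewrite !mxE /= add0r.
- by rewrite !block_mxEdr !ord1 eqxx !mxE.
Qed.

(** The j- and k-components of the Schur complement only translate the
    integration variable c. *)
Lemma det_borderS V : exists c0 : 'rV[R]_2, forall r c,
  \det (rmx (qmx (borderT V r) (borderS V c))) = \det (rmx (qmx P A)) *
    ((1 + r - alpha V) ^+ 2 + (c 0 0 + c0 0 0) ^+ 2 + (c 0 1 + c0 0 1) ^+ 2) ^+ 2.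
Proof.
have [z Xz zE] := rmx_solve V xU.
exists (\row_i nth 0 [:: - qj (schur_term V z); - qk (schur_term V z)] i) => r c.
rewrite qmx_border (det_border _ Xz); congr (_ * _ ^+ 2).
rewrite qaddE /qnorm /= (schur_term_qi qmx_dag Xz) subrr expr0n addr0 !mxE /=.
congr ((_ - _) ^+ 2 + _ + _).
rewrite schur_term_q1 /alpha /quad zE !trmx_mul.
by rewrite !mulmxA.
Qed.

End BorderDeterminants.

(** * Integration over the border *)

Section BorderIntegral.
Variable R : realType.
Local Notation C := (R[i]).
Local Notation leb := (@lebesgue_measure R).
Local Notation RT := (measurableTypeR R).
Local Notation L N := (lebesgue_tuple R N).

Lemma measurable_quad_rowt N (M : 'M[R]_N) (v0 : 'rV[R]_N) :
  measurable_fun setT (fun z : N.-tuple RT => quad M (rowt z + v0)).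
Proof. exact: measurable_quad. Qed.

Lemma cmeas_section d1 d2 (T1 : measurableType d1) (T2 : measurableType d2)
    (f : T1 * T2 -> C) x : cmeas f -> cmeas (fun y => f (x, y)).
Proof. exact: (cmeas_comp (measurable_pair1 x)). Qed.

Lemma gauss_const (t : R) (N : nat) : 0 < t ->
  ((Num.sqrt (pi / t) ^+ (2 * N))%:C : C) = (pi ^+ N)%:C * cpow t (- N%:R).
Proof.
move=> t0; rewrite exprM sqr_sqrtr ?divr_ge0 ?pi_ge0 ?ltW// expr_div_n rmorphM.
congr (_ * _); rewrite cpowN cpow_nat//.
by rewrite -[RHS]fmorphV.
Qed.

(** Laplace transforms of Gaussians give the integral of (a + M[v]) ^ - s. *)
Lemma hasI_quad N (M : 'M[R]_(2 * N)) v0 (s : C) (a : R) : posquad M -> 0 < a ->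
  N%:R < complex.Re s ->
  hasI (L (2 * N)) (fun v => cpow (a + quad M (rowt v + v0)) (- s))
    ((pi ^+ N / Num.sqrt (\det M))%:C * cGamma (s - N%:R) / cGamma s *
     cpow a (N%:R - s)).
Proof.
move=> M0 a0 sN.
have s0 : 0 < complex.Re s by apply: le_lt_trans sN.
have ReN : complex.Re (N%:R : C) = N%:R by rewrite -(rmorph_nat (real_complex R)).
have H t : 0 < t -> hasI (L (2 * N))
    (fun v => (expR (- (t * (a + quad M (rowt v + v0)))))%:C)
    ((pi ^+ N / Num.sqrt (\det M))%:C * cpow t (- N%:R) * (expR (- (a * t)))%:C).
  move=> t0; have [_ /hasI_real /(hasIZ (expR (- (a * t)))%:C)] := rint_gauss v0 M0 t0.
  rewrite [X in hasI _ _ X -> _](_ : _ = (pi ^+ N / Num.sqrt (\det M))%:C *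
    cpow t (- N%:R) * (expR (- (a * t)))%:C); last first.
    by rewrite !rmorphM /= gauss_const//; ring.
  apply: eq_hasI => v; rewrite -rmorphM -expRD; congr ((expR _)%:C).
  by ring.
have quad0 v : 0 < a + quad M v by rewrite ltr_pwDl// posquad_ge0.
have : hasI (L (2 * N))
    (fun v => cGamma s * (1 * cpow (a + quad M (rowt v + v0)) (- s)))
    ((pi ^+ N / Num.sqrt (\det M))%:C * cGamma (s - N%:R) * cpow a (N%:R - s)).
  apply: (@hasI_laplace R _ _ (L (2 * N)) (fun=> 1) _ _
    (pi ^+ N / Num.sqrt (\det M))%:C) => //.
  - exact: measurable_funD (measurable_cst _) (measurable_quad_rowt _ _).
  - by rewrite ReN.
  - by move=> t t0; apply: eq_hasI (H t t0) => v; rewrite mul1r.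
  - move=> t t0; rewrite ReN rmorph_nat.
    by apply: eq_hasI (H t t0) => v; rewrite Normc.normc1 mul1r.
move=> /(hasIZ (cGamma s)^-1); have G0 := cGamma_neq0 s0.
rewrite (_ : _ * _ = (pi ^+ N / Num.sqrt (\det M))%:C * cGamma (s - N%:R) /
  cGamma s * cpow a (N%:R - s)); last by ring.
by apply: eq_hasI => v; rewrite mulKf// mul1r.
Qed.

(** The part of the integrand that depends on the border, with d and a the values
    of delta and alpha. *)
Definition border_fun (z s : C) (d a : R) (m : 'rV[R]_2) (r : R) (c : 'rV[R]_2) : C :=
  if d < r then cpow (r - d) (z - 1) *
    cpow (Num.sqrt ((1 + r - a) ^+ 2 + (c 0 0 + m 0 0) ^+ 2 + (c 0 1 + m 0 1) ^+ 2))
      (- s)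
  else 0.

Lemma normc_border_fun z s d a m r c :
  (Normc.normc (border_fun z s d a m r c))%:C =
  border_fun (complex.Re z)%:C (complex.Re s)%:C d a m r c.
Proof.
rewrite /border_fun; case: ifP => _; last by rewrite Normc.normc0.
rewrite Normc.normcM (rmorphM (real_complex R)) -[X in X * _]/((Normc.normc _)%:C).
rewrite -[X in _ * X]/((Normc.normc _)%:C) !normc_cpowC.
have ReB1 : complex.Re (z - 1) = complex.Re z - 1 by case: (z).
have ReN : complex.Re (- s) = - complex.Re s by case: (s).
by rewrite ReB1 ReN rmorphB rmorphN rmorph1.
Qed.

Definition border_const_c (s : C) : C := pi%:C / (s / 2 - 1).
Definition border_const_r (z s : C) : C := cGamma z * cGamma (s - 2 - z) / cGamma (s - 2).

(** The centre - m only translates c. *)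
Lemma hasI_border_c z s d a m r : a <= d -> 2 < complex.Re s ->
  hasI (L 2) (fun c => border_fun z s d a m r (rowt c))
    (if 0 < r - d then border_const_c s * (cpow (r - d) (z - 1) * cpow (1 + (d - a) + (r - d)) (2 - s))
     else 0).
Proof.
move=> ad s2; rewrite /border_fun subr_gt0; case: ltP => dr; last exact: hasI0.
have ra : 0 < 1 + r - a by lra.
have p1 : posquad (1%:M : 'M[R]_2) by split; [rewrite trmx1|exact: quad1_gt0].
have Re2 : complex.Re (s / 2) = complex.Re s / 2.
  rewrite -(rmorph_nat (real_complex R)) -fmorphV; case: (s) => x y /=.
  by rewrite mulr0 subr0.
have s1 : 1%:R < complex.Re (s / 2) by rewrite Re2; lra.
have := @hasI_quad 1 1%:M m (s / 2) ((1 + r - a) ^+ 2) p1 _ s1.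
rewrite exprn_gt0// => /(_ isT) /(hasIZ (cpow (r - d) (z - 1))).
have G1 : cGamma (s / 2) = (s / 2 - 1) * cGamma (s / 2 - 1).
  rewrite -cGamma_rec ?subrK//.
  rewrite (_ : complex.Re _ = complex.Re (s / 2) - 1) ?subr_gt0//.
  by case: (s / 2).
have G0 : cGamma (s / 2 - 1) != 0.
  apply: cGamma_neq0; rewrite (_ : complex.Re _ = complex.Re (s / 2) - 1) ?subr_gt0//.
  by case: (s / 2).
have s20 : s - 2 != 0.
  apply/eqP => /eqP; rewrite subr_eq0 => /eqP e; move: s2; rewrite e.
  by rewrite -(rmorph_nat (real_complex R)) ltxx.
rewrite expr1 det1 sqrtr1 divr1 G1 cpow_sqr//.
have -> : 2 * (1%:R - s / 2) = 2 - s by field.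
rewrite (_ : cpow (r - d) (z - 1) * _ = border_const_c s * (cpow (r - d) (z - 1) *
    cpow (1 + (d - a) + (r - d)) (2 - s))); last first.
  rewrite (_ : 1 + (d - a) + (r - d) = 1 + r - a); last by ring.
  by rewrite /border_const_c; field; rewrite G0 s20.
apply: eq_hasI => c; congr (_ * _).
have qE : quad 1%:M (rowt c + m) =
    (rowt c 0 0 + m 0 0) ^+ 2 + (rowt c 0 1 + m 0 1) ^+ 2.
  rewrite /quad mulmx1 mxE big_ord_recl big_ord1 !mxE -!expr2.
  by congr (_ + (tnth _ _ + m _ _) ^+ 2); apply: val_inj.
rewrite cpow_sqrt; last by rewrite -(addrA (_ ^+ 2)) -qE ltr_pwDl ?exprn_gt0// posquad_ge0.
by rewrite -(addrA (_ ^+ 2)) -qE mulNr.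
Qed.

(** After r is translated by d, this is a Beta integral. *)
Lemma hasI_border_r z s d a : a <= d -> 0 < complex.Re z ->
  complex.Re z + 2 < complex.Re s ->
  hasI leb (fun r : RT => if 0 < r - d then
      border_const_c s * (cpow (r - d) (z - 1) * cpow (1 + (d - a) + (r - d)) (2 - s)) else 0)
    (border_const_c s * border_const_r z s * cpow (1 + (d - a)) (- (s - 2 - z))).
Proof.
move=> ad z0 zs.
have Re2 : complex.Re (s - 2) = complex.Re s - 2.
  by rewrite -(rmorph_nat (real_complex R)); case: (s).
have g0 : 0 < 1 + (d - a) by lra.
have zs' : complex.Re z < complex.Re (s - 2) by rewrite Re2; lra.
have G0 : cGamma (s - 2) != 0 by apply: cGamma_neq0; apply: lt_trans zs'.
have := hasI_affine (- d) ltr01 (hasI_beta z0 zs' g0).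
move=> /(hasIZ (border_const_c s / cGamma (s - 2))).
rewrite [X in hasI _ _ X -> _](_ : _ = border_const_c s * border_const_r z s * cpow (1 + (d - a)) (- (s - 2 - z))); last first.
  rewrite rmorph1 divr1 (opprB (s - 2)) /border_const_r.
  by field; rewrite G0.
apply: eq_hasI => r; rewrite mul1r opprB; case: ifP => _; last by rewrite mul0r !mulr0.
by field; rewrite G0.
Qed.

Variable n : nat.
Variables (M : 'M[R]_(n * 4)) (d a : (n * 4).-tuple RT -> R)
  (m : (n * 4).-tuple RT -> 'rV[R]_2).
Hypothesis M0 : posquad M.
Hypothesis da : forall V, d V - a V = quad M (rowt V).

(** The Gamma factors in s - 2 - z cancel, and the constant 2 pi / (s - 2) of the
    integral over c is absorbed by Gamma (s - 1) = (s - 2) Gamma (s - 2). *)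
Lemma hasI_border_V z s : 0 < complex.Re z ->
  complex.Re z + 2 * n%:R + 2 < complex.Re s ->
  hasI (L (n * 4)) (fun V => border_const_c s * border_const_r z s * cpow (1 + (d V - a V)) (- (s - 2 - z)))
    (2 * (pi ^+ (2 * n + 1))%:C * (cGamma z * cGamma (s - z - 2 * n%:R - 2) /
      cGamma (s - 1)) / (Num.sqrt (\det M))%:C).
Proof.
move=> z0 zs.
have n0 : 0 <= n%:R :> R by exact: ler0n.
have ReN k : complex.Re (k%:R : C) = k%:R by rewrite -(rmorph_nat (real_complex R)).
have ReB (x y : C) : complex.Re (x - y) = complex.Re x - complex.Re y.
  by case: x y => ? ? [].
have nE : (n * 4 = 2 * (2 * n))%N by rewrite mulnA mulnC.
have gauss K (M' : 'M[R]_K) : K = (2 * (2 * n))%N -> posquad M' ->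
    hasI (L K) (fun v => cpow (1 + quad M' (rowt v + 0)) (- (s - 2 - z)))
      ((pi ^+ (2 * n) / Num.sqrt (\det M'))%:C * cGamma ((s - 2 - z) - (2 * n)%:R) /
       cGamma (s - 2 - z) * cpow 1 ((2 * n)%:R - (s - 2 - z))).
  move=> eK; move: M'; rewrite eK => M' M'0; apply: hasI_quad => //.
  by rewrite !ReB !ReN natrM; lra.
have := gauss _ _ nE M0.
move=> /(hasIZ (border_const_c s * border_const_r z s)).
have s2 : 0 < complex.Re (s - 2) by rewrite ReB ReN; lra.
have G1 : cGamma (s - 1) = (s - 2) * cGamma (s - 2).
  by rewrite -cGamma_rec//; congr cGamma; ring.
have G2 := cGamma_neq0 s2.
have G3 : cGamma (s - 2 - z) != 0 by apply: cGamma_neq0; rewrite !ReB ReN; lra.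
have s20 : s - 2 != 0.
  by apply/eqP => e; move: s2; rewrite e ltxx.
have D0 : (Num.sqrt (\det M))%:C != 0.
  have [+ _] := rint_gauss 0 M0 ltr01.
  by move=> D; rewrite (fmorph_eq0 (real_complex R)) sqrtr_eq0 -ltNge.
rewrite [X in hasI _ _ X -> _](_ : _ = 2 * (pi ^+ (2 * n + 1))%:C *
  (cGamma z * cGamma (s - z - 2 * n%:R - 2) / cGamma (s - 1)) / (Num.sqrt (\det M))%:C); last first.
  rewrite cpow1x (_ : s - 2 - z - (2 * n)%:R = s - z - 2 * n%:R - 2); last first.
    by rewrite natrM; ring.
  rewrite G1 /border_const_c /border_const_r exprD expr1 !rmorphM fmorphV.
  field.
  by rewrite D0 G2 G3 s20.
by apply: eq_hasI => V; rewrite addr0 da.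
Qed.

Lemma hasI_border (f : border R n -> C) z s : cmeas f ->
  (forall V, f V = border_fun z s (d V.1) (a V.1) (m V.1) V.2.1 (rowt V.2.2)) ->
  0 < complex.Re z -> complex.Re z + 2 * n%:R + 2 < complex.Re s ->
  hasI (mu_border R n) f
    (2 * (pi ^+ (2 * n + 1))%:C * (cGamma z * cGamma (s - z - 2 * n%:R - 2) /
      cGamma (s - 1)) / (Num.sqrt (\det M))%:C).
Proof.
move=> mf fE z0 zs.
have n0 : 0 <= n%:R :> R by exact: ler0n.
have ad V : a V <= d V by rewrite -subr_ge0 da posquad_ge0.
have rc z' s' V (g : RT * 2.-tuple RT -> C) : cmeas g ->
    (forall y, g y = border_fun z' s' (d V) (a V) (m V) y.1 (rowt y.2)) ->
    0 < complex.Re z' -> complex.Re z' + 2 < complex.Re s' ->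
    hasI (sfprod leb (L 2)) g (border_const_c s' * border_const_r z' s' * cpow (1 + (d V - a V)) (- (s' - 2 - z'))).
  move=> mg gE z'0 zs'.
  have s2 : 2 < complex.Re s' by lra.
  apply: (hasI_fubini (g := fun r : RT => if 0 < r - d V then
      border_const_c s' * (cpow (r - d V) (z' - 1) * cpow (1 + (d V - a V) + (r - d V)) (2 - s')) else 0)
    mg _ (@hasI_border_r (complex.Re z')%:C (complex.Re s')%:C _ _ (ad V) z'0 zs')).
  - move=> r; apply: eq_hasI (hasI_border_c _ (m V) r (ad V) _) => [c|]; last exact: s2.
    by rewrite gE normc_border_fun.
  - move=> r; apply: eq_hasI (hasI_border_c _ (m V) r (ad V) _) => [c|]; last exact: s2.
    by rewrite gE.
  - exact: hasI_border_r.
apply: (hasI_fubini mf _ (@hasI_border_V (complex.Re z)%:C (complex.Re s)%:C z0 zs)).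
- move=> V; apply: rc.
  + by apply: cmeas_real; apply: cmeas_normc; exact: cmeas_section.
  + by move=> y; rewrite fE normc_border_fun.
  + exact: z0.
  + by move: zs => /=; lra.
- move=> V; apply: rc.
  + exact: cmeas_section.
  + by move=> y; exact: fE.
  + exact: z0.
  + by lra.
- exact: hasI_border_V.
Qed.

End BorderIntegral.

(** * Leading minors and the integrand *)

(** The value at 0 is 1, so that the first of the ratios of consecutive minors is
    the first minor. Locked, because unification would otherwise unfold
    determinants. *)
HB.lock Definition minor (R : realType) n (G : 'M[quat R]_n) (k : nat) : R :=
  qdet (mxsub (widen_ord (leq_ord (inord k : 'I_n.+1)))
              (widen_ord (leq_ord (inord k : 'I_n.+1))) G).

Section Minors.
Variable R : realType.
Local Notation H := (quat R).
Local Notation C := (R[i]).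

Lemma posdef_ulsubmx m n (T : 'M[C]_(m + n)) : posdefmx T -> posdefmx (ulsubmx T).
Proof.
move=> [TH T0]; split.
  apply/matrixP => i j; have := TH => /matrixP /(_ (lshift n i) (lshift n j)).
  by rewrite !mxE.
move=> v v0; have := T0 (col_mx v 0).
have -> : (map_mx conjc (col_mx v (0 : 'cV[C]_n)))^T = row_mx (ct v) 0.
  by rewrite matrix.map_col_mx tr_col_mx map_mx0 trmx0.
rewrite -{1}(submxK T) mul_row_block mul_row_col !mul0mx !mulmx0 !addr0; apply.
by apply: contra v0 => /eqP /(congr1 usubmx); rewrite col_mxKu raddf0 => ->.
Qed.

Lemma qdet_mxsub_eq a b m n (f : 'I_a -> 'I_m) (g : 'I_b -> 'I_n)
    (G : 'M[H]_m) (G' : 'M[H]_n) : a = b ->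
  (forall (i j : 'I_a) (i' j' : 'I_b), i = i' :> nat -> j = j' :> nat ->
    G (f i) (f j) = G' (g i') (g j')) ->
  qdet (mxsub f f G) = qdet (mxsub g g G').
Proof.
move=> ab; subst b => E; congr qdet; apply/matrixP => i j.
by rewrite [LHS]mxE [RHS]mxE; exact: E.
Qed.

Lemma minor_lublock n (G : 'M[H]_n) (s : 'I_n) :
  qdet (lublock s G) = minor G s.+1.
Proof.
rewrite minor.unlock; apply: qdet_mxsub_eq; first by rewrite inordK// ltnS ltn_ord.
by move=> i j i' j' ii' jj'; congr (G _ _); exact: val_inj.
Qed.

Lemma minor_full n (G : 'M[H]_n) : minor G n = qdet G.
Proof.
rewrite minor.unlock; transitivity (qdet (mxsub id id G)); last first.
  by congr qdet; apply/matrixP => i j; rewrite [LHS]mxE.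
apply: qdet_mxsub_eq; first by rewrite inordK.
by move=> i j i' j' ii' jj'; congr (G _ _); exact: val_inj.
Qed.

Lemma minor0 n (G : 'M[H]_n) : minor G 0 = 1.
Proof.
have q0 (F : 'M[H]_0) : qdet F = 1.
  by rewrite qdetE (_ : \det _ = 1) ?powR1//; exact: det_mx00.
rewrite minor.unlock -(q0 (mxsub (fun=> ord0 : 'I_1) (fun=> ord0 : 'I_1) 0)).
apply: qdet_mxsub_eq; first by rewrite inordK.
by move=> i j [].
Qed.

Lemma minor_lift n (G : 'M[H]_n.+1) k : (k <= n)%N ->
  minor G k = minor (mxsub (lift ord_max) (lift ord_max) G) k.
Proof.
move=> kn; rewrite minor.unlock; apply: qdet_mxsub_eq; first by rewrite !inordK// ltnS ltnW.
move=> i j i' j' ii' jj'; rewrite [RHS]mxE.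
by congr (G _ _); apply: val_inj; rewrite /= /bump leqNgt (leq_trans (ltn_ord _)) ?leq_ord.
Qed.

Lemma mxsub_lift_split (K : Type) n (G : 'M[K]_n.+1) :
  mxsub (lift ord_max) (lift ord_max) G =
  ulsubmx (mxsub (@last_split n) (@last_split n) G).
Proof. by apply/matrixP => i j; rewrite !mxE !last_splitl. Qed.

Lemma qdet_reindex a b (f : 'I_a -> 'I_b) (G : 'M[H]_b) : bijective f ->
  qdet (mxsub f f G) = qdet G.
Proof. by move=> bf; rewrite !qdetE det_rmx_mxsub. Qed.

Lemma cmx_quat_mxsub a b (f : 'I_a -> 'I_b) (T : 'M[C]_b) :
  cmx_quat (mxsub f f T) = mxsub f f (cmx_quat T).
Proof. exact: map_mxsub. Qed.

Lemma qdet_posdef_gt0 n (T : 'M[C]_n) : posdefmx T -> 0 < qdet (cmx_quat T).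
Proof. by move=> T0; rewrite qdetE powR_gt0// det_rmx_posdef_gt0. Qed.

Lemma qdet_qmx_gt0 n (T S : 'M[C]_n) : posdefmx T -> S^T = S ->
  0 < qdet (qmx T S).
Proof. by move=> T0 ST; rewrite qdetE powR_gt0// det_rmx_qmx_gt0. Qed.

Lemma minor_gt0 n (T S : 'M[C]_n) k : posdefmx T -> S^T = S -> (k <= n)%N ->
  0 < minor (cmx_quat T) k /\ 0 < minor (qmx T S) k.
Proof.
elim: n T S k => [|n IHn] T S k T0 ST kn.
  by move: kn; rewrite leqn0 => /eqP ->; rewrite !minor0.
move: kn; rewrite leq_eqVlt => /predU1P[->|kn].
  rewrite (minor_full (cmx_quat T)) (minor_full (qmx T S)).
  by split; [exact: qdet_posdef_gt0|exact: qdet_qmx_gt0].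
have bl := last_split_bij n.
rewrite (minor_lift (cmx_quat T) kn) (minor_lift (qmx T S) kn) qmx_mxsub; last first.
  exact: lift_inj.
rewrite -cmx_quat_mxsub; apply: IHn => //.
  by rewrite mxsub_lift_split; apply: posdef_ulsubmx; apply/posdef_reindex.
by apply/matrixP => i j; rewrite !mxE -{1}ST mxE.
Qed.

End Minors.

Section Weight.
Variable R : realType.
Local Notation C := (R[i]).
Implicit Types (x : nat -> R) (lam : nat -> C).

(** Written with ratios of consecutive minors, so that a new minor contributes one
    new factor and leaves the others unchanged. *)
Definition weight n x lam : C := \prod_(s < n) cpow (x s.+1 / x s) (lam s.+1).

Lemma weightS n x lam :
  weight n.+1 x lam = weight n x lam * cpow (x n.+1 / x n) (lam n.+1).
Proof. by rewrite /weight big_ord_recr. Qed.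

Lemma eq_weight n x x' lam : (forall k, (k <= n)%N -> x k = x' k) ->
  weight n x lam = weight n x' lam.
Proof. by move=> xx'; apply: eq_bigr => s _; rewrite !xx'// ltnW. Qed.

(** Summation by parts; the boundary terms vanish since x 0 = 1 and
    lam n.+1 = 0. *)
Lemma weight_abel n x lam : x 0%N = 1 -> (forall k, (k <= n)%N -> 0 < x k) ->
  lam n.+1 = 0 ->
  \prod_(s < n) cpow (x s.+1) (lam s.+1 - lam s.+2) = weight n x lam.
Proof.
move=> x0 xp lam0.
suff -> : \prod_(s < n) cpow (x s.+1) (lam s.+1 - lam s.+2) =
    weight n x lam * cpow (x n) (- lam n.+1) by rewrite lam0 oppr0 cpow0 mulr1.
elim: n xp {lam0} => [|n IHn] xp.
  by rewrite /weight !big_ord0 x0 cpow1x mulr1.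
rewrite weightS big_ord_recr /= IHn => [|k kn]; last by rewrite xp// ltnW.
have xn := xp n (leqnSn n); have xn1 := xp n.+1 (leqnn _).
rewrite cpowM ?invr_gt0// cpowV// !cpowN cpowB.
by ring.
Qed.

(** The product of the ratios telescopes. *)
Lemma weight_shift n x lam (m : nat) : x 0%N = 1 ->
  (forall k, (k <= n)%N -> 0 < x k) ->
  weight n x (fun k => lam k - m%:R) = weight n x lam / (x n ^+ m)%:C.
Proof.
move=> x0; elim: n => [|n IHn] xp.
  by rewrite /weight !big_ord0 x0 expr1n divr1.
rewrite !weightS IHn => [|k kn]; last by rewrite xp// ltnW.
have xn := xp n (leqnSn n); have xn1 := xp n.+1 (leqnn _).
rewrite cpowB cpow_nat ?divr_gt0// expr_div_n rmorphM fmorphV invfM invrK /=.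
have : (x n ^+ m)%:C != 0 by rewrite (fmorph_eq0 (real_complex R)) expf_neq0// gt_eqF.
have : (x n.+1 ^+ m)%:C != 0 by rewrite (fmorph_eq0 (real_complex R)) expf_neq0// gt_eqF.
by move=> a0 b0; field; rewrite a0 b0.
Qed.

Lemma weight_neq0 n x lam : weight n x lam != 0.
Proof. by apply/prodf_neq0 => s _; exact: cpow_neq0. Qed.

Lemma normc_weight n x lam : (Normc.normc (weight n x lam))%:C =
  weight n x (fun k => (complex.Re (lam k))%:C).
Proof.
rewrite /weight; elim/big_rec2: _ => [|s a b _ E]; first by rewrite Normc.normc1.
rewrite Normc.normcM -normc_cpowC -E.
exact: (rmorphM (real_complex R)).
Qed.

End Weight.

Section Integrand.
Variables (R : realType).
Local Notation C := (R[i]).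
Implicit Types lam sig : nat -> C.

Definition integrand n lam sig (T S : 'M[C]_n) : C :=
  weight n (minor (cmx_quat T)) lam / weight n (minor (qmx T S)) sig *
  ((qdet (cmx_quat T)) ^- (2 * n + 1))%:C.

Lemma normc_integrand n lam sig (T S : 'M[C]_n) :
  (Normc.normc (integrand lam sig T S))%:C =
  integrand (fun k => (complex.Re (lam k))%:C) (fun k => (complex.Re (sig k))%:C) T S.
Proof.
have nM (x y : C) : (Normc.normc (x * y))%:C = (Normc.normc x)%:C * (Normc.normc y)%:C.
  by rewrite Normc.normcM; exact: (rmorphM (real_complex R)).
have nV (x : C) : (Normc.normc x^-1)%:C = ((Normc.normc x)%:C)^-1.
  by rewrite Normc.normcV; exact: (fmorphV (real_complex R)).
have q0 : 0 <= (qdet (cmx_quat T)) ^- (2 * n + 1) by rewrite invr_ge0 exprn_ge0 ?powR_ge0.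
rewrite /integrand; move: (minor (cmx_quat T)) (minor (qmx T S)) (_ ^- _) q0.
move=> x y q q0.
by rewrite (nM (_ / _)) nM nV !normc_weight normc_real.
Qed.

Lemma sqrt_inv_eq (D u v : R) : 0 < D -> 0 < u -> 0 < v ->
  (D * v ^+ 4) ^+ 2 * u ^+ 4 = 1 -> (Num.sqrt D)^-1 = u * v ^+ 2.
Proof.
move=> D0 u0 v0 E; have uv0 : 0 < u * v ^+ 2 by rewrite mulr_gt0 ?exprn_gt0.
have /eqP : (D * (u * v ^+ 2) ^+ 2) ^+ 2 = 1 by rewrite -E; ring.
rewrite sqrp_eq1; last by rewrite mulr_ge0 ?exprn_ge0 ?ltW.
move=> /eqP DE; apply: (mulfI (x := Num.sqrt D)); first by rewrite gt_eqF// sqrtr_gt0.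
rewrite mulfV ?gt_eqF ?sqrtr_gt0// -[X in _ * X](ger0_norm (ltW uv0)) -sqrtr_sqr.
by rewrite -sqrtrM ?ltW// DE sqrtr1.
Qed.

Section Glue.
Variables (n : nat) (a : 'M[R]_n) (b : 'M[R]_(n.+1, n)).
Local Notation P := (hermmx a).
Local Notation A := (symmx b).
Local Notation T' V r := (hermmx (glueT a V r)).
Local Notation S' V c := (symmx (glueS b V c)).

Lemma hermmx_herm : P = ct P.
Proof.
apply/matrixP => k l; rewrite !mxE eq_sym.
case: eqVneq => [->|kl]; first by rewrite /= oppr0.
case: ltngtP => //= [_|/val_inj kl']; first by rewrite opprK.
by rewrite kl' eqxx in kl.
Qed.

Lemma symmx_sym : A^T = A.
Proof. by apply/matrixP => k l; rewrite !mxE; case: ltngtP => // /val_inj ->. Qed.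

Lemma posdef_glue V r :
  posdefmx (T' V r) <-> posdefmx P /\ delta P V < r.
Proof.
rewrite -(posdef_reindex _ (last_split_bij n)) hermmx_glueT; split.
  move=> T0; have P0 : posdefmx P by have := posdef_ulsubmx T0; rewrite block_mxKul.
  by split=> //; apply/(posdef_borderP P0).
by move=> [P0 ?]; apply/(posdef_borderP P0).
Qed.

Let hermmx_lift V r : mxsub (lift ord_max) (lift ord_max) (T' V r) = P.
Proof. by rewrite mxsub_lift_split hermmx_glueT block_mxKul. Qed.

Let symmx_lift V c : mxsub (lift ord_max) (lift ord_max) (S' V c) = A.
Proof. by rewrite mxsub_lift_split symmx_glueS block_mxKul. Qed.

Lemma minor_glueT V r k : (k <= n)%N ->
  minor (cmx_quat (T' V r)) k = minor (cmx_quat P) k.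
Proof.
move=> kn; rewrite (minor_lift (cmx_quat (T' V r)) kn); congr (minor _ k).
by rewrite -(cmx_quat_mxsub (lift ord_max) (T' V r)) hermmx_lift.
Qed.

Lemma minor_glueS V r c k : (k <= n)%N ->
  minor (qmx (T' V r) (S' V c)) k = minor (qmx P A) k.
Proof.
move=> kn; rewrite (minor_lift (qmx (T' V r) (S' V c)) kn); congr (minor _ k).
rewrite (qmx_mxsub (T' V r) (S' V c)); last exact: lift_inj.
by rewrite hermmx_lift symmx_lift.
Qed.

Hypothesis P0 : posdefmx P.

Lemma qdet_glueT V r : delta P V < r ->
  qdet (cmx_quat (T' V r)) = qdet (cmx_quat P) * (r - delta P V).
Proof.
move=> dr; rewrite -(qdet_reindex (cmx_quat (T' V r)) (last_split_bij n)).
rewrite -(cmx_quat_mxsub _ (T' V r)) hermmx_glueT (qdetE (cmx_quat P)).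
rewrite (qdetE (cmx_quat (block_mx _ _ _ _))) (det_borderT P0 V r).
have rd : 0 <= r - delta P V by rewrite subr_ge0 ltW.
rewrite powRM ?exprn_ge0 ?(ltW (det_rmx_posdef_gt0 P0))//; congr (_ * _).
by rewrite -powR_mulrn// -powRrM mulfV ?powRr1// pnatr_eq0.
Qed.

Lemma qdet_glueS V : exists c0 : 'rV[R]_2, forall r c,
  qdet (qmx (T' V r) (S' V c)) = qdet (qmx P A) * Num.sqrt
    ((1 + r - alpha P A V) ^+ 2 + (c 0 0 + c0 0 0) ^+ 2 + (c 0 1 + c0 0 1) ^+ 2).
Proof.
have [c0 E] := det_borderS P0 symmx_sym V; exists c0 => r c.
rewrite -(qdet_reindex (qmx (T' V r) (S' V c)) (last_split_bij n)).
rewrite (qmx_mxsub (T' V r) (S' V c)); last exact: bij_inj (last_split_bij n).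
rewrite hermmx_glueT symmx_glueS (qdetE (qmx P A)).
rewrite (qdetE (qmx (block_mx _ _ _ _) _)) (E r c).
set Q := (_ + _ + _); have Q0 : 0 <= Q by rewrite !addr_ge0 ?sqr_ge0.
rewrite powRM ?exprn_ge0 ?(ltW (det_rmx_qmx_gt0 P0 symmx_sym))//; congr (_ * _).
rewrite -powR_mulrn// -powRrM -powR12_sqrt//; congr (_ `^ _).
by field.
Qed.

(** The inverse square root of the determinant of the border form is what turns
    the exponents of size n + 1 into those of size n. *)
Lemma sqrt_det_gamma : (Num.sqrt (\det (gamma_form P A)))^-1 =
  qdet (cmx_quat P) * qdet (qmx P A) ^+ 2.
Proof.
have gP := qdet_posdef_gt0 P0; have gX := qdet_qmx_gt0 P0 symmx_sym.
have r4 (u : R) : 0 < u -> u = (u `^ 4^-1) ^+ 4.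
  by move=> u0; rewrite -powR_mulrn ?powR_ge0// -powRrM mulVf ?powRr1 ?ltW// pnatr_eq0.
have := det_gamma_form P0 symmx_sym.
rewrite (r4 _ (det_rmx_posdef_gt0 P0)) (r4 _ (det_rmx_qmx_gt0 P0 symmx_sym)).
rewrite -(qdetE (cmx_quat P)) -(qdetE (qmx P A)).
have [D0 _] := rint_gauss 0 (gamma_form_pos P0 symmx_sym) ltr01.
exact: sqrt_inv_eq.
Qed.

End Glue.
End Integrand.

(** * Measurability of the integrand *)

Section Sylvester.
Variable R : realType.
Local Notation C := (R[i]).

Section Bordered.
Variables (n : nat) (T : 'M[C]_n.+1).
Hypothesis TH : T = ct T.
Local Notation T2 := (mxsub (@last_split n) (@last_split n) T).
Local Notation P := (mxsub (lift ord_max) (lift ord_max) T).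
Local Notation q := (ursubmx T2).
Local Notation r := (complex.Re (T ord_max ord_max)).

Let T2E : T2 = block_mx P q (ct q) (const_mx r%:C).
Proof.
rewrite -[LHS]submxK mxsub_lift_split; congr block_mx.
  by apply/matrixP => i j; rewrite !mxE last_splitl last_splitr {1}TH !mxE.
apply/matrixP => i j; rewrite !mxE !last_splitr.
have := TH => /matrixP /(_ ord_max ord_max); rewrite !mxE.
case: (T _ _) => a b /= [/eqP].
by rewrite -subr_eq0 opprK -mulr2n mulrn_eq0 /= => /eqP ->.
Qed.

Let detT2 : \det T = \det T2.
Proof. by rewrite (det_mxsub_bij _ (last_split_bij n)). Qed.

Lemma posdef_minor : posdefmx T -> posdefmx P.
Proof.
move=> T0; rewrite mxsub_lift_split; apply: posdef_ulsubmx.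
exact/(posdef_reindex _ (last_split_bij n)).
Qed.

Lemma posdef_recP (P0 : posdefmx P) : exists2 x : R,
  \det T = \det P * x%:C & (posdefmx T <-> 0 < x).
Proof.
have Pw : P *m (invmx P *m q) = q by rewrite mulmxA mulmxV ?mul1mx ?posdef_unit.
exists (r - complex.Re ((ct q *m (invmx P *m q)) 0 0)).
  by rewrite detT2 {1}T2E (det_posdef_block _ P0 Pw).
rewrite subr_gt0 -(posdef_blockP r P0 Pw) -T2E.
by symmetry; exact: (posdef_reindex _ (last_split_bij n)).
Qed.

End Bordered.

Lemma posdef_det_gt0 n (T : 'M[C]_n) : posdefmx T -> 0 < \det T.
Proof.
elim: n T => [|n IHn] T T0; first by rewrite det_mx00 ltr01.
have P0 := posdef_minor T0; have TH : T = ct T by case: T0.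
have [x -> TP] := posdef_recP TH P0.
by rewrite mulr_gt0 ?IHn// ltcR; apply/TP.
Qed.

(** Sylvester's criterion, one minor at a time. *)
Lemma posdefS n (T : 'M[C]_n.+1) : T = ct T ->
  posdefmx T <->
  posdefmx (mxsub (lift ord_max) (lift ord_max) T) /\ 0 < complex.Re (\det T).
Proof.
move=> TH; split=> [T0|[P0]].
  split; first exact: posdef_minor.
  by have := posdef_det_gt0 T0; rewrite ltcE => /andP[].
have [x dT TP] := posdef_recP TH P0.
rewrite dT => d0; apply/TP; move: d0 (posdef_det_gt0 P0); rewrite ltcE.
case: (\det _) => u v /=; rewrite mulr0 subr0 => ux /andP[_ u0].
by rewrite -(pmulr_rgt0 _ u0).
Qed.

Lemma measurable_posdef d (X : measurableType d) n (T : X -> 'M[C]_n) :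
  (forall x, T x = ct (T x)) -> (forall k l, cmeas (fun x => T x k l)) ->
  measurable [set x | posdefmx (T x)].
Proof.
elim: n T => [|n IHn] T TH mT.
  rewrite (_ : [set _ | _] = setT); first exact: measurableT.
  apply/seteqP; split=> // x _; split; first exact: TH.
  by move=> v /negP[]; apply/eqP/matrixP => -[].
have [mdet _] := cmeas_det mT.
rewrite (_ : [set _ | _] =
  [set x | posdefmx (mxsub (lift ord_max) (lift ord_max) (T x))] `&`
  (fun x => complex.Re (\det (T x))) @^-1` `]0, +oo[); last first.
  apply/seteqP; split=> x /=.
    by move=> /(posdefS (TH x))[? ?]; rewrite in_itv/= andbT.
  by rewrite in_itv /= andbT => /(posdefS (TH x)).
apply: measurableI.
  apply: IHn => [x|k l].
    by apply/matrixP => k l; rewrite [LHS]mxE {1}TH !mxE.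
  by under [fun _ => _]funext do rewrite mxE; exact: mT.
by rewrite -[X in measurable X]setTI; exact: mdet.
Qed.

End Sylvester.

Section MeasurableMinors.
Context d (X : measurableType d) (R : realType).
Local Notation C := (R[i]).

Lemma measurable_det n (A : X -> 'M[R]_n) :
  (forall k l, measurable_fun setT (fun x => A x k l)) ->
  measurable_fun setT (fun x => \det (A x)).
Proof.
move=> mA; have [+ _] : cmeas (fun x => \det (map_mx (real_complex R) (A x))).
  apply: cmeas_det => k l; under [fun _ => _]funext do rewrite mxE.
  exact: cmeas_real.
by under [X in measurable_fun _ X -> _]funext do rewrite det_map_mx.
Qed.

Definition qmeas n (G : X -> 'M[quat R]_n) := forall k l i,
  measurable_fun setT (fun x => qcoord (G x k l) i).

Lemma measurable_qdet n (G : X -> 'M[quat R]_n) : qmeas G ->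
  measurable_fun setT (fun x => qdet (G x)).
Proof.
move=> mG; under [fun _ => _]funext do rewrite qdetE.
apply: (measurableT_comp (measurable_powR _)); apply: measurable_det => i j.
case/mxvec_indexP: i => k l; case/mxvec_indexP: j => k' l'.
under [fun _ => _]funext do rewrite rmxE.
have [m0 m1 m2 m3] := And4 (mG k' k 0%N) (mG k' k 1%N) (mG k' k 2%N) (mG k' k 3%N).
have mZ (c : R) (f : X -> R) : measurable_fun setT f ->
    measurable_fun setT (fun x => f x * c).
  by move=> mf; apply: measurable_funM => //; exact: measurable_cst.
case: l' => -[|[|[|[|]]]] // ?; rewrite /qcoord /=;
  repeat (apply: measurable_funB || apply: measurable_funD || apply: mZ); assumption.
Qed.

Lemma measurable_minor n (G : X -> 'M[quat R]_n) k : qmeas G ->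
  measurable_fun setT (fun x => minor (G x) k).
Proof.
move=> mG; rewrite minor.unlock; apply: measurable_qdet => i j l.
by under [fun _ => _]funext do rewrite mxE; exact: mG.
Qed.

Lemma qmeas_cmx n (T : X -> 'M[C]_n) : (forall k l, cmeas (fun x => T x k l)) ->
  qmeas (fun x => cmx_quat (T x)).
Proof.
move=> mT k l i; have [m1 m2] := mT k l.
under [fun _ => _]funext do rewrite mxE /qcoord /=.
case: i => [|[|[|[|i]]]] //=; do ?exact: measurable_cst.
Qed.

Lemma qmeas_qmx n (T S : X -> 'M[C]_n) : (forall k l, cmeas (fun x => T x k l)) ->
  (forall k l, cmeas (fun x => S x k l)) -> qmeas (fun x => qmx (T x) (S x)).
Proof.
move=> mT mS k l i; have [m1 m2] := mT k l; have [m3 m4] := mS k l.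
under [fun _ => _]funext do rewrite qmxE /qcoord /=.
case: i => [|[|[|[|i]]]] //=.
  by apply: measurable_funD => //; exact: measurable_cst.
by rewrite nth_nil; exact: measurable_cst.
Qed.

(** For nonnegative f the inverse is the power with exponent - 1. *)
Lemma measurable_inv_ge0 (f : X -> R) : (forall x, 0 <= f x) ->
  measurable_fun setT f -> measurable_fun setT (fun x => (f x)^-1).
Proof.
move=> f0 mf; under [fun _ => _]funext do rewrite -powR_inv1//.
exact: (measurableT_comp (measurable_powR _)).
Qed.

Lemma minor_ge0 n (G : 'M[quat R]_n) k : 0 <= minor G k.
Proof. by rewrite minor.unlock powR_ge0. Qed.

Lemma cmeas_weight n (x : X -> nat -> R) lam : (forall p k, 0 <= x p k) ->
  (forall k, measurable_fun setT (fun p => x p k)) ->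
  cmeas (fun p => weight n (x p) lam).
Proof.
move=> x0 mx; apply: cmeas_prod => s; apply: cmeas_cpow.
by apply: measurable_funM => //; exact: measurable_inv_ge0.
Qed.

Lemma weightN n (x : nat -> R) (lam : nat -> C) :
  (weight n x lam)^-1 = weight n x (fun k => - lam k).
Proof. by rewrite /weight -prodfV; apply: eq_bigr => s _; rewrite cpowN. Qed.

Lemma cmeas_integrand n (T S : X -> 'M[C]_n) lam sig :
  (forall k l, cmeas (fun x => T x k l)) ->
  (forall k l, cmeas (fun x => S x k l)) ->
  cmeas (fun x => integrand lam sig (T x) (S x)).
Proof.
move=> mT mS; apply: cmeasM.
  apply: cmeasM.
    apply: cmeas_weight => [p k|k]; first exact: minor_ge0.
    by apply: measurable_minor; exact: qmeas_cmx.
  under [fun _ => _]funext do rewrite weightN.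
  apply: cmeas_weight => [p k|k]; first exact: minor_ge0.
  by apply: measurable_minor; exact: qmeas_qmx.
apply: cmeas_real; apply: measurable_inv_ge0 => [x|].
  by rewrite exprn_ge0// powR_ge0.
by apply: measurable_funX; apply: measurable_qdet; exact: qmeas_cmx.
Qed.

End MeasurableMinors.

Section MeasurableData.
Context d (X : measurableType d) (R : realType) (n : nat).

Lemma cmeas_hermmx (a : X -> 'M[R]_n) :
  (forall k l, measurable_fun setT (fun x => a x k l)) ->
  forall k l, cmeas (fun x => hermmx (a x) k l).
Proof.
move=> ma k l; under [fun _ => _]funext do rewrite mxE.
case: (k == l); first exact: cmeas_real.
case: (k < l)%N; split=> //=.
exact: measurableT_comp.
Qed.

Lemma cmeas_symmx (b : X -> 'M[R]_(n.+1, n)) :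
  (forall k l, measurable_fun setT (fun x => b x k l)) ->
  forall k l, cmeas (fun x => symmx (b x) k l).
Proof.
move=> mb k l; under [fun _ => _]funext do rewrite mxE.
by case: (k <= l)%N; split => /=.
Qed.

End MeasurableData.

(** * The induction on the size *)

Section Induction.
Variable R : realType.
Local Notation C := (R[i]).
Implicit Types lam sig : nat -> C.
Local Notation Th p := (hermmx (tuple_mx p.1)).
Local Notation Sy p := (symmx (tuple_mx p.2)).

Definition cone n : set (small R n) := [set p | posdefmx (Th p)].

Definition density n lam sig (p : small R n) : C :=
  if p \in @cone n then integrand lam sig (Th p) (Sy p) else 0.

Lemma cmeas_Th n k l : cmeas (fun p : small R n => Th p k l).
Proof.
apply: cmeas_hermmx => i j; apply: (@measurable_tuple_mx _ _ _ _ _ (fun p : small R n => p.1)).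
exact: measurable_fst.
Qed.

Lemma cmeas_Sy n k l : cmeas (fun p : small R n => Sy p k l).
Proof.
apply: cmeas_symmx => i j; apply: (@measurable_tuple_mx _ _ _ _ _ (fun p : small R n => p.2)).
exact: measurable_snd.
Qed.

Lemma measurable_cone n : measurable (@cone n).
Proof.
apply: measurable_posdef; first by move=> p; exact: hermmx_herm.
exact: cmeas_Th.
Qed.

Lemma cmeas_density n lam sig : cmeas (@density n lam sig).
Proof.
apply: cmeas_if; first exact: measurable_cone.
by apply: cmeas_integrand; [exact: cmeas_Th|exact: cmeas_Sy].
Qed.

Lemma normc_density n lam sig p : (Normc.normc (@density n lam sig p))%:C =
  density (fun k => (complex.Re (lam k))%:C) (fun k => (complex.Re (sig k))%:C) p.
Proof.
rewrite /density; case: ifP => _; first exact: normc_integrand.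
by rewrite Normc.normc0.
Qed.

Definition factor (z s : C) n : C :=
  2 * (pi ^+ (2 * n + 1))%:C *
  (cGamma z * cGamma (s - z - 2 * n%:R - 2) / cGamma (s - 1)).

Definition value n lam sig : C :=
  \prod_(1 <= k < n.+1)
      (2 * (pi ^+ (2 * k - 1))%:C *
       (cGamma (lam k - (n + k)%:R) * cGamma (sig k - lam k - (n%:R - k%:R)) /
        cGamma (sig k - 2 * (n%:R - k%:R) - 1))).

Lemma valueS n lam sig : value n.+1 lam sig =
  factor (lam n.+1 - (2 * n.+1)%:R) (sig n.+1) n *
  value n (fun k => lam k - 1%:R) (fun k => sig k - 2%:R).
Proof.
have e0 : (2 * n.+1 - 1 = 2 * n + 1)%N by rewrite mulnS -addnBAC// addnC.
have e1 : (n.+1 + n.+1 = 2 * n.+1)%N by rewrite mul2n addnn.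
have e2 : sig n.+1 - lam n.+1 - (n.+1%:R - n.+1%:R) =
    sig n.+1 - (lam n.+1 - (2 * n.+1)%:R) - 2 * n%:R - 2.
  by rewrite natrM -natr1; ring.
have e3 : sig n.+1 - 2 * (n.+1%:R - n.+1%:R) - 1 = sig n.+1 - 1 by ring.
rewrite /value big_nat_recr //= e0 e1 e2 e3 mulrC -/(factor _ _ _).
congr (factor _ _ _ * _); apply: eq_bigr => k _.
have -> : lam k - 1%:R - (n + k)%:R = lam k - (n.+1 + k)%:R.
  by rewrite addSn -[(n + k).+1%:R]natr1; ring.
have -> : sig k - 2%:R - (lam k - 1%:R) - (n%:R - k%:R) =
    sig k - lam k - (n.+1%:R - k%:R) by rewrite -[n.+1%:R]natr1; ring.
have -> // : sig k - 2%:R - 2 * (n%:R - k%:R) - 1 =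
    sig k - 2 * (n.+1%:R - k%:R) - 1.
by rewrite -[n.+1%:R]natr1; ring.
Qed.

Section Step.
Variables (n : nat) (lam sig : nat -> C) (z : small R n).
Local Notation P := (Th z).
Local Notation A := (Sy z).
Local Notation u := (qdet (cmx_quat P)).
Local Notation v := (qdet (qmx P A)).

(** The part of the integrand of size n + 1 that does not depend on the border. *)
Definition coef : C :=
  weight n (minor (cmx_quat P)) lam / weight n (minor (qmx P A)) sig *
  (u ^- (2 * n.+1 + 1))%:C.

Lemma coef_neq0 : posdefmx P -> coef != 0.
Proof.
move=> P0; rewrite /coef mulf_neq0 ?mulf_neq0 ?invr_eq0 ?weight_neq0//.
rewrite (fmorph_eq0 (real_complex R)) invr_eq0 expf_neq0// gt_eqF//.
exact: qdet_posdef_gt0.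
Qed.

(** The factor on the left is contributed by the determinant of gamma_form; it
    turns the coefficient into the integrand of size n for lam - 1 and
    sig - 2. *)
Lemma coef_integrand : posdefmx P -> coef * (u * v ^+ 2)%:C =
  integrand (fun k => lam k - 1%:R) (fun k => sig k - 2%:R) P A.
Proof.
move=> P0; have AT := symmx_sym (tuple_mx z.2).
have u0 : 0 < u := qdet_posdef_gt0 P0.
have v0 : 0 < v := qdet_qmx_gt0 P0 AT.
have xT k : (k <= n)%N -> 0 < minor (cmx_quat P) k.
  by move=> kn; have [] := minor_gt0 P0 AT kn.
have xS k : (k <= n)%N -> 0 < minor (qmx P A) k.
  by move=> kn; have [] := minor_gt0 P0 AT kn.
rewrite /integrand (weight_shift lam 1 (minor0 _) xT) (weight_shift sig 2 (minor0 _) xS).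
rewrite (minor_full (cmx_quat P)) (minor_full (qmx P A)) /coef.
move: (weight_neq0 n (minor (qmx P A)) sig) u0 v0.
move: (weight n (minor (qmx P A)) sig) (weight n (minor (cmx_quat P)) lam) u v.
move=> w w' u' v' w0 u0 v0.
have U0 : u'%:C != 0 by rewrite (fmorph_eq0 (real_complex R)) gt_eqF.
have V0 : v'%:C != 0 by rewrite (fmorph_eq0 (real_complex R)) gt_eqF.
have -> : (2 * n.+1 + 1 = (2 * n + 1) + 2)%N by rewrite mulnS -addnA addnC.
rewrite !rmorphM !fmorphV !rmorphXn /= exprD.
have : u'%:C ^+ (2 * n + 1) != 0 by rewrite expf_neq0.
move: (u'%:C ^+ (2 * n + 1)) => U U1.
by field; rewrite U0 V0 U1 w0.
Qed.

(** The condition delta < r of border_fun is what remains of positive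
    definiteness. *)
Lemma density_glue : posdefmx P -> exists m : (n * 4).-tuple (measurableTypeR R) -> 'rV[R]_2,
  forall b : border R n, density lam sig (glue (z, b)) =
  coef * border_fun (lam n.+1 - (2 * n.+1)%:R) (sig n.+1)
    (delta P (tuple_mx b.1)) (alpha P A (tuple_mx b.1)) (m b.1) b.2.1 (rowt b.2.2).
Proof.
move=> P0; have AT := symmx_sym (tuple_mx z.2).
have [m mE] := choice (fun V => qdet_glueS (tuple_mx z.2) P0 (tuple_mx V)).
exists m => -[V [r c]]; rewrite /density /border_fun /=.
have TE : Th (glue (z, (V, (r, c)))) =
    hermmx (glueT (tuple_mx z.1) (tuple_mx V) r) by rewrite /= mxtupleK.
have SE : Sy (glue (z, (V, (r, c)))) =
    symmx (glueS (tuple_mx z.2) (tuple_mx V) (rowt c)) by rewrite /= mxtupleK.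
have coneE : (glue (z, (V, (r, c))) \in @cone n.+1) = (delta P (tuple_mx V) < r).
  have DE : @cone n.+1 (glue (z, (V, (r, c)))) =
    posdefmx (hermmx (glueT (tuple_mx z.1) (tuple_mx V) r)).
    by rewrite /cone /= mxtupleK.
  apply/idP/idP => [|dr]; rewrite inE DE; first by move=> /posdef_glue[].
  exact/posdef_glue.
rewrite coneE; case: ifPn => dr; last by rewrite mulr0.
rewrite TE SE /integrand !weightS (qdet_glueT P0 dr).
rewrite (eq_weight lam (fun k => minor_glueT (tuple_mx z.1) (tuple_mx V) r (k := k))).
rewrite (eq_weight sig (fun k => minor_glueS (tuple_mx z.1) (tuple_mx z.2)
  (tuple_mx V) r (rowt c) (k := k))).
rewrite !minor_full (minor_glueT _ _ _ (leqnn n)) (minor_glueS _ _ _ _ _ (leqnn n)).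
rewrite !minor_full (qdet_glueT P0 dr) mE.
set Q := Num.sqrt _.
have u0 : 0 < u := qdet_posdef_gt0 P0.
have v0 : 0 < v := qdet_qmx_gt0 P0 AT.
rewrite /coef.
move: (weight_neq0 n (minor (qmx P A)) sig) u0 v0.
move: (weight n (minor (qmx P A)) sig) (weight n (minor (cmx_quat P)) lam) u v.
move=> w w' u' v' w0 u0 v0.
rewrite ![u' * _]mulrC ![v' * _]mulrC !mulfK ?gt_eqF//.
have d0 : 0 < r - delta P (tuple_mx V) by rewrite subr_gt0.
move: (r - _) d0 => d d0.
rewrite (_ : _ - _ - 1 = lam n.+1 - (2 * n.+1 + 1)%:R); last by rewrite natrD; ring.
rewrite cpowB cpow_nat// exprMn (invfM (d ^+ _)) (rmorphM (real_complex R)) !fmorphV cpowN /= (invfM w).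
by ring.
Qed.

End Step.

Definition admissible n lam sig := forall k, (1 <= k <= n)%N ->
  0 < complex.Re (lam k - (n + k)%:R) /\
  0 < complex.Re (sig k - lam k - (n%:R - k%:R)).

(** The integral over the border is the same function of lam and sig for the
    integrand and, with real parts, for its modulus, so that the induction
    hypothesis is used twice. *)
Lemma hasI_density n lam sig : admissible n lam sig ->
  hasI ((lebesgue_tuple R (n * n) \x lebesgue_tuple R (n.+1 * n))%E :
    {measure set _ -> \bar R}) (@density n lam sig) (value n lam sig).
Proof.
have ReB (x y : C) : complex.Re (x - y) = complex.Re x - complex.Re y.
  by case: x y => ? ? [].
have ReN k : complex.Re (k%:R : C) = k%:R by rewrite -(rmorph_nat (real_complex R)).
elim: n lam sig => [|n IHn] lam sig adm.
  have dE (p : small R 0) : density lam sig p = 1.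
    rewrite /density mem_set; last first.
      split; first exact: hermmx_herm.
      by move=> w /negP[]; apply/eqP/matrixP => -[].
    by rewrite /integrand /weight !big_ord0 -minor_full minor0 divr1 mul1r expr1n invr1.
  rewrite /value big_geq//.
  have one0 : hasI (lebesgue_tuple R 0) (fun=> 1) 1.
    apply/(hasI_real _ (fun=> 1) 1); apply: rint_ge0 => //.
    by rewrite /= integral_dirac//= diracT mul1e.
  have one0n : hasI (lebesgue_tuple R 0) (fun=> (Normc.normc (1 : C))%:C) 1.
    by rewrite Normc.normc1.
  have pt := hasI_fubini (m1 := lebesgue_tuple R 0) (m2 := lebesgue_tuple R 0)
    (cmeas_cst _ _) (fun=> one0n) one0 (fun=> one0) one0.
  by apply: eq_hasI pt => p; rewrite dE.
have adm' l s : admissible n.+1 l s ->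
    admissible n (fun k => l k - 1%:R) (fun k => s k - 2%:R).
  move=> h k /andP[k1 kn]; have := h k; rewrite k1 (leq_trans kn)// => /(_ isT).
  rewrite !ReB !ReN !natrD -[n.+1%:R]natr1 => -[? ?]; split; lra.
pose lamR k := (complex.Re (lam k))%:C; pose sigR k := (complex.Re (sig k))%:C.
have admR : admissible n.+1 lamR sigR by move=> k /adm; rewrite !ReB.
have z0 l s : admissible n.+1 l s -> 0 < complex.Re (l n.+1 - (2 * n.+1)%:R).
  by move=> /(_ n.+1); rewrite leqnn => /(_ isT)[+ _]; rewrite addnn mul2n.
have zs l s : admissible n.+1 l s ->
    complex.Re (l n.+1 - (2 * n.+1)%:R) + 2 * n%:R + 2 < complex.Re (s n.+1).
  move=> /(_ n.+1); rewrite leqnn => /(_ isT)[_].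
  by rewrite !ReB !ReN natrM -[n.+1%:R]natr1 => ?; lra.
have step l s (z : small R n) (f : border R n -> C) : cmeas f ->
    admissible n.+1 l s ->
    (forall b, f b = density l s (glue (z, b))) ->
    hasI (mu_border R n) f (factor (l n.+1 - (2 * n.+1)%:R) (s n.+1) n *
      density (fun k => l k - 1%:R) (fun k => s k - 2%:R) z).
  move=> mf h fE; rewrite /density; case: ifPn => [|zD].
    rewrite inE => P0; have [m mE] := density_glue l s P0.
    have AT := symmx_sym (tuple_mx z.2).
    have c0 := coef_neq0 l s P0.
    have da V : delta (Th z) (tuple_mx V) - alpha (Th z) (Sy z) (tuple_mx V) =
        quad (gamma_form (Th z) (Sy z)) (rowt V).
      by rewrite -quad_gamma// vec_mxK.
    pose g b := (coef l s z)^-1 * f b.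
    have mg : cmeas g by apply: cmeasM => //; exact: cmeas_cst.
    have gE b : g b = border_fun (l n.+1 - (2 * n.+1)%:R) (s n.+1)
        (delta (Th z) (tuple_mx b.1)) (alpha (Th z) (Sy z) (tuple_mx b.1))
        (m b.1) b.2.1 (rowt b.2.2).
      by rewrite /g fE mE mulKf.
    have := hasI_border (gamma_form_pos P0 AT) da mg gE (z0 _ _ h) (zs _ _ h).
    move=> /(hasIZ (coef l s z)).
    have -> : (Num.sqrt (\det (gamma_form (Th z) (Sy z))))%:C =
        ((qdet (cmx_quat (Th z)) * qdet (qmx (Th z) (Sy z)) ^+ 2)%:C)^-1.
      rewrite -(sqrt_det_gamma _ P0) -[RHS](fmorphV (real_complex R)).
      by rewrite invrK.
    rewrite invrK -(coef_integrand l s P0) -/(factor _ _ _) mulrCA.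
    by apply: eq_hasI => b; rewrite /g mulVKf.
  rewrite mulr0; apply: eq_hasI (hasI0 _) => b; rewrite fE /density ifN//.
  apply: contra zD; rewrite !inE /cone /= !mxtupleK => /posdef_glue[].
  by [].
apply: (hasI_push (@measurable_glue R n) (@lebesgue_glue R n)).
  exact: cmeas_density.
have mf : cmeas (density lam sig \o @glue R n).
  by apply: cmeas_comp; [exact: measurable_glue|exact: cmeas_density].
rewrite valueS.
apply: (hasI_fubini (m1 := mu_small R n) (m2 := mu_border R n) mf _
  (hasIZ (factor (lamR n.+1 - (2 * n.+1)%:R) (sigR n.+1) n) (IHn _ _ (adm' _ _ admR)))
  _ (hasIZ (factor (lam n.+1 - (2 * n.+1)%:R) (sig n.+1) n) (IHn _ _ (adm' _ _ adm)))).
- move=> z; apply: (step lamR sigR z) => // [|b]; last exact: normc_density.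
  by apply: cmeas_real; apply: cmeas_normc; exact: (cmeas_section z mf).
- move=> z; exact: (step lam sig z _ (cmeas_section z mf) adm (fun=> erefl)).
Qed.

End Induction.

(** * The integral formula *)

Theorem mainTheorem11 (R : realType) (n : nat) (lam sig : nat -> R[i])
  (n_gt0 : (1 <= n)%N)
  (lam_end : lam n.+1 = 0) (sig_end : sig n.+1 = 0)
  (lam_cond : forall k : nat, (1 <= k <= n)%N ->
     0 < complex.Re (lam k - (n + k)%:R))
  (sig_cond : forall k : nat, (1 <= k <= n)%N ->
     0 < complex.Re (sig k - lam k - (n%:R - k%:R))) :
  let mu := (lebesgue_tuple R (n * n) \x lebesgue_tuple R (n.+1 * n))%E in
  let T (p : (n * n).-tuple (measurableTypeR R) *
             (n.+1 * n).-tuple (measurableTypeR R)) : 'M[R[i]]_n :=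
    hermmx (tuple_mx p.1) in
  let S (p : (n * n).-tuple (measurableTypeR R) *
             (n.+1 * n).-tuple (measurableTypeR R)) : 'M[R[i]]_n :=
    symmx (tuple_mx p.2) in
  let D := [set p | posdefmx (T p)] in
  let F p : R[i] :=
    (\prod_(s < n)
       (cpow (qdet (lublock s (cmx_quat (T p)))) (lam s.+1 - lam s.+2) /
        cpow (qdet (lublock s
               (1%:M + cmx_quat (T p) + cmx_quat (S p) *m (quatJ R)%:M)))
             (sig s.+1 - sig s.+2)))
    * ((qdet (cmx_quat (T p))) ^- (2 * n + 1))%:C in
  cintegrable mu D F /\
  cintegral mu D F =
    \prod_(1 <= k < n.+1)
      (2 * (pi ^+ (2 * k - 1))%:C *
       (cGamma (lam k - (n + k)%:R) * cGamma (sig k - lam k - (n%:R - k%:R)) /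
        cGamma (sig k - 2 * (n%:R - k%:R) - 1))).
Proof.
move=> mu T S D F.
have adm : admissible n lam sig by move=> k kn; split; [exact: lam_cond|exact: sig_cond].
have FE p : D p -> F p = integrand lam sig (T p) (S p).
  move=> P0; have AT := symmx_sym (tuple_mx p.2).
  have xT k : (k <= n)%N -> 0 < minor (cmx_quat (T p)) k.
    by move=> kn; have [] := minor_gt0 P0 AT kn.
  have xS k : (k <= n)%N -> 0 < minor (qmx (T p) (S p)) k.
    by move=> kn; have [] := minor_gt0 P0 AT kn.
  rewrite /F /integrand -(weight_abel (minor0 _) xT lam_end).
  rewrite -(weight_abel (minor0 _) xS sig_end) -prodf_div.
  by congr (_ * _); apply: eq_bigr => s _; rewrite -!minor_lublock.
apply: cintegral_hasI; first exact: measurable_cone.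
apply: eq_hasI (hasI_density adm) => p; rewrite /density.
case: ifPn => [pD|//].
by rewrite FE//; rewrite inE in pD.
Qed.
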